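(* Let $F$ be the limit set of any conformal iterated function system (CIFS) $\{S_i:X\to X\}_{i\in I}$. Let $P$ be any subset of $\bigcup_{i\in I}S_i(X)$ which intersects $S_i(X)$ in exactly one point for each $i\in I$. For $\theta\in(0,1)$ and $\phi\in[\theta,1]$ put $$f(\theta,\phi)=\frac{(\phi^{-1}-1)\,\overline{\dim}_{\mathrm A}^{\phi}P+(\theta^{-1}-\phi^{-1})\,\overline{\dim}_{\mathrm B}F}{\theta^{-1}-1}.$$ Then for all $\theta\in(0,1)$, $$\max\{\dim_{\mathrm H}F,\ \overline{\dim}_{\mathrm A}^\theta P\}\ \le\ \overline{\dim}_{\mathrm A}^\theta F=\dim_{\mathrm A}^\theta F\ \le\ \max_{\phi\in[\theta,1]}f(\theta,\phi).$$
   Context: Notation: $\mathbb{N}=\{1,2,3,\dots\}$; $B(x,r)$ is the open Euclidean ball; $\mathcal{L}^d$ is Lebesgue measure; $N_r(E)$ is the smallest number of balls of radius $r$ needed to cover $E$; $\dim_{\mathrm H}$ and $\overline{\dim}_{\mathrm B}$ are Hausdorff and upper box dimension. CIFS: Let $d\in\mathbb{N}$, let $X$ be a compact connected subset of $\mathbb{R}^d$, let $I$ be a (non-empty) countable index set (finite or infinite), and let $S_i:X\to X$, $i\in I$. Put $I^*=\bigcup_{n\ge1}I^n$ (finite words), and for $w=w_1\cdots w_n\in I^n$ put $S_w=S_{w_1}\circ\cdots\circ S_{w_n}$. The system is a CIFS if: (1) (Open Set Condition) $U:=\mathrm{Int}_{\mathbb{R}^d}X\neq\varnothing$, $S_i(U)\subset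 U$ for all $i$, and $S_i(U)\cap S_j(U)=\varnothing$ for $i\ne j$; (2) (Cone condition) $\inf_{x\in X}\inf_{r\in(0,1)}\mathcal{L}^d(B(x,r)\cap \mathrm{Int}_{\mathbb{R}^d}X)/r^d>0$; (3) (Conformality) there is an open, bounded, connected $V\subset\mathbb{R}^d$ with $X\subset V$ and $\epsilon>0$ such that each $S_i$ extends to a $C^{1+\epsilon}$ diffeomorphism $\overline{S_i}$ from $V$ onto an open subset of $V$, which is conformal on $V$: for all $x\in V$ the differential $\overline{S_i}'|_x$ exists, is non-zero, is a similarity map ($\|\overline{S_i}'|_x(y)\|=\|\overline{S_i}'|_x\|\,\|y\|$ for all $y\in\mathbb{R}^d$), and is $\epsilon$-Hölder continuous in $x$. Moreover there is $\xi\in(0,1)$ with $\|\overline{S_i}'\|<\xi$ for all $i\in I$, where $\|\cdot\|$ is the supremum norm over $V$; (4) (Bounded distortion) there is $K>0$ with $\|S_w'|_y\|\le K\|S_w'|_x\|$ for all $x,y\in V$, $w\in I^*$ (derivatives of the composed extensions). The limit set is $F=\bigcup_{w\in I^{\mathbb{N}}}\bigcap_{n\ge1}S_{w|_n}(X)$, where $w|_n=w_1\cdots w_n$. Dimensions: for a non-empty bounded set $E\subset\mathbb{R}^d$ and $\theta\in(0,1)$, the Assouad spectrum is $\dim_{\mathrm A}^\theta E=\inf\{\alpha:\exists C>0\ \forall x\in E\ \forall\,0<R\le1,\ N_{R^{1/\theta}}(B(x,R)\cap E)\le CR^{\alpha(1-1/\theta)}\}$ and the upper Assouad spectrum is $\overline{\dim}_{\mathrm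 A}^\theta E=\inf\{\alpha:\exists C>0\ \forall x\in E\ \forall\,0<r\le R^{1/\theta}\le R\le1,\ N_r(B(x,R)\cap E)\le C(R/r)^\alpha\}$. The quasi-Assouad dimension is $\dim_{\mathrm{qA}}E=\lim_{\theta\to1^-}\dim_{\mathrm A}^\theta E=\lim_{\theta\to1^-}\overline{\dim}_{\mathrm A}^\theta E$, and by convention $\overline{\dim}_{\mathrm A}^1E:=\dim_{\mathrm{qA}}E$. For fixed $\theta$, $\phi\mapsto f(\theta,\phi)$ is continuous on $[\theta,1]$, so the maximum is attained. *)

(* Defs.v *)
From HB Require Import structures.
From mathcomp Require Import all_boot all_order all_algebra.
From mathcomp Require Import all_classical all_reals all_analysis.

Set Implicit Arguments.
Unset Strict Implicit.
Unset Printing Implicit Defensive.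

Import Order.TTheory GRing.Theory Num.Theory.
Import numFieldNormedType.Exports.

Local Open Scope classical_set_scope.
Local Open Scope ring_scope.

(* R^d is ['rV[R]_d]. The library norm on it is the
   sup norm; its topology, boundedness and differentials are those of the
   Euclidean norm [enorm], but balls, diameters and operator norms are not and
   are therefore taken with respect to [enorm] below. *)

Section EuclideanSpace.
Context {R : realType} {d : nat}.
Implicit Types (x y : 'rV[R]_d) (E U : set 'rV[R]_d).

Definition enorm x : R := Num.sqrt (\sum_(j < d) x 0 j ^+ 2).

Definition eball x (r : R) : set 'rV[R]_d := [set y | enorm (y - x) < r].

Definition opnorm (L : 'rV[R]_d -> 'rV[R]_d) : R :=
  sup [set enorm (L y) | y in [set y | enorm y <= 1]].

Definition box (a b : 'rV[R]_d) : set 'rV[R]_d :=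
  [set x | forall j, a 0 j <= x 0 j <= b 0 j].

(* d-dimensional Lebesgue outer measure, which is the Lebesgue measure on
   measurable sets; it is only applied to open sets. *)
Definition lebesgue_rV E : \bar R :=
  ereal_inf [set (\sum_(0 <= k <oo) (\prod_(j < d) ((ab k).2 0 j -
                                      (ab k).1 0 j))%:E)%E
            | ab in [set ab : nat -> 'rV[R]_d * 'rV[R]_d |
                (forall k j, (ab k).1 0 j <= (ab k).2 0 j) /\
                E `<=` \bigcup_k box (ab k).1 (ab k).2]].

Definition ediam U : \bar R :=
  ereal_sup [set (enorm (p.1 - p.2))%:E | p in U `*` U].

(* Finite covers are obtained by padding with empty sets, which contribute
   nothing to the sum (whatever the exponent). *)
Definition hausdorff_pre (s delta : R) E : \bar R :=
  ereal_inf [set (\sum_(0 <= k <oo | U k != set0) poweR (ediam (U k)) s)%E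
            | U in [set U : nat -> set 'rV[R]_d |
                (forall k, (ediam (U k) <= delta%:E)%E) /\
                E `<=` \bigcup_k U k]].

Definition hausdorff_measure (s : R) E : \bar R :=
  ereal_sup [set hausdorff_pre s delta E | delta in [set delta | 0 < delta]].

Definition hausdorff_dim E : R :=
  inf [set s | 0 <= s /\ hausdorff_measure s E = 0%E].

(* Centres are arbitrary points of R^d; the value is +oo when E has no finite
   cover. *)
Definition covering_number (r : R) E : \bar R :=
  ereal_inf [set (n%:R)%:E | n in [set n : nat |
    exists c : 'I_n -> 'rV[R]_d, E `<=` \bigcup_i eball (c i) r]].

Definition upper_box_dim E : R :=
  fine (limf_esup
    (fun r : R => (lne (covering_number r E) * ((- ln r)^-1)%:E)%E) 0^'+).

Definition assouad_spectrum (theta : R) E : R :=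
  inf [set alpha | exists2 C : R, 0 < C &
    forall x (rho : R), E x -> 0 < rho <= 1 ->
      (covering_number (rho `^ theta^-1) (eball x rho `&` E)
         <= (C * rho `^ (alpha * (1 - theta^-1)))%:E)%E].

Definition upper_assouad_spectrum_lt1 (theta : R) E : R :=
  inf [set alpha | exists2 C : R, 0 < C &
    forall x (r rho : R), E x ->
      0 < r -> r <= rho `^ theta^-1 -> rho `^ theta^-1 <= rho -> rho <= 1 ->
      (covering_number r (eball x rho `&` E)
         <= (C * (rho / r) `^ alpha)%:E)%E].

(* The upper spectrum is nondecreasing in theta, so this limit exists. It is
   also the limit of [assouad_spectrum theta E]. *)
Definition quasi_assouad_dim E : R :=
  lim (upper_assouad_spectrum_lt1 theta E @[theta --> 1^'-]).

Definition upper_assouad_spectrum (theta : R) E : R :=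
  if theta == 1 then quasi_assouad_dim E
  else upper_assouad_spectrum_lt1 theta E.

End EuclideanSpace.

Section CIFS.
Context {R : realType} {d : nat} {I : countType}.
Implicit Types (X V : set 'rV[R]_d) (f g : 'rV[R]_d -> 'rV[R]_d).

Definition C1_holder (eps : R) V f : Prop :=
  (forall x, V x -> differentiable f x) /\
  exists C : R, forall x y, V x -> V y ->
    opnorm (fun v => 'd f x v - 'd f y v) <= C * enorm (x - y) `^ eps.

(* The inverse of a C^{1+eps} bijection is in general C^{1+eps} only locally,
   the image of V being possibly non-convex. *)
Definition C1_holder_diffeo_into (eps : R) V f : Prop :=
  [/\ C1_holder eps V f, f @` V `<=` V, open (f @` V) &
      exists2 g, (forall x, V x -> g (f x) = x) &
        forall y, (f @` V) y -> exists2 W, nbhs y W & C1_holder eps W g].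

Definition conformal_on V f : Prop :=
  forall x, V x ->
    (exists v, 'd f x v != 0) /\
    (forall v, enorm ('d f x v) = opnorm ('d f x) * enorm v).

Definition sup_diff_norm V f : \bar R :=
  ereal_sup [set (opnorm ('d f x))%:E | x in V].

Definition word_map (S : I -> 'rV[R]_d -> 'rV[R]_d) (w : seq I) :
    'rV[R]_d -> 'rV[R]_d :=
  foldr (fun i f => S i \o f) id w.

Definition open_set_condition X (S : I -> 'rV[R]_d -> 'rV[R]_d) : Prop :=
  [/\ X° !=set0,
      forall i, S i @` X° `<=` X° &
      forall i j, i != j -> S i @` X° `&` S j @` X° = set0].

Definition cone_condition X : Prop :=
  (0 < ereal_inf [set lebesgue_rV (eball p.1 p.2 `&` X°) * ((p.2 ^+ d)^-1%R)%:E
                 | p in [set p : 'rV[R]_d * R | X p.1 /\ (0 < p.2 < 1)%R]])%E.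

Definition conformality V (eps : R) (T : I -> 'rV[R]_d -> 'rV[R]_d) : Prop :=
  [/\ forall i, C1_holder_diffeo_into eps V (T i),
      forall i, conformal_on V (T i) &
      exists2 xi : R, 0 < xi < 1 &
        forall i, (sup_diff_norm V (T i) < xi%:E)%E].

Definition bounded_distortion V (T : I -> 'rV[R]_d -> 'rV[R]_d) : Prop :=
  exists2 K : R, 0 < K &
    forall (w : seq I) x y, w != [::] -> V x -> V y ->
      opnorm ('d (word_map T w) y) <= K * opnorm ('d (word_map T w) x).

(* The maps X -> X are encoded as total functions, only the values on X of
   which matter; T collects their extensions to V. *)
Record is_CIFS X (S : I -> 'rV[R]_d -> 'rV[R]_d) : Prop := IsCIFS {
  cifs_index : [set: I] !=set0;
  cifs_compact : compact X;
  cifs_connected : connected X;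
  cifs_stable : forall i, S i @` X `<=` X;
  cifs_osc : open_set_condition X S;
  cifs_cone : cone_condition X;
  cifs_conformal : exists V (eps : R) (T : I -> 'rV[R]_d -> 'rV[R]_d),
    [/\ [/\ open V, bounded_set V, connected V & X `<=` V],
        0 < eps,
        forall i x, X x -> T i x = S i x,
        conformality V eps T &
        bounded_distortion V T] }.

Definition limit_set X (S : I -> 'rV[R]_d -> 'rV[R]_d) : set 'rV[R]_d :=
  \bigcup_(w in [set: nat -> I])
    \bigcap_(n in [set n | (0 < n)%N]) (word_map S (mkseq w n) @` X).

End CIFS.

Definition spectrum_bound {R : realType} {d : nat} (P F : set 'rV[R]_d)
    (theta phi : R) : R :=
  ((phi^-1 - 1) * upper_assouad_spectrum phi P +
   (theta^-1 - phi^-1) * upper_box_dim F) / (theta^-1 - 1).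

Definition is_maximum {R : realType} (A : set R) (m : R) : Prop :=
  A m /\ ubound A m.

(* Main.v *)
(* Bounded distortion makes each S_w a similarity on X of ratio rr w up to a constant, and
   the cone condition bounds the number of pieces S_w(X), |w| = n, of size at least rho that
   meet a ball of radius rho.

   - A pair of scales r <= R^(1/theta) around x is mapped by a suitable S_v to a pair of scales
     with equality, so the two spectra of F have the same admissible exponents.
   - A cover of F at scale r counts the pieces S_i(X) of size at least r, hence covers P up to
     a logarithm.
   - To cover B(x, R) in F at scale r, pull back by the longest prefixes of ratio at least R:
     only pieces S_i(F) of size at most R remain. The tiny ones are covered through P, and those
     of size s = R^(1/phi) cost N_s(P in B(x, R)) N_(r/s)(F), about (R/r)^(f(theta, phi)).
     Constants are made uniform in phi by a finite grid of values of 1/phi. *)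
Require Import Defs.
From HB Require Import structures.
From mathcomp Require Import all_boot all_order all_algebra.
From mathcomp Require Import all_classical all_reals all_analysis.
From mathcomp Require Import ring lra.

Set Implicit Arguments.
Unset Strict Implicit.
Unset Printing Implicit Defensive.

Import Order.TTheory GRing.Theory Num.Theory.
Import numFieldNormedType.Exports.

Local Open Scope classical_set_scope.
Local Open Scope ring_scope.

(** * Euclidean norm *)

Section EuclideanNorm.
Context {R : realType} {d : nat}.
Implicit Types (x y z : 'rV[R]_d) (r : R).

(** The alphabet may be infinite, and this shapes the argument. A word whose ratio is at least R can
    be followed by a letter of arbitrarily small ratio, so near a point F need not split into
    boundedly many pieces of size about R; the letters at that stage are seen only through P.
    Moreover the open set condition separates words of equal length only, so pieces are counted one
    length at a time. The resulting logarithmic factors, like the slack in the infima that define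
    the dimensions, cost an arbitrary e > 0 in the exponent; hence the work is done with admissible
    exponents instead of the spectra themselves. Pulling back by S_v divides both scales by the same
    ratio, so a pair with r = R^(1/theta) becomes one with only r <= R^(1/theta), and the main
    covering estimate must hold for all such pairs. The excess smallness of r is paid for by the
    upper box dimension of F, which is at most the maximum of f because it equals f(theta, 1). *)

Definition dotp x y : R := \sum_(j < d) x 0 j * y 0 j.

Lemma dotpC x y : dotp x y = dotp y x.
Proof. by apply: eq_bigr => j _; rewrite mulrC. Qed.

Lemma dotpDr x y z : dotp x (y + z) = dotp x y + dotp x z.
Proof.
by rewrite -big_split; apply: eq_bigr => j _; rewrite mxE mulrDr.
Qed.

Lemma dotpZr r x y : dotp x (r *: y) = r * dotp x y.
Proof.
by rewrite mulr_sumr; apply: eq_bigr => j _; rewrite mxE mulrCA.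
Qed.

Lemma dotpDl x y z : dotp (x + y) z = dotp x z + dotp y z.
Proof. by rewrite dotpC dotpDr !(dotpC z). Qed.

Lemma dotpZl r x y : dotp (r *: x) y = r * dotp x y.
Proof. by rewrite dotpC dotpZr dotpC. Qed.

Lemma dotp_ge0 x : 0 <= dotp x x.
Proof. by apply: sumr_ge0 => j _; rewrite -expr2 sqr_ge0. Qed.

Lemma enorm_ge0 x : 0 <= enorm x.
Proof. exact: sqrtr_ge0. Qed.

Lemma enorm_sqr x : enorm x ^+ 2 = dotp x x.
Proof. by rewrite sqr_sqrtr // sumr_ge0 // => j _; rewrite sqr_ge0. Qed.

Lemma enorm0 : enorm (0 : 'rV[R]_d) = 0.
Proof.
by rewrite /enorm big1 ?sqrtr0 // => j _; rewrite mxE expr0n.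
Qed.

Lemma enormZ r x : enorm (r *: x) = `|r| * enorm x.
Proof.
rewrite /enorm -sqrtr_sqr -sqrtrM ?sqr_ge0 //; congr Num.sqrt.
by rewrite mulr_sumr; apply: eq_bigr => j _; rewrite mxE exprMn.
Qed.

Lemma enormN x : enorm (- x) = enorm x.
Proof. by rewrite -scaleN1r enormZ normrN1 mul1r. Qed.

Lemma enormB x y : enorm (x - y) = enorm (y - x).
Proof. by rewrite -enormN opprB. Qed.

Lemma ler_abs_enorm x j : `|x 0 j| <= enorm x.
Proof.
rewrite -sqrtr_sqr; apply: ler_wsqrtr.
by rewrite (bigD1 j) //= lerDl sumr_ge0 // => i _; rewrite sqr_ge0.
Qed.

Lemma enorm_eq0 x : enorm x = 0 -> x = 0.
Proof.
move=> x0; apply/rowP => j; rewrite mxE; apply/normr0_eq0/le_anti.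
by rewrite normr_ge0 andbT -x0 ler_abs_enorm.
Qed.

Lemma dotp_le x y : dotp x y <= enorm x * enorm y.
Proof.
have [x0|x0] := eqVneq (enorm x) 0.
  have -> : dotp x y = 0.
    by apply: big1 => j _; rewrite (enorm_eq0 x0) mxE mul0r.
  by rewrite x0 mul0r.
have xp : 0 < enorm x by rewrite lt_neqAle eq_sym x0 enorm_ge0.
have [y0|y0] := eqVneq (enorm y) 0.
  have -> : dotp x y = 0.
    by apply: big1 => j _; rewrite (enorm_eq0 y0) mxE mulr0.
  by rewrite y0 mulr0.
have yp : 0 < enorm y by rewrite lt_neqAle eq_sym y0 enorm_ge0.
(* The square of |y| x - |x| y expands to 2 |x| |y| (|x| |y| - x.y). *)
have := dotp_ge0 (enorm y *: x + (- enorm x) *: y).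
rewrite !(dotpDl, dotpDr, dotpZl, dotpZr) -!enorm_sqr (dotpC y x) => h.
have : 0 <= (enorm x * enorm y) * (enorm x * enorm y - dotp x y) by lra.
by rewrite pmulr_rge0 ?mulr_gt0 // subr_ge0.
Qed.

Lemma enormD x y : enorm (x + y) <= enorm x + enorm y.
Proof.
rewrite -(@ler_pXn2r _ 2) ?nnegrE ?addr_ge0 ?enorm_ge0 //.
rewrite sqrrD !enorm_sqr !(dotpDl, dotpDr) (dotpC y x).
have := dotp_le x y; lra.
Qed.

Lemma enorm_tri x y z : enorm (x - z) <= enorm (x - y) + enorm (y - z).
Proof. by rewrite (le_trans _ (enormD _ _)) // addrA subrK. Qed.

Lemma norm_le_enorm x : `|x| <= enorm x.
Proof.
have -> : `|x| = mx_norm x by [].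
rewrite mx_normrE; apply: bigmax_le => [|[i j] _]; first exact: enorm_ge0.
by rewrite /= ord1 ler_abs_enorm.
Qed.

Lemma ler_abs_norm x j : `|x 0 j| <= `|x|.
Proof.
have -> : `|x| = mx_norm x by [].
by rewrite mx_normrE; apply/bigmax_geP; right; exists (0, j).
Qed.

Lemma enorm_le_norm x : enorm x <= d%:R * `|x|.
Proof.
rewrite -(@ler_pXn2r _ 2) ?nnegrE ?enorm_ge0 ?mulr_ge0 //.
rewrite enorm_sqr exprMn.
apply: (@le_trans _ _ (\sum_(j < d) `|x| ^+ 2)).
  apply: ler_sum => j _; rewrite -expr2 -[x 0 j ^+ 2]real_normK ?num_real //.
  by rewrite ler_pXn2r ?nnegrE // ler_abs_norm.
rewrite sumr_const card_ord -[leLHS]mulr_natl ler_wpM2r ?sqr_ge0 //.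
by rewrite -natrX ler_nat -mulnn; case: (d) => // n; rewrite leq_pmull.
Qed.

Lemma eball_center x r : 0 < r -> eball x r x.
Proof. by rewrite /eball /= subrr enorm0. Qed.

Lemma sub_eball x y r s : enorm (x - y) + r <= s -> eball x r `<=` eball y s.
Proof.
move=> h z; rewrite /eball /= => zx.
have := enorm_tri z x y; lra.
Qed.

Lemma eball_sub_ball x r : eball x r `<=` ball x r.
Proof.
move=> y; rewrite /eball /= -ball_normE /ball_ /= => h.
by rewrite distrC (le_lt_trans (norm_le_enorm _)).
Qed.

(** The factor [d.+1], not [d], stays positive in dimension 0, so it can be divided by. *)
Lemma ball_sub_eball x r : ball x r `<=` eball x (d.+1%:R * r).
Proof.
move=> y; rewrite /eball /= -ball_normE /ball_ /= distrC => h.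
apply: (le_lt_trans (enorm_le_norm _)).
have /le_lt_trans : d%:R * `|y - x| <= d.+1%:R * `|y - x|.
  by rewrite ler_wpM2r // ler_nat.
by apply; rewrite ltr_pM2l.
Qed.

Lemma nbhs_eball x r : 0 < r -> nbhs x (eball x r).
Proof.
move=> r0; apply/nbhs_ballP; exists (r / d.+1%:R) => /=.
  by rewrite divr_gt0.
by apply: (subset_trans (@ball_sub_eball _ _)); rewrite mulrC divfK.
Qed.

Lemma nbhs_eballP x (A : set 'rV[R]_d) :
  nbhs x A <-> exists2 r, 0 < r & eball x r `<=` A.
Proof.
split=> [/nbhs_ballP[r /= r0 rA]|[r r0 rA]].
  by exists r => //; apply: subset_trans rA; exact: eball_sub_ball.
by apply: filterS rA _; exact: nbhs_eball.
Qed.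

Lemma open_eball x r : open (eball x r).
Proof.
rewrite openE => y yx; apply/nbhs_eballP.
exists (r - enorm (y - x)); first by rewrite subr_gt0.
by apply: sub_eball; rewrite addrC subrK.
Qed.

Lemma compact_closed_eball x r : compact [set y | enorm (y - x) <= r].
Proof.
apply: bounded_closed_compact.
  exists (r + `|x|); split; first exact: num_real.
  move=> M hM y /= yx; have := norm_le_enorm (y - x).
  have := ler_normD (y - x) x; rewrite subrK; lra.
rewrite -[X in closed X]setCK; apply: open_closedC.
rewrite openE => y /= /negP; rewrite -ltNge => ry; apply/nbhs_eballP.
exists (enorm (y - x) - r); first by rewrite subr_gt0.
move=> z; rewrite /eball /= => zy; apply/negP; rewrite -ltNge.
have := enorm_tri y z x; rewrite (enormB y z); lra.
Qed.

Lemma bounded_eball (A : set 'rV[R]_d) : bounded_set A ->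
  exists2 D : R, 0 < D & forall x y, A x -> A y -> enorm (x - y) <= D.
Proof.
move=> [M [_ hM]]; exists (d.+1%:R * (2 * (`|M| + 1))).
  by rewrite !mulr_gt0 // ltr_wpDl.
move=> x y Ax Ay; apply: (le_trans (enorm_le_norm _)).
have MM : M < `|M| + 1 by rewrite (le_lt_trans (ler_norm _)) // ltrDl.
have := hM _ MM _ Ax; have := hM _ MM _ Ay => /= hy hx.
apply: ler_pM => //; first by rewrite ler_nat.
have := ler_normB x y; lra.
Qed.

End EuclideanNorm.

(** * Mean value inequality and images of balls *)

Section MeanValue.
Context {R : realType} {d : nat}.
Implicit Types (x y e v : 'rV[R]_d) (f g T : 'rV[R]_d -> 'rV[R]_d).

Lemma dotp_continuous e : continuous (dotp e : 'rV[R]_d -> R).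
Proof.
move=> x; apply/(@cvgrPdist_lt _ _ _ _ (nbhs_filter x)) => r r0.
apply/nbhs_eballP.
exists (r / (enorm e + 1)).
  by rewrite divr_gt0 // ltr_wpDl // enorm_ge0.
move=> y; rewrite /eball /= => yx.
have e0 := enorm_ge0 e.
have h (u : 'rV[R]_d) : dotp e u <= (enorm e + 1) * enorm u.
  rewrite (le_trans (dotp_le _ _)) // ler_wpM2r ?enorm_ge0 //.
  by rewrite lerDl.
have hr : (enorm e + 1) * enorm (y - x) < r.
  by rewrite mulrC -ltr_pdivlMr // ltr_wpDl.
rewrite -scaleN1r -[dotp e y]mul1r.
have -> : dotp e x + -1 *: (1 * dotp e y) = dotp e (x - y).
  by rewrite dotpDr -(scaleN1r y) dotpZr mul1r.
rewrite ltr_norml; have h1 := h (x - y); have := h (y - x).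
rewrite (_ : y - x = -1 *: (x - y)); last by rewrite scaleN1r opprB.
rewrite dotpZr scaleN1r opprB => h2.
rewrite enormB in h1; apply/andP; split; lra.
Qed.

Lemma is_diff_dotp e x : is_diff x (dotp e : 'rV[R]_d -> R) (dotp e).
Proof.
have dotl : linear (dotp e : 'rV[R]_d -> R).
  by move=> a u v; rewrite dotpDr dotpZr.
pose fM := GRing.isLinear.Build _ _ _ _ _ dotl.
pose fL : {linear _ -> _} := HB.pack (dotp e : 'rV[R]_d -> R) fM.
have -> : (dotp e : 'rV[R]_d -> R) = fL by [].
apply: DiffDef; first exact/linear_differentiable/dotp_continuous.
by rewrite diff_lin //; exact: dotp_continuous.
Qed.

Lemma is_derive_line (G : 'rV[R]_d -> R) x v (t l : R) :
  is_derive (x + t *: v) v G l -> is_derive t 1 (fun u : R => G (x + u *: v)) l.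
Proof.
have E : (fun h : R => h^-1 *: (G (h *: v + (x + t *: v)) - G (x + t *: v))) =
    (fun h : R => h^-1 *: (G (x + (h *: (1 : R) + t) *: v) - G (x + t *: v))).
  apply/funext => h; rewrite [h *: 1]mulr1 scalerDl.
  by rewrite (addrCA x).
move=> [GD Gl]; apply: DeriveDef.
  by rewrite /derivable in GD *; rewrite E in GD.
by rewrite /derive -E.
Qed.

(** The mean value theorem fails for vector values; it is applied to the scalar function t |-> e .
    f(x + t v) with e the increment of [f], which gives |e|^2 <= |e| L. *)
Lemma mean_value_enorm f x v (L : R) :
  (forall t : R, 0 <= t <= 1 -> differentiable f (x + t *: v)) ->
  (forall t : R, 0 <= t <= 1 -> enorm ('d f (x + t *: v) v) <= L) ->
  enorm (f (x + v) - f x) <= L.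
Proof.
move=> fd fL; set e := f (x + v) - f x.
pose h (t : R) := dotp e (f (x + t *: v)).
have hD (t : R) : 0 <= t <= 1 ->
    is_derive t 1 h (dotp e ('d f (x + t *: v) v)).
  move=> t01; refine (@is_derive_line (dotp e \o f) x v t _ _).
  have fd' : is_diff (x + t *: v) f ('d f (x + t *: v)).
    by apply: DiffDef => //; exact: fd.
  have gd := is_diff_comp fd' (is_diff_dotp e (f (x + t *: v))).
  apply: DeriveDef; first by apply: diff_derivable; exact: ex_diff.
  by rewrite deriveE ?diff_val //; exact: ex_diff.
have [||c] := @MVT R h (fun t => dotp e ('d f (x + t *: v) v)) 0 1 ltr01.
- by move=> t /itvP t01; apply: hD; rewrite !t01.
- apply: derivable_within_continuous => t /itvP t01.
  by have [] : is_derive t 1 h (dotp e ('d f (x + t *: v) v)) by apply: hD; rewrite !t01.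
rewrite in_itv /= => /andP[c0 c1].
rewrite /h scale1r scale0r addr0 subr0 mulr1 => hc.
have : dotp e e <= enorm e * L.
  rewrite {2}/e -scaleN1r dotpDr dotpZr mulN1r hc.
  rewrite (le_trans (dotp_le _ _)) // ler_wpM2l ?enorm_ge0 // fL //.
  by rewrite !ltW.
rewrite -enorm_sqr expr2.
have [->|e0] := eqVneq (enorm e) 0.
  move=> _; apply: le_trans (fL 0 _); last by rewrite lexx ler01.
  exact: enorm_ge0.
by rewrite ler_pM2l // lt_neqAle eq_sym e0 enorm_ge0.
Qed.

(* Lift to the domain, by the inverse g, the segment from T x to a point of the ball:
   as long as it stays in the image, its lift stays at distance less than s from x,
   so it can never leave the image. *)
Lemma ball_in_image T g x (s c : R) : 0 < c ->
  (forall y, eball x s y -> differentiable T y) ->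
  (forall y, eball x s y -> g (T y) = y) ->
  open (T @` eball x s) ->
  (forall y, eball x s y -> differentiable g (T y)) ->
  (forall y v, eball x s y -> c * enorm v <= enorm ('d T y v)) ->
  eball (T x) (c * s) `<=` T @` eball x s.
Proof.
move=> c0 Td gT TO gd Tc.
have [s0|s0] := ltP 0 s; last first.
  move=> z; rewrite /eball /= => hz; have := enorm_ge0 (z - T x).
  by have := ler_wpM2l (ltW c0) s0; rewrite mulr0; lra.
(* Near [T y] the composite [T \o g] is the identity, because the image is open; the lower bound on
   ['d T] thus becomes an upper bound on ['d g]. *)
have dg y u : eball x s y -> enorm ('d g (T y) u) <= c^-1 * enorm u.
  move=> ys; rewrite mulrC ler_pdivlMr // mulrC.
  apply: le_trans (Tc y _ ys) _.
  have Tgy : differentiable T (g (T y)) by rewrite gT //; exact: Td.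
  have e1 : 'd (T \o g) (T y) u = 'd T y ('d g (T y) u).
    have E z : z = y -> 'd T z ('d g (T y) u) = 'd T y ('d g (T y) u).
      by move=> ->.
    transitivity ('d T (g (T y)) ('d g (T y) u)); last exact: (E _ (gT _ ys)).
    exact: (congr1 (fun F => F u) (diff_comp (gd _ ys) Tgy)).
  have dTg : differentiable (T \o g) (T y).
    exact: differentiable_comp (gd _ ys) Tgy.
  rewrite -e1 -deriveE // (_ : 'D_u (T \o g) (T y) = u) //.
  have -> : 'D_u (T \o g) (T y) = 'D_u id (T y).
    have [->|u0] := eqVneq u 0; first by rewrite !derive0.
    apply: near_eq_derive => //.
    have : open_nbhs (T y) (T @` eball x s) by split=> //; exists y.
    move=> /open_nbhs_nbhs; apply: filterS => z [w ws <-] /=.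
    by rewrite gT.
  by rewrite derive_id.
move=> z zs; apply: contrapT => zn.
pose p (t : R) := T x + t *: (z - T x).
have p0 : p 0 = T x by rewrite /p scale0r addr0.
have pc : continuous p.
  move=> t; apply: cvgD; first exact: cvg_cst.
  exact: scalel_continuous.
pose O : set R := p @^-1` (T @` eball x s).
have OO : open O by apply: open_comp => // t _; exact: pc.
pose s' := c^-1 * enorm (z - T x).
have s's : s' < s by rewrite /s' mulrC ltr_pdivrMr // mulrC.
(* [A] holds the times at which the segment is outside the image; its infimum [t0] is the first exit
   time, and the exit point itself is outside because the image is open. *)
pose A : set R := [set t | 0 <= t /\ ~ O t].
have A1 : A 1 by split; rewrite // /O /= /p scale1r addrC subrK.
have lbA : lbound A 0 by move=> t [].
have hA : has_inf A by split; [exists 1|exists 0].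
pose t0 := inf A.
have t00 : 0 <= t0 by apply: lb_le_inf => //; exists 1.
have t01 : t0 <= 1 by apply: ge_inf => //; exists 0.
have At t : 0 <= t -> t < t0 -> O t.
  move=> t0' tt0; apply: contrapT => On.
  by have : t0 <= t; [apply: ge_inf => //; exists 0|rewrite leNgt tt0].
have nO : ~ O t0.
  move=> Ot0; have /nbhs_ballP[e /= e0 eO] := open_nbhs_nbhs (conj OO Ot0).
  have /(_ (e / 2)) := inf_adherent _ hA; rewrite divr_gt0 // => /(_ isT)[t [t0' nt] tlt].
  have tt : t0 <= t by apply: ge_inf => //; exists 0.
  apply: nt; apply: eO; rewrite -ball_normE /= distrC ger0_norm ?subr_ge0 //.
  rewrite -/t0 in tlt; lra.
have t0p : 0 < t0.
  rewrite lt_neqAle t00 andbT; apply/eqP => t0E; apply: nO.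
  by rewrite -t0E /O /= p0; exists x => //; exact: eball_center.
have gO t : 0 <= t -> t < t0 -> enorm (g (p t) - x) <= s'.
  move=> tp tt0.
  have seg (u : R) : 0 <= u <= 1 -> exists2 y, eball x s y & T x + u *: (p t - T x) = T y.
    move=> /andP[u0 u1].
    have -> : T x + u *: (p t - T x) = p (u * t).
      by rewrite /p addrAC subrr add0r scalerA.
    have [|y yB yE] := At (u * t) (mulr_ge0 u0 tp); last by exists y.
    by rewrite (le_lt_trans _ tt0) // ler_piMl.
  have -> : g (p t) - x = g (T x + (p t - T x)) - g (T x).
    by rewrite (addrC (T x)) subrK (gT x) //; exact: eball_center.
  apply: mean_value_enorm => u u01; have [y yB ->] := seg u u01; first exact: gd.
  apply: le_trans (dg _ _ yB) _; rewrite ler_wpM2l ?invr_ge0 ?(ltW c0) //.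
  rewrite /p addrAC subrr add0r enormZ ger0_norm // ler_piMl ?enorm_ge0 //.
  lra.
(* Before [t0] the lift stays in the closed ball of radius s' < s, whose image is compact, so the
   exit point still belongs to the image: a contradiction. *)
have cK : closed (T @` [set y | enorm (y - x) <= s']).
  apply: compact_closed; first exact: norm_hausdorff.
  apply: continuous_compact; last exact: compact_closed_eball.
  apply: continuous_in_subspaceT => y; rewrite inE /= => yx.
  apply: differentiable_continuous; apply: Td.
  by rewrite /eball /= (le_lt_trans yx).
have : (T @` [set y | enorm (y - x) <= s']) (p t0).
  apply: cK => B /pc /nbhs_ballP[e /= e0 eB].
  pose t := Num.max 0 (t0 - e / 2).
  have tp : 0 <= t by rewrite le_max lexx.
  have tt0 : t < t0 by rewrite gt_max t0p /= gtrBl divr_gt0.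
  exists (p t); split.
    have [y yB yE] := At _ tp tt0; exists y => //=.
    by rewrite -(gT y yB) yE; exact: gO.
  apply: eB; rewrite -ball_normE /= ger0_norm ?subr_ge0 ?(ltW tt0) //.
  rewrite ltrBlDr -ltrBlDl lt_max; apply/orP; right; lra.
move=> [y /= yx yE]; apply: nO; exists y => //.
by rewrite /eball /= (le_lt_trans yx).
Qed.
End MeanValue.

(** * Word maps *)

Section Similarities.
Context {R : realType} {d : nat}.
Implicit Types (L : 'rV[R]_d -> 'rV[R]_d).

(** A unit vector attains the supremum; in dimension 0 there is none and [a] would not be
    determined. *)
Lemma opnorm_similarity L (a : R) : (0 < d)%N -> 0 <= a ->
  (forall v, enorm (L v) = a * enorm v) -> opnorm L = a.
Proof.
move=> d0 a0 La; pose e : 'rV[R]_d := delta_mx 0 (Ordinal d0).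
have e1 : enorm e = 1.
  rewrite /enorm (bigD1 (Ordinal d0)) //= !mxE !eqxx expr1n.
  by rewrite big1 ?addr0 ?sqrtr1 // => j jn; rewrite !mxE (negPf jn) andbF expr0n.
have E : [set enorm (L y) | y in [set y | enorm y <= 1]] a.
  by exists e => /=; rewrite ?La e1 ?mulr1.
have ub : ubound [set enorm (L y) | y in [set y | enorm y <= 1]] a.
  by move=> _ [y /= y1 <-]; rewrite La ler_piMr.
apply/le_anti/andP; split; first by apply: ge_sup => //; exists a.
by apply: ub_le_sup => //; exists a.
Qed.

End Similarities.

Section WordMaps.
Context {R : realType} {d : nat} {I : countType}.
Implicit Types (T : I -> 'rV[R]_d -> 'rV[R]_d) (w u : seq I) (x y : 'rV[R]_d).

Lemma word_map_cat T u w : word_map T (u ++ w) = word_map T u \o word_map T w.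
Proof. by elim: u => //= i u ->. Qed.

Lemma eq_word_map T S (X : set 'rV[R]_d) w x : (forall i, S i @` X `<=` X) ->
  (forall i x, X x -> T i x = S i x) -> X x ->
  word_map T w x = word_map S w x /\ X (word_map S w x).
Proof.
move=> SX TS Xx; elim: w => //= i w [-> Xw]; rewrite TS //; split=> //.
by apply: (SX i); exists (word_map S w x).
Qed.

Variables (V : set 'rV[R]_d) (eps : R) (T : I -> 'rV[R]_d -> 'rV[R]_d).
Hypotheses (d0 : (0 < d)%N) (cT : conformality V eps T).

Lemma word_map_in w x : V x -> V (word_map T w x).
Proof.
move=> Vx; elim: w => //= i w Vw.
by have [/(_ i) [_ + _ _] _ _] := cT; apply; exists (word_map T w x).
Qed.

Lemma letter_differentiable i x : V x -> differentiable (T i) x.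
Proof. by have [/(_ i) [[+ _] _ _ _] _ _] := cT; apply. Qed.

Lemma word_map_differentiable w x : V x -> differentiable (word_map T w) x.
Proof.
move=> Vx; elim: w => [|i w IH] /=.
  by have [] := is_diff_id x.
apply: differentiable_comp => //; apply: letter_differentiable.
exact: word_map_in.
Qed.

Lemma letter_inverse i : exists g, forall x, V x ->
  g (T i x) = x /\ differentiable g (T i x).
Proof.
have [/(_ i) [_ _ _ [g gT gd]] _ _] := cT; exists g => x Vx.
split; first exact: gT.
have [|W Wx [Wd _]] := gd (T i x); first by exists x.
by apply: Wd; exact: nbhs_singleton.
Qed.

(** Inside the open image of [V], the image of [O] is the preimage of [O] under the continuous
    inverse. *)
Lemma letter_open i (O : set 'rV[R]_d) :
  open O -> O `<=` V -> open (T i @` O).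
Proof.
move=> Oo OV; have [g gT] := letter_inverse i.
have [/(_ i) [_ _ TVo _] _ _] := cT.
rewrite openE => _ [x Ox <-]; have Vx := OV _ Ox.
have [gx /differentiable_continuous gc] := gT x Vx.
have : nbhs (T i x) (g @^-1` O).
  by apply: gc; rewrite gx; exact: open_nbhs_nbhs.
have : nbhs (T i x) (T i @` V).
  by apply: open_nbhs_nbhs; split=> //; exists x.
apply: filterS2 => z [y Vy <-] /=; rewrite (gT y Vy).1 => Oy.
by exists y.
Qed.

Lemma word_map_open w (O : set 'rV[R]_d) :
  open O -> O `<=` V -> open (word_map T w @` O).
Proof.
move=> Oo OV; elim: w => [|i w IH] /=; first by rewrite image_id.
rewrite -image_comp; apply: letter_open => // _ [x Ox <-].
by apply: word_map_in; exact: OV.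
Qed.

Lemma word_map_inverse w : exists g, forall x, V x ->
  g (word_map T w x) = x /\ differentiable g (word_map T w x).
Proof.
elim: w => [|i w [g gP]] /=.
  exists id => y _; split=> //.
have [h hP] := letter_inverse i; exists (g \o h) => x Vx.
have [h1 h2] := hP _ (word_map_in w Vx); have [g1 g2] := gP _ Vx.
rewrite /= h1 g1; split=> //; apply: differentiable_comp => //.
by rewrite h1.
Qed.

Lemma word_map_inj w x y : V x -> V y ->
  word_map T w x = word_map T w y -> x = y.
Proof.
have [g gP] := word_map_inverse w => Vx Vy E.
by rewrite -(gP x Vx).1 -(gP y Vy).1 E.
Qed.

Definition ratio w x := opnorm ('d (word_map T w) x).

Lemma ratio_nil x :
  ratio [::] x = 1 /\ forall v, enorm ('d (word_map T [::]) x v) = enorm v.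
Proof.
have E : 'd (word_map T [::]) x = id :> ('rV[R]_d -> 'rV[R]_d).
  by have [] := is_diff_id x.
rewrite /ratio E; split=> //.
by apply: opnorm_similarity => // v; rewrite mul1r.
Qed.

Lemma letter_similarity i x : V x -> 0 < opnorm ('d (T i) x) /\
  forall v, enorm ('d (T i) x v) = opnorm ('d (T i) x) * enorm v.
Proof.
move=> Vx; have [_ /(_ i x Vx) [[v v0] h] _] := cT; split=> //.
have : 0 < enorm ('d (T i) x v).
  rewrite lt_neqAle enorm_ge0 andbT eq_sym; apply: contra_neq v0.
  exact: enorm_eq0.
rewrite h; have := enorm_ge0 v; rewrite le_eqVlt => /orP[/eqP <-|v1].
  by rewrite mulr0 ltxx.
by rewrite pmulr_lgt0.
Qed.

Lemma word_similarity w x : V x -> 0 < ratio w x /\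
  forall v, enorm ('d (word_map T w) x v) = ratio w x * enorm v.
Proof.
move=> Vx; elim: w => [|i w [r0 IH]].
  by have [-> h] := ratio_nil x; split=> // v; rewrite h mul1r.
have [i0 ih] := letter_similarity i (word_map_in w Vx).
have E v : enorm ('d (word_map T (i :: w)) x v) =
    (opnorm ('d (T i) (word_map T w x)) * ratio w x) * enorm v.
  have cd := diff_comp (word_map_differentiable w Vx)
    (letter_differentiable i (word_map_in w Vx)).
  apply: (etrans (congr1 (fun F => enorm (F v)) cd)).
  apply: (etrans (ih _)); apply: (etrans (congr1 ( *%R _) (IH v))).
  exact: mulrA.
have -> : ratio (i :: w) x = opnorm ('d (T i) (word_map T w x)) * ratio w x.
  exact: (opnorm_similarity d0 (ltW (mulr_gt0 i0 r0)) E).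
exact (conj (mulr_gt0 i0 r0) E).
Qed.

(** The chain rule is exact for operator norms because the differentials are similarities. *)
Lemma ratio_cat u w x : V x ->
  ratio (u ++ w) x = ratio u (word_map T w x) * ratio w x.
Proof.
move=> Vx; have [r0 h] := word_similarity w Vx.
have [r1 h1] := word_similarity u (word_map_in w Vx).
apply: (opnorm_similarity d0 (ltW (mulr_gt0 r1 r0))) => v.
have cd := diff_comp (word_map_differentiable w Vx)
  (word_map_differentiable u (word_map_in w Vx)).
rewrite word_map_cat; apply: (etrans (congr1 (fun F => enorm (F v)) cd)).
apply: (etrans (h1 _)); apply: (etrans (congr1 ( *%R _) (h v))).
exact: mulrA.
Qed.

Lemma ratio_le : exists2 xi : R, 0 < xi < 1 &
  forall w x, V x -> ratio w x <= xi ^+ size w.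
Proof.
have [_ _ [xi xi01 hxi]] := cT; exists xi => // w x Vx.
elim: w => [|i w IH]; first by have [-> _] := ratio_nil x.
rewrite -cat1s ratio_cat // exprS; apply: ler_pM => //.
- by apply: ltW; have [] := word_similarity [:: i] (word_map_in w Vx).
- by apply: ltW; have [] := word_similarity w Vx.
- rewrite -lee_fin; apply: le_trans (ltW (hxi i)).
  by apply: ereal_sup_ubound; exists (word_map T w x) => //; exact: word_map_in.
Qed.

End WordMaps.

(** * Bi-Lipschitz estimates *)

Section CompactSets.
Context {R : realType} {d : nat}.
Implicit Types (x y z : 'rV[R]_d) (A V X : set 'rV[R]_d).

Lemma compact_increasing (E : ptopologicalType) (A : set E) (O : nat -> set E) :
  compact A -> (forall n, open (O n)) ->
  (forall n m, (n <= m)%N -> O n `<=` O m) -> A `<=` \bigcup_n O n ->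
  exists n, A `<=` O n.
Proof.
rewrite compact_cover => cA Oo Oi AO.
have [|D _ AD] := cA nat setT O (fun n _ => Oo n).
  by move=> x /AO [n _ On]; exists n.
exists (\max_(n <- finmap.enum_fset D) n)%N => x /AD [n /= nD On].
by apply: Oi On; apply: leq_bigmax_seq.
Qed.

(** [O n] is made of balls of radius [r m], m <= n, whose concentric doubles lie in [V]; the
    doubling leaves room for a ball of radius [r n] around each of its points. Compactness stops the
    increasing sequence. *)
Lemma lebesgue_number A V : compact A -> open V -> A `<=` V ->
  exists2 s : R, 0 < s & forall x, A x -> eball x s `<=` V.
Proof.
move=> cA Vo AV; pose r n : R := n.+1%:R^-1.
have r0 n : 0 < r n by rewrite invr_gt0.
have rm n m : (n <= m)%N -> r m <= r n.
  by move=> nm; rewrite lef_pV2 ?posrE // ler_nat ltnS.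
pose O n := \bigcup_(p in [set p : 'rV[R]_d * nat |
  (p.2 <= n)%N /\ eball p.1 (2 * r p.2) `<=` V]) eball p.1 (r p.2).
have [n||x Ax|n AO] := @compact_increasing _ A O cA.
- by apply: bigcup_open => x _; exact: open_eball.
- move=> n m nm y [p [pn pV] yp]; exists p => //; split=> //.
  exact: leq_trans nm.
- have /nbhs_eballP[e e0 eV] := open_nbhs_nbhs (conj Vo (AV _ Ax)).
  pose n := Num.truncn (2 / e); exists n => //.
  exists (x, n); last exact: eball_center.
  split=> //=; apply: subset_trans eV; apply: sub_eball.
  rewrite subrr enorm0 add0r ler_pdivrMr ?ltr0n // mulrC -ler_pdivrMr //.
  exact/ltW/truncnS_gt.
exists (r n) => // x /AO [[y m] /= [mn yV]]; rewrite /eball /= => xy.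
apply: subset_trans yV; apply: sub_eball; have := rm _ _ mn; lra.
Qed.

(** [D n] is any property inherited after n jumps of length less than [s]. The points reached and
    the points not reached both have open s-neighbourhoods, so connectedness leaves none unreached;
    compactness bounds the number of jumps. *)
Lemma connected_chain X x0 (s : R) (D : nat -> set 'rV[R]_d) :
  compact X -> connected X -> X x0 -> 0 < s -> D 0%N x0 ->
  (forall n x y, X x -> X y -> D n x -> enorm (y - x) < s -> D n.+1 y) ->
  exists n, forall x, X x -> exists2 k, (k <= n)%N & D k x.
Proof.
move=> cX coX Xx0 s0 D0 DS.
pose U n := \bigcup_(p in [set p | X p /\ exists2 k, (k <= n)%N & D k p]) eball p s.
have Uo n : open (U n) by apply: bigcup_open => x _; exact: open_eball.
have Ui n m : (n <= m)%N -> U n `<=` U m.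
  move=> nm y [x [Xx [k kn Dk]] yx]; exists x => //; split=> //.
  by exists k => //; exact: leq_trans nm.
have XU : X `<=` \bigcup_n U n.
  pose B := X `&` \bigcup_n U n.
  suff -> : X = B by move=> x [].
  apply/esym/coX.
  - exists x0; split=> //; exists 0%N => //; exists x0; last exact: eball_center.
    by split=> //; exists 0%N.
  - by exists (\bigcup_n U n) => //; apply: bigcup_open => n _.
  - pose W := \bigcup_(z in X `\` \bigcup_n U n) eball z s.
    exists (~` W).
      by apply: open_closedC; apply: bigcup_open => z _; exact: open_eball.
    apply/seteqP; split=> x [Xx]; last first.
      move=> nW; split=> //; apply: contrapT => nU; apply: nW.
      by exists x => //; exact: eball_center.
    move=> [n _ [p [Xp [k kn Dk]] xp]]; split=> // -[z [Xz nz]] xz; apply: nz.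
    exists k.+1 => //; exists x; last by rewrite /eball /= enormB.
    by split=> //; exists k.+1 => //; exact: (DS _ p).
have [n hn] := compact_increasing cX Uo Ui XU.
exists n.+1 => x Xx; have [p [Xp [k kn Dk]] xp] := hn x Xx.
by exists k.+1 => //; exact: (DS _ p).
Qed.

End CompactSets.

Section BiLipschitz.
Context {R : realType} {d : nat} {I : countType}.
Variables (V : set 'rV[R]_d) (eps K : R) (T : I -> 'rV[R]_d -> 'rV[R]_d).
Hypotheses (d0 : (0 < d)%N) (cT : conformality V eps T) (Vo : open V).
Hypotheses (K1 : 1 <= K) (distortion : forall w x y, V x -> V y ->
  ratio T w y <= K * ratio T w x).
Implicit Types (w : seq I) (x y : 'rV[R]_d) (s : R).

Let K0 : 0 < K. Proof. exact: lt_le_trans K1. Qed.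

Lemma ratio_gt0 w x : V x -> 0 < ratio T w x.
Proof. by move=> Vx; have [] := word_similarity d0 cT w Vx. Qed.

(** By distortion the differential expands by at least ratio / K throughout the ball, which is the
    constant [c] of [ball_in_image]. *)
Lemma word_map_ball w x s : V x -> eball x s `<=` V ->
  eball (word_map T w x) (ratio T w x / K * s) `<=` word_map T w @` eball x s.
Proof.
move=> Vx sV; have [g gP] := word_map_inverse cT w.
have c0 : 0 < ratio T w x / K by rewrite divr_gt0 // ratio_gt0.
apply: (@ball_in_image R d _ g) => //.
- move=> y /sV Vy; exact: (word_map_differentiable cT).
- by move=> y /sV /gP [].
- exact: (word_map_open cT (@open_eball _ _ _ _) sV).
- by move=> y /sV /gP [].
- move=> y v /sV Vy; have [_ ->] := word_similarity d0 cT w Vy.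
  by rewrite ler_wpM2r ?enorm_ge0 // ler_pdivrMr // mulrC distortion.
Qed.

Lemma word_map_lipschitz_ball w x y s : V x -> eball x s `<=` V ->
  eball x s y -> enorm (word_map T w y - word_map T w x) <=
    K * ratio T w x * enorm (y - x).
Proof.
move=> Vx sV yx.
have xt (t : R) : 0 <= t <= 1 -> V (x + t *: (y - x)).
  move=> /andP[t0 t1]; apply: sV; rewrite /eball /= addrAC subrr add0r enormZ.
  rewrite ger0_norm //; apply: le_lt_trans yx.
  by rewrite ler_piMl // enorm_ge0.
rewrite -{1}(subrK x y) (addrC _ x); apply: mean_value_enorm => t /xt Vt.
  exact: (word_map_differentiable cT).
have [_ ->] := word_similarity d0 cT w Vt.
by rewrite ler_wpM2r ?enorm_ge0 // distortion.
Qed.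

Variables (X : set 'rV[R]_d) (x0 : 'rV[R]_d).
Hypotheses (cX : compact X) (coX : connected X) (XV : X `<=` V) (Xx0 : X x0).

(* The upper bound for distant points comes from connecting them by a chain of
   bounded length in X, the lower bound from [word_map_ball]. *)
Lemma word_map_bilipschitz : exists2 C : R, 1 <= C &
  forall w x y, X x -> X y ->
    enorm (word_map T w x - word_map T w y) <= C * ratio T w x0 * enorm (x - y)
    /\ ratio T w x0 * enorm (x - y) <=
         C * enorm (word_map T w x - word_map T w y).
Proof.
have KK : 1 <= K * K by rewrite -[leLHS]mulr1 ler_pM.
have [s s0 sV] := lebesgue_number cX Vo XV.
have [D D0 XD] := bounded_eball (compact_bounded cX).
have r0 w : 0 < ratio T w x0 by apply: ratio_gt0; exact: XV.
have rK w x : X x -> ratio T w x <= K * ratio T w x0.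
  by move=> Xx; apply: distortion; exact: XV.
have loc w x y : X x -> X y -> enorm (x - y) < s ->
    enorm (word_map T w x - word_map T w y) <=
      K * (K * ratio T w x0) * enorm (x - y).
  move=> Xx Xy xy; apply: le_trans (word_map_lipschitz_ball w (XV Xy) (sV _ Xy) xy) _.
  by rewrite ler_wpM2r ?enorm_ge0 // ler_wpM2l ?rK // ltW.
pose E (n : nat) : set 'rV[R]_d := [set x | forall w,
  enorm (word_map T w x - word_map T w x0) <= n%:R * (K * K * ratio T w x0 * s)].
have [||n hn] := @connected_chain R d X x0 s E cX coX Xx0 s0.
- by move=> w; rewrite subrr enorm0 mul0r.
- move=> n x y Xx Xy Ex yx w.
  have := enorm_tri (word_map T w y) (word_map T w x) (word_map T w x0).
  have := loc w y x Xy Xx yx; have := Ex w; rewrite -natr1.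
  have : K * (K * ratio T w x0) * enorm (y - x) <= K * (K * ratio T w x0) * s.
    by rewrite ler_wpM2l ?(ltW yx) // !mulr_ge0 ?(ltW K0) // ltW.
  nra.
have diam w x : X x -> enorm (word_map T w x - word_map T w x0) <=
    n%:R * (K * K * ratio T w x0 * s).
  move=> Xx; have [k kn Ek] := hn x Xx; apply: le_trans (Ek w) _.
  by rewrite ler_wpM2r ?ler_nat // !mulr_ge0 ?(ltW K0) ?(ltW s0) // ltW.
exists (K * K * (2 * n%:R + 1) + K * K * (D / s + 1)).
  have h2 : 0 <= D / s by rewrite divr_ge0 // ltW.
  have h3 : (0 : R) <= n%:R by [].
  nra.
move=> w x y Xx Xy; move: (r0 w) => {}r0.
have Ds : 0 <= D / s by rewrite divr_ge0 // ltW.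
have n0 : (0 : R) <= n%:R by [].
have e0 := enorm_ge0 (x - y).
have A0 : 0 <= K * K * (2 * n%:R + 1).
  by rewrite !mulr_ge0 ?(ltW K0) // addr_ge0 // mulr_ge0.
have B0 : 0 <= K * K * (D / s + 1) by rewrite !mulr_ge0 ?(ltW K0) // addr_ge0.
split.
- apply: (@le_trans _ _ (K * K * (2 * n%:R + 1) * ratio T w x0 * enorm (x - y))); last first.
    by rewrite ler_wpM2r // ler_wpM2r ?(ltW r0) // lerDl.
  have [xys|sxy] := ltP (enorm (x - y)) s.
    apply: le_trans (loc w x y Xx Xy xys) _.
    rewrite mulrA ler_wpM2r // ler_wpM2r ?(ltW r0) // ler_peMr ?mulr_ge0 ?(ltW K0) //.
    by rewrite lerDr mulr_ge0.
  apply: (le_trans (enorm_tri _ (word_map T w x0) _)).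
  rewrite (enormB (word_map T w x0)).
  have h1 := diam w x Xx; have h2 := diam w y Xy.
  apply: (@le_trans _ _ (2 * n%:R * (K * K * ratio T w x0 * s))); first lra.
  have : K * K * ratio T w x0 * s <= K * K * ratio T w x0 * enorm (x - y).
    by rewrite ler_wpM2l // !mulr_ge0 ?(ltW K0) ?(ltW r0).
  set a := K * K * _ * _; set b := _ * enorm _ => ab.
  have -> : K * K * (2 * n%:R + 1) * ratio T w x0 * enorm (x - y) = (2 * n%:R + 1) * b.
    by rewrite /b; ring.
  have : 0 <= a by rewrite !mulr_ge0 // ltW.
  nra.
set h := enorm (word_map T w x - word_map T w y).
have h0 : 0 <= h by exact: enorm_ge0.
have rxK : ratio T w x0 <= K * ratio T w x by apply: distortion; exact: XV.
have rx0 : 0 < ratio T w x := ratio_gt0 w (XV Xx).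
(* If the image of [y] falls in the inner ball of the image of B(x, t), injectivity puts [y] itself
   in B(x, t). Used below with t = |x - y| or t = s, this excludes that distant points have very
   close images. *)
have ball_y (t : R) : t <= s -> h < ratio T w x / K * t -> enorm (x - y) < t.
  move=> ts ht.
  have tV : eball x t `<=` V.
    by apply: subset_trans (sV _ Xx); apply: sub_eball; rewrite subrr enorm0 add0r.
  have : eball (word_map T w x) (ratio T w x / K * t) (word_map T w y).
    by rewrite /eball /= enormB.
  move=> /(word_map_ball (XV Xx) tV) [z zt zy].
  have -> : y = z by exact: (word_map_inj cT (XV Xy) (tV _ zt) (esym zy)).
  by rewrite enormB.
suff hh : ratio T w x0 * enorm (x - y) <= K * K * (D / s + 1) * h.
  by apply: le_trans hh _; rewrite ler_wpM2r // lerDr.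
have [hs|sh] := ltP h (ratio T w x / K * s).
  have : enorm (x - y) <= K * h / ratio T w x.
    rewrite leNgt; apply/negP => lt.
    have := ball_y (enorm (x - y)).
    have : h < ratio T w x / K * enorm (x - y).
      move: lt; rewrite ltr_pdivrMr // => lt.
      by rewrite mulrAC ltr_pdivlMr // mulrC (mulrC (ratio T w x)).
    move=> h1 h2; have [xs|xs] := leP (enorm (x - y)) s.
      by have := h2 xs h1; rewrite ltxx.
    by have := ball_y s (lexx _) hs; rewrite ltNge (ltW xs).
  rewrite ler_pdivlMr // => h1.
  have h2 : ratio T w x0 * enorm (x - y) <= K * ratio T w x * enorm (x - y).
    by rewrite ler_wpM2r.
  apply: le_trans h2 _; rewrite -mulrA (mulrC (ratio T w x)).
  apply: (@le_trans _ _ (K * (K * h))); first by rewrite ler_wpM2l // ltW.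
  rewrite mulrA ler_wpM2r // ler_peMr ?mulr_ge0 ?(ltW K0) //.
  by rewrite lerDr.
(* Here the images are already far apart relative to the ratio, and bounding |x - y| by the diameter
   [D] is enough. *)
have h1 : ratio T w x * s <= K * h by move: sh; rewrite mulrAC ler_pdivrMr // (mulrC h).
have h2 : ratio T w x0 * s <= K * K * h.
  apply: (@le_trans _ _ (K * ratio T w x * s)); first by rewrite ler_wpM2r // ltW.
  by rewrite -!mulrA ler_wpM2l // ltW.
have h3 : ratio T w x0 * D <= K * K * h * (D / s).
  by rewrite mulrA ler_pdivlMr // mulrAC ler_wpM2r // ltW.
apply: (@le_trans _ _ (ratio T w x0 * D)); first by rewrite (ler_pM2l r0); exact: (XD _ _ Xx Xy).
apply: (le_trans h3); rewrite mulrAC -/h; apply: (ler_wpM2r h0).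
by rewrite ler_wpM2l ?lerDl // mulr_ge0 // ltW.
Qed.

End BiLipschitz.

(** * Dyadic cubes and the volume of open sets *)

Section DyadicCubes.
Context {R : realType} {d : nat}.
Implicit Types (x y c : 'rV[R]_d) (O : set 'rV[R]_d) (k : nat).

Definition cube c (r : R) : set 'rV[R]_d :=
  [set y | forall j, `|y 0 j - c 0 j| < r].

Definition dyadic_index : Type := (nat * {ffun 'I_d -> int})%type.

HB.instance Definition _ := Countable.copy dyadic_index (nat * {ffun 'I_d -> int})%type.
Implicit Types p q : dyadic_index.

Definition dyadic_cell k x : {ffun 'I_d -> int} :=
  [ffun j => Num.floor (2 ^+ k * x 0 j)].

(* half-open cubes, so that the cubes of a given generation tile the space *)
Definition dyadic p : set 'rV[R]_d := [set x | dyadic_cell p.1 x = p.2].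

Definition dyadic_half p : R := (2 ^+ p.1.+1)^-1.

Definition dyadic_center p : 'rV[R]_d :=
  \row_j (((p.2 j)%:~R + 2^-1) / 2 ^+ p.1).

Lemma dyadicP p x : dyadic p x <-> forall j,
  (p.2 j)%:~R <= 2 ^+ p.1 * x 0 j < (p.2 j + 1)%:~R.
Proof.
split=> [<- j|px]; first by rewrite ffunE floor_itv.
by apply/ffunP => j; rewrite ffunE; apply/eqP; rewrite floor_eq.
Qed.

Lemma dyadic_half_gt0 p : 0 < dyadic_half p.
Proof. by rewrite invr_gt0 exprn_gt0. Qed.

Lemma dyadic_sub_box p x j : dyadic p x ->
  (dyadic_center p 0 j - dyadic_half p <= x 0 j <= dyadic_center p 0 j + dyadic_half p).
Proof.
move=> /dyadicP /(_ j) /andP[h1 h2]; rewrite mxE /dyadic_half exprS invfM.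
have k0 : 0 < (2 : R) ^+ p.1 by rewrite exprn_gt0.
rewrite -mulrBl -mulrDl ler_pdivrMr // ler_pdivlMr // (mulrC (x 0 j)).
by move: h2; rewrite intrD => h2; apply/andP; split; lra.
Qed.

Lemma cube_sub_dyadic p : cube (dyadic_center p) (dyadic_half p) `<=` dyadic p.
Proof.
move=> x px; apply/dyadicP => j; have := px j.
rewrite mxE /dyadic_half exprS invfM.
have k0 : 0 < (2 : R) ^+ p.1 by rewrite exprn_gt0.
rewrite ltr_norml => /andP[]; rewrite ltrBrDr ltrBlDr addrC -mulrBl -mulrDl.
rewrite ltr_pdivrMr // ltr_pdivlMr // (mulrC (x 0 j)) => h1 h2.
by rewrite intrD; apply/andP; split; lra.
Qed.

(** For an integer m, m <= floor t is equivalent to 2 m <= floor (2 t), so a cell determines its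
    parent. *)
Lemma dyadic_cell_le k l x y : (k <= l)%N ->
  dyadic_cell l x = dyadic_cell l y -> dyadic_cell k x = dyadic_cell k y.
Proof.
move=> /subnK <-; elim: (l - k)%N => // n IH; rewrite addSn => E; apply: IH.
have key (m : int) z j : (m <= dyadic_cell (n + k) z j) =
    (2 * m <= dyadic_cell (n + k).+1 z j).
  by rewrite !ffunE !floor_ge_int exprS -mulrA intrM ler_pM2l.
apply/ffunP => j; apply/le_anti.
by apply/andP; split; rewrite key; [rewrite -E | rewrite E]; rewrite -key.
Qed.

(** Generations are natural numbers, so sides are at most 1 and a largest cube inside [O] around
    each point exists. *)
Definition maximal_dyadic O : set dyadic_index := [set p | dyadic p `<=` O /\
  forall x k, dyadic p x -> (k < p.1)%N -> ~ dyadic (k, dyadic_cell k x) `<=` O].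

Lemma maximal_dyadic_disjoint O p q x : maximal_dyadic O p ->
  maximal_dyadic O q -> dyadic p x -> dyadic q x -> p = q.
Proof.
have lt p' q' : maximal_dyadic O p' -> maximal_dyadic O q' -> dyadic p' x ->
    dyadic q' x -> (p'.1 < q'.1)%N -> False.
  move=> [pO _] [_ qM] px qx lt; apply: (qM _ _ qx lt).
  by apply: subset_trans pO => y; rewrite /dyadic /= => ->; exact: px.
move=> Mp Mq px qx; case: (ltngtP p.1 q.1) => [l|l|E].
- by have := lt _ _ Mp Mq px qx l.
- by have := lt _ _ Mq Mp qx px l.
- move: px qx; rewrite /dyadic /= E => h1 h2.
  by case: p q E h1 h2 {Mp Mq} => [? ?] [? ?] /= -> <- <-.
Qed.

Lemma dyadic_cover O : open O -> O `<=` \bigcup_(p in maximal_dyadic O) dyadic p.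
Proof.
move=> Oo x Ox; have /nbhs_eballP[e e0 eO] := open_nbhs_nbhs (conj Oo Ox).
have exk : exists k, `[< dyadic (k, dyadic_cell k x) `<=` O >].
  have [k hk] : exists k, d.+1%:R / e < 2 ^+ k.
    exists (Num.truncn (d.+1%:R / e)).+1; apply: lt_trans (truncnS_gt _) _.
    by rewrite -natrX ltr_nat ltn_expl.
  exists k; apply/asboolP; apply: subset_trans eO => y /dyadicP hy.
  have /dyadicP hx : dyadic (k, dyadic_cell k x) x by [].
  have k0 : 0 < (2 : R) ^+ k by rewrite exprn_gt0.
  have d1 : (0 : R) < d.+1%:R by [].
  have xy : `|y - x| <= (2 ^+ k)^-1.
    have -> : `|y - x| = mx_norm (y - x) by [].
    rewrite mx_normrE; apply: bigmax_le => [|[i j] _]; first by rewrite invr_ge0 ltW.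
    rewrite /= ord1 !mxE -(ler_pM2l k0) divff ?gt_eqF // -{1}(gtr0_norm k0) -normrM.
    have /andP[] := hx j; have /andP[] := hy j; rewrite intrD /= => h1 h2 h3 h4.
    by rewrite mulrBr ler_norml; apply/andP; split; lra.
  rewrite /eball /=; apply: le_lt_trans (enorm_le_norm _) _.
  apply: (@le_lt_trans _ _ (d.+1%:R * (2 ^+ k)^-1)).
    by apply: ler_pM => //; rewrite ler_nat.
  by rewrite ltr_pdivrMr // -ltr_pdivrMl // mulrC.
case: (ex_minnP exk) => k /asboolP kO kmin.
exists (k, dyadic_cell k x) => //; split=> // y l yk /= lk lO.
have : (k <= l)%N.
  by apply: kmin; apply/asboolP; rewrite (dyadic_cell_le (ltnW lk) (esym yk)).
by rewrite leqNgt lk.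
Qed.

(** The closures of the maximal cubes form one of the covers in the infimum defining [lebesgue_rV];
    were all their finite volume sums at most [m], the measure would be too. *)
Lemma lebesgue_rV_dyadic O (m : R) : (0 < d)%N -> open O -> 0 <= m ->
  (m%:E < lebesgue_rV O)%E ->
  exists s : seq dyadic_index, [/\ uniq s, forall p, p \in s -> maximal_dyadic O p &
    m < \sum_(p <- s) (2 * dyadic_half p) ^+ d].
Proof.
move=> d0 Oo m0 mO; apply: contrapT => noS.
have small s : uniq s -> (forall p, p \in s -> maximal_dyadic O p) ->
    \sum_(p <- s) (2 * dyadic_half p) ^+ d <= m.
  by move=> us sM; rewrite leNgt; apply/negP => ms; apply: noS; exists s.
(* Codes of no maximal cube are sent to the degenerate box (0, 0), of volume 0 since d > 0. *)
pose f n : option dyadic_index :=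
  if pickle_inv n is Some p then if `[< maximal_dyadic O p >] then Some p else None
  else None.
pose ab n : 'rV[R]_d * 'rV[R]_d := if f n is Some p then
  (\row_j (dyadic_center p 0 j - dyadic_half p),
   \row_j (dyadic_center p 0 j + dyadic_half p)) else (0, 0).
have fK : ocancel f pickle.
  move=> n; rewrite /f; have := @pickle_invK dyadic_index n.
  by case: (pickle_inv n) => //= p pn; case: ifP.
have vol n : \prod_(j < d) ((ab n).2 0 j - (ab n).1 0 j) =
    if f n is Some p then (2 * dyadic_half p) ^+ d else 0.
  rewrite /ab; case: (f n) => [p|] /=.
    rewrite (eq_bigr (fun=> 2 * dyadic_half p)); first by rewrite prodr_const card_ord.
    by move=> j _; rewrite !mxE; ring.
  by rewrite (bigD1 (Ordinal d0)) //= mxE subrr mul0r.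
have vol0 n : 0 <= \prod_(j < d) ((ab n).2 0 j - (ab n).1 0 j).
  rewrite vol; case: (f n) => // p.
  by rewrite exprn_ge0 // mulr_ge0 // ltW // dyadic_half_gt0.
have : (lebesgue_rV O <= m%:E)%E.
  apply: le_trans (_ : (\sum_(0 <= n <oo)
    (\prod_(j < d) ((ab n).2 0 j - (ab n).1 0 j))%:E <= _)%E).
    apply: ereal_inf_lbound; exists ab => //; split.
      move=> n j; rewrite /ab; case: (f n) => //= p; rewrite !mxE.
      have := dyadic_half_gt0 p; lra.
    move=> x /(dyadic_cover Oo) [p Mp px]; exists (pickle p) => //.
    rewrite /ab /f pickleK_inv; case: asboolP => // _ j; rewrite !mxE.
    have := dyadic_sub_box j px; rewrite mxE; exact.
  apply: lime_le; first by apply: is_cvg_nneseries => n _ _; rewrite lee_fin.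
  apply: nearW => N; rewrite sumEFin lee_fin.
  rewrite (eq_bigr _ (fun n _ => vol n)).
  have -> : \sum_(0 <= n < N) (if f n is Some p then (2 * dyadic_half p) ^+ d else 0) =
      \sum_(p <- pmap f (iota 0 N)) (2 * dyadic_half p) ^+ d.
    rewrite /index_iota subn0; elim: (iota 0 N) => [|n s IH]; first by rewrite !big_nil.
    by rewrite big_cons IH /=; case: (f n) => [p|]; rewrite ?big_cons //= add0r.
  apply: small; first by apply: (pmap_uniq fK); exact: iota_uniq.
  move=> p; rewrite mem_pmap => /mapP[n _]; rewrite /f.
  by case: (pickle_inv n) => // q; case: asboolP => // Mq [->].
by rewrite leNgt mO.
Qed.

End DyadicCubes.

(** * Packing disjoint cubes by counting grid points *)

Section CubePacking.
Context {R : realType} {d : nat}.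
Implicit Types (x c : 'rV[R]_d).

Lemma sum_card_disjoint (J : eqType) (G : finType) (A : J -> {set G}) (s : seq J) :
  uniq s -> (forall i j z, i \in s -> j \in s -> z \in A i -> z \in A j -> i = j) ->
  (\sum_(j <- s) #|A j| <= #|G|)%N.
Proof.
move=> us dA.
have -> : (\sum_(j <- s) #|A j| = \sum_(z : G) \sum_(j <- s) (z \in A j))%N.
  rewrite exchange_big /=; apply: eq_bigr => j _.
  by rewrite -sum1_card big_mkcond; apply: eq_bigr => z _; case: (z \in A j).
rewrite -sum1_card; apply: leq_sum => z _.
have -> : (\sum_(j <- s) (z \in A j) = count (fun j => z \in A j) s)%N.
  by elim: (s) => [|j t IH]; rewrite ?big_nil // big_cons IH.
rewrite -size_filter; have := filter_uniq (fun j => z \in A j) us.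
have : forall j, j \in [seq j <- s | z \in A j] -> (z \in A j) /\ (j \in s).
  by move=> j; rewrite mem_filter => /andP.
case: [seq j <- s | z \in A j] => [|i [|j t]] // h; rewrite /= inE negb_or.
have [zi si] := h i (mem_head _ _).
have [|zj sj] := h j; first by rewrite !inE eqxx orbT.
by rewrite (dA i j z si sj zi zj) eqxx.
Qed.

Definition grid_in (lo : 'rV[R]_d) (eta : R) (n : nat) c (r : R) :
    {set {ffun 'I_d -> 'I_n.+1}} :=
  [set z : {ffun 'I_d -> 'I_n.+1} | [forall j, `|lo 0 j + (z j)%:R * eta - c 0 j| < r]].

Lemma card_grid_in (lo c : 'rV[R]_d) (eta r : R) n : 0 < eta -> eta < r ->
  (forall j, lo 0 j <= c 0 j - r /\ c 0 j + r <= lo 0 j + n%:R * eta) ->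
  (r / eta) ^+ d <= #|grid_in lo eta n c r|%:R.
Proof.
(* In each coordinate [m j] is the last grid index not beyond the left edge of the cube, and the
   next [q] indices stay inside because q eta <= r + eta < 2 r. *)
move=> e0 er hlo; pose q := (Num.truncn (r / eta)).+1.
pose m j := Num.truncn ((c 0 j - r - lo 0 j) / eta).
have r0 : 0 < r by lra.
have qh : q%:R * eta < 2 * r.
  have : (Num.truncn (r / eta))%:R * eta <= r.
    by rewrite -ler_pdivlMr // truncn_le divr_ge0 // ltW.
  rewrite /q -natr1 mulrDl mul1r; lra.
have mh j : (m j)%:R * eta <= c 0 j - r - lo 0 j < (m j).+1%:R * eta.
  rewrite -ler_pdivlMr // -ltr_pdivrMr //; apply: truncn_itv.
  by have [h _] := hlo j; rewrite divr_ge0 ?(ltW e0) //; lra.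
have pt j (i : 'I_q) : `|lo 0 j + ((m j).+1 + i)%:R * eta - c 0 j| < r.
  have /andP[m1 m2] := mh j.
  have i0 : (0 : R) <= i%:R * eta by rewrite mulr_ge0 // ltW.
  have iq : i.+1%:R * eta <= q%:R * eta by rewrite ler_wpM2r ?(ltW e0) // ler_nat.
  rewrite -natr1 mulrDl in iq; rewrite -natr1 mulrDl in m2.
  rewrite natrD -natr1 !mulrDl ltr_norml; apply/andP; split; lra.
have lt_n j (i : 'I_q) : ((m j).+1 + i < n.+1)%N.
  have := pt j i; rewrite ltr_norml => /andP[_ h]; have [_ h'] := hlo j.
  have : ((m j).+1 + i)%:R * eta < n%:R * eta by lra.
  by rewrite ltr_pM2r // ltr_nat => /ltnW; rewrite ltnS.
pose g (z : {ffun 'I_d -> 'I_q}) : {ffun 'I_d -> 'I_n.+1} :=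
  [ffun j => Ordinal (lt_n j (z j))].
have gi : injective g.
  move=> z z' /ffunP E; apply/ffunP => j; have := congr1 val (E j).
  by rewrite !ffunE /= => /addnI /val_inj.
have : (q ^ d <= #|grid_in lo eta n c r|)%N.
  have -> : (q ^ d = #|(g @: [set: {ffun 'I_d -> 'I_q}])%SET|)%N.
    by rewrite card_imset // cardsT card_ffun !card_ord.
  apply: subset_leq_card; apply/fintype.subsetP => _ /imsetP[z _ ->].
  by rewrite inE; apply/forallP => j; rewrite ffunE /= pt.
rewrite -(ler_nat R) natrX; apply: le_trans.
apply: lerXn2r; rewrite ?nnegrE ?divr_ge0 ?(ltW r0) ?(ltW e0) //.
exact/ltW/truncnS_gt.
Qed.

(* The cubes are compared by the number of points of a fine grid they contain,
   which avoids the additivity of Lebesgue measure. *)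
Lemma cube_packing (J : eqType) (s : seq J) (c : J -> 'rV[R]_d) (r : J -> R) x (rho : R) :
  (0 < d)%N -> uniq s -> 0 < rho -> (forall j, j \in s -> 0 < r j) ->
  (forall j, j \in s -> cube (c j) (r j) `<=` cube x rho) ->
  (forall i j y, i \in s -> j \in s -> cube (c i) (r i) y -> cube (c j) (r j) y -> i = j) ->
  \sum_(j <- s) r j ^+ d <= (12 * rho) ^+ d.
Proof.
move=> d0 us rho0 r0 rs dis.
have [eta e0 [erho er]] : exists2 eta : R, 0 < eta &
    eta <= rho /\ forall j, j \in s -> eta < r j.
  elim: (s) r0 => [|i t IH] r0; first by exists rho.
  have [|e e0 [h1 h2]] := IH; first by move=> j jt; apply: r0; rewrite inE jt orbT.
  have ri : 0 < r i by apply: r0; exact: mem_head.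
  exists (Num.min e (r i / 2)); first by rewrite lt_min e0 divr_gt0.
  split=> [|j]; first by rewrite ge_min h1.
  rewrite inE gt_min => /predU1P[->|/h2 ->//].
  by rewrite orbC ltr_pdivrMr // ltr_pMr // ltr1n.
have cin j : j \in s -> cube x rho (c j).
  by move=> js; apply: (rs j js) => i; rewrite subrr normr0 r0.
have rle j : j \in s -> r j < 4 * rho.
  move=> js; have rj := r0 _ js.
  have /(_ (Ordinal d0)) : cube x rho (c j + const_mx (r j / 2)).
    apply: (rs j js) => i; rewrite !mxE addrAC subrr add0r gtr0_norm ?divr_gt0 //.
    by rewrite ltr_pdivrMr // ltr_pMr // ltr1n.
  have := cin j js (Ordinal d0); rewrite !mxE !ltr_norml => /andP[? ?] /andP[? ?].
  lra.
(* Centres are within [rho] of [x] and half-sides are below 4 rho, so the grid must span half-side 5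
   rho. Rounding adds at most 2 eta <= 2 rho to the length 10 rho, hence the constant 12. *)
pose n := (Num.truncn (10 * rho / eta)).+1.
pose lo : 'rV[R]_d := x - const_mx (5 * rho).
have n10 : 10 * rho <= n%:R * eta.
  by rewrite -ler_pdivrMr // ltW // truncnS_gt.
have n12 : n.+1%:R * eta <= 12 * rho.
  have : (Num.truncn (10 * rho / eta))%:R * eta <= 10 * rho.
    by rewrite -ler_pdivlMr // truncn_le divr_ge0 ?mulr_ge0 // ltW.
  by rewrite /n -2!natr1; lra.
have cnt j : j \in s -> (r j / eta) ^+ d <= #|grid_in lo eta n (c j) (r j)|%:R.
  move=> js; apply: card_grid_in => // [|i]; first exact: er.
  have := cin j js i; have := rle j js; rewrite !mxE ltr_norml => h /andP[? ?].
  by split; lra.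
have tot : (\sum_(j <- s) #|grid_in lo eta n (c j) (r j)| <= n.+1 ^ d)%N.
  have -> : (n.+1 ^ d = #|{ffun 'I_d -> 'I_n.+1}|)%N by rewrite card_ffun !card_ord.
  apply: sum_card_disjoint => // i j z si sj; rewrite !inE => /forallP zi /forallP zj.
  apply: (dis i j (\row_l (lo 0 l + (z l)%:R * eta))) => // l; rewrite mxE.
    exact: zi.
  exact: zj.
have : \sum_(j <- s) (r j / eta) ^+ d <= n.+1%:R ^+ d.
  rewrite -natrX; apply: le_trans (_ : _ <= (\sum_(j <- s) #|grid_in lo eta n (c j) (r j)|)%:R) _.
    by rewrite natr_sum [leLHS]big_seq [leRHS]big_seq; apply: ler_sum => j /cnt.
  by rewrite ler_nat.
rewrite (eq_bigr (fun j => r j ^+ d * eta^-1 ^+ d)); last first.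
  by move=> j _; rewrite exprMn.
rewrite -mulr_suml exprVn ler_pdivrMr ?exprn_gt0 // -exprMn => /le_trans; apply.
by apply: lerXn2r; rewrite ?nnegrE ?mulr_ge0 ?(ltW e0) ?(ltW rho0).
Qed.

End CubePacking.

(** * Bounded overlap *)

(* [rr w] stands for the norm of the derivative of S_w at a fixed point of X. *)
Record conformal_geometry (R : realType) (d : nat) (I : countType)
    (X : set 'rV[R]_d) (S : I -> 'rV[R]_d -> 'rV[R]_d) (rr : seq I -> R)
    (C xi : R) (M : nat) : Prop := ConformalGeometry {
  geo_C : 1 <= C;
  geo_xi : 0 < xi < 1;
  geo_gt0 : forall w, 0 < rr w;
  geo_nil : rr [::] = 1;
  geo_le : forall w, rr w <= xi ^+ size w;
  geo_rcons : forall w i, rr w * rr [:: i] <= C * rr (rcons w i);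
  geo_upper : forall w x y, X x -> X y ->
    enorm (word_map S w x - word_map S w y) <= C * rr w * enorm (x - y);
  geo_lower : forall w x y, X x -> X y ->
    rr w * enorm (x - y) <= C * enorm (word_map S w x - word_map S w y);
  geo_diam : forall x y, X x -> X y -> enorm (x - y) <= C;
  geo_overlap : forall n z rho (s : seq (seq I)), 0 < rho -> uniq s ->
    (forall w, w \in s -> [/\ size w = n, rho <= rr w &
       exists2 x, X x & enorm (word_map S w x - z) < rho]) ->
    (size s <= M)%N }.

Section Overlap.
Context {R : realType} {d : nat} {I : countType}.
Variables (X V : set 'rV[R]_d) (eps K C c0 : R) (x0 : 'rV[R]_d).
Variables (S T : I -> 'rV[R]_d -> 'rV[R]_d).
Hypotheses (d0 : (0 < d)%N) (cT : conformality V eps T).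
Hypotheses (K1 : 1 <= K) (distortion : forall w x y, V x -> V y ->
  ratio T w y <= K * ratio T w x).
Hypotheses (XV : X `<=` V) (Xx0 : X x0) (SX : forall i, S i @` X `<=` X).
Hypotheses (TS : forall i x, X x -> T i x = S i x).
Hypotheses (osc : open_set_condition X S).
Hypotheses (C0 : 0 <= C) (upper : forall w x y, X x -> X y ->
  enorm (word_map T w x - word_map T w y) <= C * ratio T w x0 * enorm (x - y)).
Hypotheses (c00 : 0 < c0) (cone : forall x r, X x -> 0 < r < 1 ->
  ((c0 * r ^+ d)%:E < lebesgue_rV (eball x r `&` X°))%E).

Let intX x : X° x -> X x. Proof. exact: interior_subset. Qed.

(** Different first letters contradict the open set condition, equal ones are cancelled by
    injectivity; equal length excludes that one word is a prefix of the other. *)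
Lemma words_disjoint u v x y : size u = size v -> X° x -> X° y ->
  word_map T u x = word_map T v y -> u = v.
Proof.
have [_ SU SD] := osc.
have inU w z : X° z -> X° (word_map T w z).
  move=> Uz; elim: w => //= i w IH; rewrite TS; last exact: intX.
  by apply: (SU i); exists (word_map T w z).
move=> + Ux Uy; elim: u v => [[]//|i u IH [//|j v] /= [szuv] E].
have XuX := intX (inU u _ Ux); have XvX := intX (inU v _ Uy).
have ij : i = j.
  apply/eqP; apply: contrapT => /negP ij; have := SD i j ij.
  move=> /seteqP[+ _] => /(_ (S i (word_map T u x))); apply; split.
    by exists (word_map T u x) => //; exact: inU.
  by rewrite -TS // E TS //; exists (word_map T v y) => //; exact: inU.
subst j; congr (_ :: _); apply: IH => //.
exact: (@word_map_inj _ _ _ _ _ _ cT [:: i] _ _ (XV XuX) (XV XvX) E).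
Qed.

(* The cone condition gives, inside each S_w(X) meeting the ball, disjoint cubes of
   total volume at least a constant times rho^d; S_w(Int X) are disjoint for words
   of equal length, so these cubes pack. *)
Lemma bounded_overlap : exists M : nat,
  forall n z rho (s : seq (seq I)), 0 < rho -> uniq s ->
    (forall w, w \in s -> [/\ size w = n, rho <= ratio T w x0 &
       exists2 x, X x & enorm (word_map T w x - z) < rho]) ->
    (size s <= M)%N.
Proof.
(* One factor [K] changes the reference point from [x0] to the centre of the cube, the other comes
   from [word_map_ball]; [d.+1] passes from a cube to a Euclidean ball. *)
pose kappa : R := (K * K * d.+1%:R)^-1.
have K0 : 0 < K by exact: lt_le_trans K1.
have k0 : 0 < kappa by rewrite invr_gt0 !mulr_gt0.
pose B := (48 * (1 + C) / kappa) ^+ d / c0.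
exists (Num.truncn B) => n z rho s rho0 us hs.
have r0 w : 0 < ratio T w x0 by apply: (ratio_gt0 d0 cT); exact: XV.
(* The factor 2 makes the radius smaller than 1, as the cone condition requires, while the image of
   the ball still has radius at most C rho / 2. *)
pose t w := rho / (2 * ratio T w x0).
have t0 w : 0 < t w by rewrite divr_gt0 // mulr_gt0.
have : forall w, exists gw : 'rV[R]_d * seq (@dyadic_index d), w \in s ->
    [/\ X gw.1, enorm (word_map T w gw.1 - z) < rho, uniq gw.2,
      forall p, p \in gw.2 -> maximal_dyadic (eball gw.1 (t w) `&` X°) p &
      c0 * t w ^+ d < \sum_(p <- gw.2) (2 * dyadic_half p) ^+ d].
  move=> w.
  have [ws|] := boolP (w \in s); last by exists (0, [::]).
  have [_ rw [x Xx xz]] := hs w ws.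
  have tw1 : t w < 1.
    rewrite ltr_pdivrMr ?mulr_gt0 // mul1r; have := r0 w; lra.
  have [|||D [uD DM hD]] := @lebesgue_rV_dyadic R d (eball x (t w) `&` X°) (c0 * t w ^+ d) d0.
  - by apply: openI; [exact: open_eball | exact: open_interior].
  - by rewrite mulr_ge0 ?exprn_ge0 // ltW.
  - by apply: cone => //; rewrite t0.
  by exists (x, D).
move=> /choice[g gP].
pose J := [seq (w, p) | w <- s, p <- (g w).2].
pose c (j : seq I * @dyadic_index d) := word_map T j.1 (dyadic_center j.2).
pose r (j : seq I * @dyadic_index d) : R := kappa * ratio T j.1 x0 * dyadic_half j.2.
have JP j : j \in J -> j.1 \in s /\ j.2 \in (g j.1).2.
  by move=> /allpairsPdep[w [p [ws wp ->]]].
have rJ0 j : 0 < r j by rewrite !mulr_gt0 // dyadic_half_gt0.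
have cubeJ j y : j \in J -> cube (c j) (r j) y ->
    exists2 b, dyadic j.2 b & (eball (g j.1).1 (t j.1) `&` X°) b /\
      y = word_map T j.1 b.
  move=> /JP[ws wp] yj; have [Xx xz uD DM _] := gP _ ws.
  have [pO pM] := DM _ wp; pose a : 'rV[R]_d := dyadic_center j.2.
  have sub : eball a (dyadic_half j.2) `<=` dyadic j.2.
    apply: subset_trans (@cube_sub_dyadic _ _ _) => b ba i.
    have := ler_abs_enorm (b - a) i; rewrite !mxE => h.
    exact: le_lt_trans ba.
  have Va : V a.
    by apply/XV/intX; apply: (pO a _).2; apply: sub; apply: eball_center; exact: dyadic_half_gt0.
  have subV : eball a (dyadic_half j.2) `<=` V.
    by move=> b /sub /pO [_ /intX /XV].
  have : eball (word_map T j.1 a) (ratio T j.1 a / K * dyadic_half j.2) y.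
    rewrite /eball /=; apply: le_lt_trans (enorm_le_norm _) _.
    have nr : `|y - word_map T j.1 a| <= r j.
      have -> : `|y - word_map T j.1 a| = mx_norm (y - word_map T j.1 a) by [].
      rewrite mx_normrE; apply: bigmax_le => [|[i l] _]; first exact: ltW.
      by rewrite /= ord1 !mxE; exact/ltW/yj.
    apply: (@lt_le_trans _ _ (d.+1%:R * r j)).
      apply: (@le_lt_trans _ _ (d%:R * r j)); first exact: ler_wpM2l.
      by rewrite ltr_pM2r // ltr_nat.
    have -> : d.+1%:R * r j = ratio T j.1 x0 / K / K * dyadic_half j.2.
      by rewrite /r /kappa; field; rewrite gt_eqF // nat1r pnatr_eq0.
    rewrite ler_pM2r ?dyadic_half_gt0 // ler_pM2r ?invr_gt0 //.
    by rewrite ler_pdivrMr // mulrC; apply: distortion => //; exact: XV.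
  move=> /(word_map_ball d0 cT K1 distortion Va subV) [b /sub bp <-].
  by exists b => //; split=> //; exact: pO.
have packing : \sum_(j <- J) r j ^+ d <= (12 * ((1 + C) * rho)) ^+ d.
  apply: (@cube_packing _ _ _ _ c r z) => //.
  - apply: allpairs_uniq_dep => //; first by move=> w ws; have [] := gP w ws.
    by move=> [w p] [w' p'] _ _ /= [-> ->].
  - by rewrite mulr_gt0 // ltr_pwDl.
  - move=> j jJ y /(cubeJ _ _ jJ) [b _ [[bx /intX Xb] ->]] i.
    have [ws _] := JP _ jJ; have [Xx xz _ _ _] := gP _ ws.
    have := ler_abs_enorm (word_map T j.1 b - z) i; rewrite !mxE => h.
    apply: le_lt_trans h _; apply: le_lt_trans (enorm_tri _ (word_map T j.1 (g j.1).1) _) _.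
    have h1 := upper j.1 Xb Xx.
    have h2 : C * ratio T j.1 x0 * enorm (b - (g j.1).1) <= C * ratio T j.1 x0 * t j.1.
      by rewrite ler_wpM2l ?(ltW bx) // mulr_ge0 // ltW.
    have h3 : C * ratio T j.1 x0 * t j.1 = C * rho / 2.
      by rewrite /t; field; rewrite gt_eqF.
    have : 0 <= C * rho by rewrite mulr_ge0 // ltW.
    rewrite mulrDl mul1r; lra.
  - move=> i j y iJ jJ /(cubeJ _ _ iJ) [b bp [[bx bU] ->]] /(cubeJ _ _ jJ) [b' bp' [[bx' bU'] E]].
    have [ws wp] := JP _ iJ; have [ws' wp'] := JP _ jJ.
    have ww : i.1 = j.1.
      apply: (words_disjoint _ bU bU' E).
      by have [-> _ _] := hs _ ws; have [-> _ _] := hs _ ws'.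
    case: i j ww {iJ jJ} ws wp ws' wp' bp bp' E bx bx' => [w p] [w' p'] /= <- {w'}.
    move=> ws wp _ wp' bp bp' E _ _; congr pair.
    have bb := word_map_inj cT (XV (intX bU)) (XV (intX bU')) E.
    have [_ _ _ DM _] := gP _ ws.
    by apply: (maximal_dyadic_disjoint (DM _ wp) (DM _ wp') bp); rewrite bb.
(* Each word contributes at least (kappa ratio / 2)^d c0 t^d = c0 (kappa rho / 4)^d, independent of
   the word; comparison with the packing bound gives [B]. *)
have lower : (size s)%:R * (c0 * (kappa * rho / 4) ^+ d) <= \sum_(j <- J) r j ^+ d.
  rewrite /J big_allpairs_dep /= mulr_natl -iter_addr_0 -(count_predT s) -big_const_seq.
  rewrite big_seq [leRHS]big_seq; apply: ler_sum => w ws; have [_ _ _ _ hD] := gP w ws.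
  rewrite (eq_bigr (fun p => (kappa * ratio T w x0 / 2) ^+ d * (2 * dyadic_half p) ^+ d)).
    rewrite -mulr_sumr; apply: le_trans (_ : _ <= (kappa * ratio T w x0 / 2) ^+ d * (c0 * t w ^+ d)) _.
      rewrite mulrCA -exprMn le_eqVlt; apply/orP; left; apply/eqP; congr (_ * _ ^+ d).
      by rewrite /t; field; rewrite gt_eqF.
    by rewrite ler_wpM2l ?(ltW hD) // exprn_ge0 // !mulr_ge0 // ltW.
  by move=> p _; rewrite -exprMn /r /=; congr (_ ^+ d); field.
have p0 : 0 < kappa * rho / 4 by rewrite !mulr_gt0.
suff h : (size s)%:R <= B by rewrite truncn_ge_nat //; exact: le_trans h.
rewrite ler_pdivlMr //.
have p0d : 0 < (kappa * rho / 4) ^+ d by rewrite exprn_gt0.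
rewrite -(ler_pM2r p0d) -[leLHS]mulrA; apply: le_trans (le_trans lower packing) _.
rewrite -exprMn le_eqVlt; apply/orP; left; apply/eqP; congr (_ ^+ d).
by field; rewrite gt_eqF.
Qed.

End Overlap.

Lemma cifs_geometry (R : realType) (d : nat) (I : countType) (X : set 'rV[R]_d)
    (S : I -> 'rV[R]_d -> 'rV[R]_d) : (0 < d)%N -> is_CIFS X S ->
  exists (rr : seq I -> R) (C xi : R) (M : nat), conformal_geometry X S rr C xi M.
Proof.
move=> d0 [_ cX coX SX osc cone [V [eps [T [[Vo Vb Vc XV] _ TS cT [K K0 hK]]]]]].
have [x0 Xx0] : X !=set0.
  by have [[x xi] _ _] := osc; exists x; exact: interior_subset.
(* Bounded distortion is assumed for non-empty words; a constant at least 1 also serves the empty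
   word. *)
pose K' := Num.max K 1.
have K1 : 1 <= K' by rewrite le_max lexx orbT.
have distortion w x y : V x -> V y -> ratio T w y <= K' * ratio T w x.
  move=> Vx Vy; have [->|wn] := eqVneq w [::].
    by rewrite (ratio_nil T d0 x).1 (ratio_nil T d0 y).1 mulr1.
  apply: le_trans (hK w x y wn Vx Vy) _; rewrite ler_wpM2r ?le_max ?lexx //.
  by apply: ltW; exact: (ratio_gt0 d0 cT).
have [C C1 hC] := word_map_bilipschitz d0 cT Vo K1 distortion cX coX XV Xx0.
have [xi xi01 hxi] := ratio_le d0 cT.
have [c0 c00 hcone] : exists2 c0 : R, 0 < c0 & forall x r, X x -> 0 < r < 1 ->
    ((c0 * r ^+ d)%:E < lebesgue_rV (eball x r `&` X°))%E.
  move: cone; rewrite /cone_condition; set e := ereal_inf _ => e0.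
  have [c c0 ce] : exists2 c : R, 0 < c & (c%:E < e)%E.
    case: e e0 => [e| |] //; last by exists 1 => //; exact: ltry.
    rewrite lte_fin => e0; exists (e / 2); first by rewrite divr_gt0.
    by rewrite lte_fin ltr_pdivrMr // ltr_pMr // ltr1n.
  exists c => // x r Xx /andP[r0 r1].
  have : (e <= lebesgue_rV (eball x r `&` X°) * ((r ^+ d)^-1)%:E)%E.
    by apply: ereal_inf_lbound; exists (x, r) => //=; rewrite r0 r1.
  move=> /(lt_le_trans ce); rewrite EFinM lte_pdivlMr // exprn_gt0 //.
have C0 : 0 <= C by exact: le_trans C1.
have [M hM] := bounded_overlap d0 cT K1 distortion XV Xx0 TS osc C0
  (fun w x y Xx Xy => (hC w x y Xx Xy).1) c00 hcone.
have [D D0 XD] := bounded_eball (compact_bounded cX).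
have wS w x : X x -> word_map T w x = word_map S w x.
  by move=> Xx; have [] := eq_word_map w SX TS Xx.
have r0 w : 0 < ratio T w x0 by apply: (ratio_gt0 d0 cT); exact: XV.
pose C' := C + D + K'.
have CC' : C <= C' by rewrite /C'; lra.
exists (fun w => ratio T w x0), C', xi, M; apply: ConformalGeometry.
- lra.
- exact: xi01.
- exact: r0.
- exact: (ratio_nil T d0 x0).1.
- by move=> w; apply: hxi; exact: XV.
- move=> w i; rewrite -cats1 (ratio_cat d0 cT) ?mulrA; last exact: XV.
  rewrite ler_pM2r //; apply: (@le_trans _ _ (K' * ratio T w (word_map T [:: i] x0))).
    by apply: distortion; [apply: (word_map_in cT); exact: XV | exact: XV].
  rewrite ler_wpM2r; [by []| | by rewrite /C'; lra].
  by apply/ltW/(ratio_gt0 d0 cT)/(word_map_in cT)/XV.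
- move=> w x y Xx Xy; rewrite -!wS //; apply: le_trans (hC w x y Xx Xy).1 _.
  by rewrite ler_wpM2r ?enorm_ge0 // ler_wpM2r // ltW.
- move=> w x y Xx Xy; rewrite -!wS //; apply: le_trans (hC w x y Xx Xy).2 _.
  by rewrite ler_wpM2r ?enorm_ge0.
- by move=> x y Xx Xy; apply: le_trans (XD x y Xx Xy) _; rewrite /C'; lra.
- move=> n z rho s rho0 us hs; apply: (hM n z rho s rho0 us) => w /hs[h1 h2 [x Xx xz]].
  by split=> //; exists x => //; rewrite wS.
Qed.

(** * Covering numbers *)

Section Covering.
Context {R : realType} {d : nat}.
Implicit Types (x y a : 'rV[R]_d) (E : set 'rV[R]_d) (r s t : R).

(** A finite list with a real bound on its length replaces the extended-real covering number; by
    [covering_numberP] nothing is lost, the infimum over naturals being attained. *)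
Definition cov r t E := exists c : seq 'rV[R]_d, (size c)%:R <= t /\
  forall x, E x -> exists2 a, a \in c & eball a r x.

Lemma covering_numberP r t E : (covering_number r E <= t%:E)%E <-> cov r t E.
Proof.
pose Q (n : nat) := exists c : 'I_n -> 'rV[R]_d, E `<=` \bigcup_i eball (c i) r.
have QP n : Q n <-> exists c : seq 'rV[R]_d, size c = n /\
    forall x, E x -> exists2 a, a \in c & eball a r x.
  split=> [[c Ec]|[c [<- Ec]]].
    exists [seq c i | i <- enum 'I_n]; rewrite size_map size_enum_ord; split=> //.
    by move=> x /Ec [i _ xi]; exists (c i) => //; rewrite map_f // mem_enum.
  exists (fun i => nth 0 c i) => x /Ec [a /(nthP 0)[i ic <-] xa].
  by exists (Ordinal ic).
split=> [h|[c [ct Ec]]]; last first.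
  apply: le_trans (_ : ((size c)%:R%:E <= _)%E); last by rewrite lee_fin.
  apply: ereal_inf_lbound; exists (size c) => //.
  by apply/QP; exists c.
have exQ : exists n, `[< Q n >].
  apply: contrapT => nQ; move: h; rewrite /covering_number.
  rewrite (_ : [set n | _] = set0) ?image_set0 ?ereal_inf0 //.
  by apply/seteqP; split=> // n Qn; apply: nQ; exists n; apply/asboolP.
case: (ex_minnP exQ) => n /asboolP Qn nmin.
have [c [cn Ec]] := (QP n).1 Qn; exists c; split=> //; rewrite cn.
rewrite -lee_fin; apply: le_trans h; apply: le_ereal_inf_tmp => _ [m Qm <-].
by rewrite lee_fin ler_nat; apply: nmin; apply/asboolP.
Qed.

Lemma cov_ge0 r t E : cov r t E -> 0 <= t.
Proof. by move=> [c [ct _]]; exact: le_trans ct. Qed.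

Lemma cov_sub r r' t t' E E' : E `<=` E' -> r <= r' -> t <= t' ->
  cov r t E' -> cov r' t' E.
Proof.
move=> EE rr tt [c [ct Ec]]; exists c; split; first exact: le_trans tt.
move=> x /EE /Ec [a ac xa]; exists a => //.
exact: lt_le_trans rr.
Qed.

Lemma cov0 r t E : 0 <= t -> (forall x, ~ E x) -> cov r t E.
Proof. by move=> t0 E0; exists [::]; split=> // x /E0. Qed.

Lemma cov_point r t x : 0 < r -> 1 <= t -> cov r t [set x].
Proof.
move=> r0 t1; exists [:: x]; split=> // _ ->; exists x; rewrite ?mem_head //.
exact: eball_center.
Qed.

Lemma cov_cup r t u E E' : cov r t E -> cov r u E' -> cov r (t + u) (E `|` E').
Proof.
move=> [c [ct Ec]] [c' [cu Ec']]; exists (c ++ c'); split.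
  by rewrite size_cat natrD lerD.
by move=> x [/Ec|/Ec'] [a ac xa]; exists a; rewrite // mem_cat ac ?orbT.
Qed.

Lemma cov_bigcup (J : eqType) (s : seq J) (F : J -> set 'rV[R]_d) r u E :
  (forall j, j \in s -> cov r u (F j)) ->
  (forall x, E x -> exists2 j, j \in s & F j x) -> cov r ((size s)%:R * u) E.
Proof.
elim: s E => [|j s IH] E hF hE; first by rewrite mul0r; apply: cov0 => // x /hE[].
rewrite /= -natr1 mulrDl mul1r addrC.
apply: (@cov_sub r r _ _ _ (F j `|` \bigcup_(i in [set i | i \in s]) F i)) => //.
  move=> x /hE[i]; rewrite inE => /predU1P[->|si] xi; first by left.
  by right; exists i.
apply: cov_cup; first by apply: hF; exact: mem_head.
by apply: IH => // i si; apply: hF; rewrite inE si orbT.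
Qed.

Lemma cov_bigcup_nat (n : nat) (F : nat -> set 'rV[R]_d) r u E :
  (forall j, (j < n)%N -> cov r u (F j)) ->
  (forall x, E x -> exists2 j, (j < n)%N & F j x) -> cov r (n%:R * u) E.
Proof.
move=> hF hE; rewrite -{1}(size_iota 0 n); apply: (@cov_bigcup _ _ F).
  by move=> j; rewrite mem_iota => /hF.
by move=> x /hE [j jn xj]; exists j; rewrite // mem_iota.
Qed.

Lemma cov_refine r r' t u E : 0 <= u -> cov r t E ->
  (forall a, cov r' u (eball a r `&` E)) -> cov r' (t * u) E.
Proof.
move=> u0 [c [ct Ec]] h; apply: (@cov_sub _ r' ((size c)%:R * u) _ _ E) => //.
  by rewrite ler_wpM2r.
apply: (@cov_bigcup _ _ (fun a => eball a r `&` E)) => // x Ex.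
by have [a ac xa] := Ec x Ex; exists a.
Qed.

Lemma cov_ball x r s : 0 < r -> r <= s ->
  cov r (((2 * d + 3)%:R * (s / r)) ^+ d) (eball x s).
Proof.
move=> r0 rs; have s0 : 0 < s by exact: lt_le_trans rs.
(* Centres form a grid of mesh [h]: the sup-norm error is at most [h], the Euclidean one at most d h
   < r. There are at most 2 (d + 1) s / r + 1 <= (2 d + 3) s / r of them per axis. *)
pose h := r / d.+1%:R; have h0 : 0 < h by rewrite divr_gt0.
pose N := Num.truncn (2 * s / h).
exists [seq \row_j (x 0 j - s + h * (z j)%:R) | z : {ffun 'I_d -> 'I_N.+1}]; split.
  rewrite size_map -cardE card_ffun !card_ord natrX; apply: lerXn2r.
  - by rewrite nnegrE.
  - by rewrite nnegrE mulr_ge0 // divr_ge0 // ltW.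
  have : N%:R <= 2 * s / h by rewrite truncn_le divr_ge0 // ?mulr_ge0 // ltW.
  have -> : 2 * s / h = (2 * d.+1)%:R * (s / r).
    have D0 : d.+1%:R != 0 :> R by rewrite pnatr_eq0.
    by rewrite natrM /h; move: (d.+1%:R : R) D0 => D D0; field; rewrite D0 gt_eqF.
  have : 1 <= s / r by rewrite ler_pdivlMr // mul1r.
  rewrite -natr1 !natrD !natrM -natr1; lra.
move=> y yx.
have yj j : 0 <= (y 0 j - x 0 j + s) / h /\ (Num.truncn (((y 0 j - x 0 j + s) / h)%R) < N.+1)%N.
  have := ler_abs_enorm (y - x) j; rewrite !mxE => /le_lt_trans /(_ yx).
  rewrite ltr_norml => /andP[h1 h2]; split.
    by rewrite divr_ge0 ?(ltW h0) //; lra.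
  rewrite ltnS; apply: le_truncn; rewrite ler_pM2r ?invr_gt0 //; lra.
pose z : {ffun 'I_d -> 'I_N.+1} := [ffun j => Ordinal (yj j).2].
exists (\row_j (x 0 j - s + h * (z j)%:R)).
  by apply/mapP; exists z => //; rewrite mem_enum.
rewrite /eball /=; apply: le_lt_trans (enorm_le_norm _) _.
set v := y - _; have vh : `|v| <= h.
  have -> : `|v| = mx_norm v by [].
  rewrite mx_normrE; apply: bigmax_le => [|[i j] _]; first exact: ltW.
  rewrite /= ord1 !mxE ffunE /=; have [j0 _] := yj j.
  have := truncn_itv j0; rewrite ler_pdivlMr // ltr_pdivrMr // -natr1 => /andP[h1 h2].
  rewrite ler_norml; apply/andP; split; lra.
apply: (@le_lt_trans _ _ (d%:R * h)); first by rewrite ler_wpM2l.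
by rewrite /h mulrCA gtr_pMr // ltr_pdivrMr // mul1r ltr_nat.
Qed.

Lemma doubling (A : R) : exists2 M : R, 1 <= M &
  forall x r, 0 < r -> cov r M (eball x (A * r)).
Proof.
pose B := Num.max A 1; exists (((2 * d + 3)%:R * B) ^+ d).
  by rewrite exprn_ege1 // mulr_ege1 // ?le_max ?lexx ?orbT // ler1n addnS.
move=> x r r0; have B1 : 1 <= B by rewrite le_max lexx orbT.
have -> : B = B * r / r by rewrite mulfK // gt_eqF.
apply: (@cov_sub r r _ _ _ (eball x (B * r))) => //; last first.
  by apply: cov_ball => //; rewrite ler_peMl // ltW.
by apply: sub_eball; rewrite subrr enorm0 add0r ler_pM2r // le_max lexx.
Qed.

Lemma cov_rescale (A : R) : exists2 M : R, 1 <= M &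
  forall r r' t E, 0 < r -> r' <= A * r -> cov r' t E -> cov r (t * M) E.
Proof.
have [M M1 hM] := doubling A; exists M => // r r' t E r0 rr' h.
apply: (cov_refine (le_trans ler01 M1) h) => a.
apply: (cov_sub _ (lexx _) (lexx _) (hM a r r0)).
by move=> x [xa _]; apply: lt_le_trans rr'.
Qed.

(** A relation, in place of a map, lets the same statement serve for S_v and for its inverse, which
    is defined only on the image. New centres are points related to some point of the old ball,
    which doubles the radius; the default of [xget] is never met. *)
Lemma cov_expanding (A : R) : exists2 M : R, 1 <= M &
  forall (Q : 'rV[R]_d -> 'rV[R]_d -> Prop) (L r r' t : R) E E',
  0 < r' -> 0 <= L -> L * r <= A * r' ->
  (forall x, E' x -> exists2 y, E y & Q x y) ->
  (forall x x' y y', Q x y -> Q x' y' -> enorm (x - x') <= L * enorm (y - y')) ->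
  cov r t E -> cov r' (t * M) E'.
Proof.
have [M M1 hM] := cov_rescale (2 * A + 1); exists M => //.
move=> Q L r r' t E E' r0 L0 LA EQ QL [c [ct Ec]].
apply: (hM r' (2 * (L * r) + r')) => //; first by lra.
pose f a := xget 0 [set x | exists2 y, Q x y & eball a r y].
exists (map f c); rewrite size_map; split=> // x /EQ [y /Ec [a ac ya] Qxy].
exists (f a); first exact: map_f.
have [y' Qy' ay'] : [set x | exists2 y, Q x y & eball a r y] (f a).
  by apply: xgetPex; exists x, y.
rewrite /eball /=; apply: le_lt_trans (QL _ _ _ _ Qxy Qy') _.
rewrite /eball /= in ay' ya.
have : enorm (y - y') <= 2 * r.
  by have := enorm_tri y a y'; rewrite (enormB a); lra.
move=> /(ler_wpM2l L0); lra.
Qed.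

(** The spectra only consider balls centred in [E]. A ball of radius s / 2 that meets [E] lies in a
    ball of radius [s] centred in [E], and boundedly many of them cover B(x, A s). *)
Lemma cov_recenter (A : R) : exists2 M : R, 1 <= M &
  forall r s t E, 0 < s -> 0 <= t -> (forall x, E x -> cov r t (eball x s `&` E)) ->
  forall x, cov r (M * t) (eball x (A * s) `&` E).
Proof.
have [M M1 hM] := doubling (2 * A); exists M => // r s t E s0 t0 h x.
have s2 : 0 < s / 2 by rewrite divr_gt0.
apply: (@cov_refine (s / 2)) => // [|a].
  apply: (cov_sub _ (lexx _) (lexx _) (hM x (s / 2) s2)) => y [+ _].
  by have -> : 2 * A * (s / 2) = A * s by field.
have [[p [pa Ep]]|no] := pselect (exists p, (eball a (s / 2) `&` E) p).
  apply: (cov_sub _ (lexx _) (lexx _) (h p Ep)) => y [ya [_ Ey]]; split=> //.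
  rewrite /eball /= in ya pa *; have := enorm_tri y a p; rewrite (enormB a); lra.
by apply: cov0 => // y [ya [_ Ey]]; apply: no; exists y.
Qed.

(** Overlap bounds speak of duplicate-free lists; a list that cannot be extended inside [A] exhausts
    it. *)
Lemma finite_enumeration (J : eqType) (A : set J) (M : nat) :
  (forall s : seq J, uniq s -> (forall j, j \in s -> A j) -> (size s <= M)%N) ->
  exists s : seq J, (size s <= M)%N /\ forall j, A j <-> j \in s.
Proof.
move=> hM.
suff grow n : (exists s : seq J, (size s <= M)%N /\ forall j, A j <-> j \in s) \/
    exists s : seq J, [/\ uniq s, size s = n & forall j, j \in s -> A j].
  have [//|[s [us sn sA]]] := grow M.+1.
  by have := hM s us sA; rewrite sn ltnn.
elim: n => [|n [|[s [us sn sA]]]]; [by right; exists [::] | by left |].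
have [[j [Aj js]]|no] := pselect (exists j, A j /\ j \notin s).
  right; exists (j :: s); split; rewrite /= ?js ?sn // => i.
  by rewrite inE => /predU1P[->|/sA].
left; exists s; split; first exact: hM.
move=> j; split=> [Aj|/sA //]; apply: contrapT => /negP js.
by apply: no; exists j.
Qed.

End Covering.

(** * The limit set *)

Section LimitSet.
Context {R : realType} {d : nat} {I : countType}.
Variables (X : set 'rV[R]_d) (S : I -> 'rV[R]_d -> 'rV[R]_d) (rr : seq I -> R).
Variables (C xi : R) (M : nat).
Hypotheses (geo : conformal_geometry X S rr C xi M).
Hypotheses (SX : forall i, S i @` X `<=` X).
Local Notation F := (limit_set X S).
Implicit Types (x y : 'rV[R]_d) (w : nat -> I).

Lemma word_map_stable u x : X x -> X (word_map S u x).
Proof.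
by move=> Xx; elim: u => //= i u IH; apply: (SX (i := i)); exists (word_map S u x).
Qed.

Lemma word_map_X_inj u x y : X x -> X y ->
  word_map S u x = word_map S u y -> x = y.
Proof.
move=> Xx Xy E; have := geo_lower geo u Xx Xy; rewrite E subrr enorm0 mulr0.
rewrite pmulr_rle0 ?(geo_gt0 geo) // => h; apply/subr0_eq/enorm_eq0/le_anti.
by rewrite h enorm_ge0.
Qed.

Definition coded w x :=
  forall n, (0 < n)%N -> (word_map S (mkseq w n) @` X) x.

Lemma mkseq_shift w n : mkseq w n.+1 = w 0%N :: mkseq (fun k => w k.+1) n.
Proof.
rewrite /mkseq /=; congr (_ :: _).
by rewrite -[1%N]/(1 + 0)%N iotaDl -map_comp.
Qed.

(** Each level provides its own preimage; injectivity of the first map on [X] identifies them all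
    with one [y]. *)
Lemma coded_shift w x : coded w x ->
  exists2 y, coded (fun k => w k.+1) y & x = S (w 0%N) y.
Proof.
move=> wx; have [y Xy /= yx] := wx 1%N isT; exists y => // n n0.
have [z Xz] := wx n.+1 isT; rewrite mkseq_shift /= => zx.
exists z => //; apply: (@word_map_X_inj [:: w 0%N]) => //=.
  exact: word_map_stable.
by rewrite zx yx.
Qed.

Lemma coded_prefix w x n : coded w x ->
  exists2 y, coded (fun k => w (n + k)%N) y & x = word_map S (mkseq w n) y.
Proof.
elim: n w x => [|n IH] w x wx; first by exists x.
have [y wy ->] := coded_shift wx; have [z wz ->] := IH _ _ wy.
by exists z => //; rewrite mkseq_shift.
Qed.

Lemma limit_setP x : F x <-> exists w, coded w x.
Proof. by split=> [[w _ wx]|[w wx]]; exists w. Qed.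

Lemma limit_set_sub : F `<=` X.
Proof.
move=> x /limit_setP[w /(_ 1%N isT)[y Xy <-]].
exact: (@word_map_stable [:: w 0%N]).
Qed.

Lemma limit_set_word u x : F x -> F (word_map S u x).
Proof.
move=> Fx; elim: u => //= i u IH; move: IH (limit_set_sub IH).
move: (word_map S u x) => {Fx}x /limit_setP[w wx] Xx; apply/limit_setP.
exists (fun n => if n is k.+1 then w k else i) => -[//|n] _; rewrite mkseq_shift.
case: n => [|n]; first by exists x.
by have [y Xy yx] := wx n.+1 isT; exists y => //; exact: (congr1 (S i) yx).
Qed.

(** A single code serves all lengths, so that a stopping time can later be chosen along it. *)
Lemma limit_set_prefix x : F x -> exists w, forall n, exists2 y, F y &
  x = word_map S (mkseq w n) (S (w n) y).
Proof.
move=> /limit_setP[w wx]; exists w => n; have [y wy ->] := coded_prefix n wx.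
have [z wz ->] := coded_shift wy; rewrite addn0; exists z => //.
by apply/limit_setP; exists (fun k => w (n + k.+1)%N).
Qed.

(** For a constant code the images of [X] are nested and closed, so a cluster point of the orbit of
    [x0] lies in all of them. Continuity is taken from [geo_upper], as the maps matter only on
    [X]. *)
Lemma limit_set_nonempty : [set: I] !=set0 -> compact X -> X !=set0 -> F !=set0.
Proof.
move=> [i _] cX [x0 Xx0]; pose w (n : nat) := i.
pose u n := word_map S (mkseq w n) x0.
have uX n m : (n <= m)%N -> (word_map S (mkseq w n) @` X) (u m).
  move=> nm; rewrite /u -(subnKC nm) /mkseq iotaD map_cat word_map_cat.
  by eexists; last reflexivity; exact: word_map_stable.
have cl n : closed (word_map S (mkseq w n) @` X).
  apply: compact_closed; first exact: norm_hausdorff.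
  apply: continuous_compact => //; apply/subspace_continuousP => x Xx.
  apply/(@cvgrPdist_lt _ _ _ _ (within_filter X (nbhs_filter x))) => e e0.
  apply/nbhs_eballP; pose L := C * rr (mkseq w n).
  have L0 : 0 < L by rewrite mulr_gt0 ?(geo_gt0 geo) // (lt_le_trans _ (geo_C geo)).
  exists (e / L); first by rewrite divr_gt0.
  move=> y; rewrite /eball /= => yx Xy; apply: le_lt_trans (norm_le_enorm _) _.
  rewrite enormB; apply: le_lt_trans (geo_upper geo _ Xy Xx) _.
  by rewrite -ltr_pdivlMl // mulrC.
have [p [Xp clp]] : X `&` cluster (u @ \oo) !=set0.
  by apply: cX; exists 0%N => // n _; exact: (word_map_stable (mkseq w n) Xx0).
exists p; apply/limit_setP; exists w => n _; apply: cl => B Bp.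
have [|q [? ?]] := clp (word_map S (mkseq w n) @` X) B _ Bp; last by exists q.
by exists n => // m nm; exact: uX.
Qed.

End LimitSet.

(** * Absorbing logarithms into small powers *)

Section LogarithmicCount.
Context {R : realType}.

Lemma ln_le_powR (e t : R) : 0 < e -> 1 <= t -> ln t <= e^-1 * t `^ e.
Proof.
move=> e0 t1; have t0 : 0 < t by exact: lt_le_trans t1.
rewrite mulrC ler_pdivlMr // mulrC -ln_powR.
by apply/ltW/ln_sublinear/powR_gt0.
Qed.

Lemma powRD_gt0 (a x y : R) : 0 < a -> a `^ (x + y) = a `^ x * a `^ y.
Proof. by move=> a0; rewrite powRD // (gt_eqF a0) implybT. Qed.

Lemma powRB_gt0 (a x y : R) : 0 < a -> a `^ (x - y) = a `^ x / a `^ y.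
Proof. by move=> a0; rewrite powRB // (gt_eqF a0) implybT. Qed.

Lemma powR_ge1 (t e : R) : 1 <= t -> 0 <= e -> 1 <= t `^ e.
Proof. by move=> t1 e0; rewrite -(powRr0 t) ler_powR. Qed.

(** [k] is about ln t / ln q. This bounds the number of dyadic sizes or of word lengths between two
    scales by a power [e] of their ratio. *)
Lemma exponential_count (q e : R) : 1 < q -> 0 < e -> exists2 L : R, 0 < L &
  forall t, 1 <= t -> exists2 k : nat, t < q ^+ k & k%:R <= L * t `^ e.
Proof.
move=> q1 e0; have lq : 0 < ln q by exact: ln_gt0.
have q0 : 0 < q by exact: lt_trans q1.
exists (e^-1 / ln q + 1); first by rewrite ltr_wpDl // divr_ge0 ?invr_ge0 // ltW.
move=> t t1; have t0 : 0 < t by exact: lt_le_trans t1.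
have lt0 : 0 <= ln t / ln q by rewrite divr_ge0 ?ln_ge0 // ltW.
exists (Num.truncn (ln t / ln q)).+1.
  rewrite -ltr_ln ?posrE ?exprn_gt0 // lnXn // -mulr_natl.
  by rewrite -ltr_pdivrMr // truncnS_gt.
rewrite -natr1 mulrDl mul1r lerD ?powR_ge1 // ?(ltW e0) //.
apply: (@le_trans _ _ (ln t / ln q)); first by rewrite truncn_le.
by rewrite ler_pdivrMr // mulrAC divfK ?gt_eqF // ln_le_powR.
Qed.

End LogarithmicCount.

(** * Assouad spectra *)

Section Spectra.
Context {R : realType} {d : nat}.
Implicit Types (x : 'rV[R]_d) (E : set 'rV[R]_d) (r rho theta phi alpha : R).

Lemma powR_expR (a x : R) : 0 < a -> a `^ x = expR (x * ln a).
Proof. by move=> a0; rewrite /powR gt_eqF. Qed.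

Definition admissible theta E alpha := exists2 C : R, 0 < C &
  forall x rho, E x -> 0 < rho <= 1 ->
    cov (rho `^ theta^-1) (C * rho `^ (alpha * (1 - theta^-1))) (eball x rho `&` E).

Definition upper_admissible theta E alpha := exists2 C : R, 0 < C &
  forall x r rho, E x -> 0 < rho <= 1 -> 0 < r <= rho `^ theta^-1 ->
    cov r (C * (rho / r) `^ alpha) (eball x rho `&` E).

Lemma assouad_spectrumE theta E :
  assouad_spectrum theta E = inf [set alpha | admissible theta E alpha].
Proof.
congr inf; apply/seteqP; split=> alpha [C C0 h]; exists C => // x rho Ex rho0.
  by apply/covering_numberP; exact: h.
by apply/covering_numberP; exact: h.
Qed.

Lemma powR_theta_le theta rho : 0 < theta < 1 -> 0 < rho <= 1 ->
  rho `^ theta^-1 <= rho.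
Proof.
by move=> /andP[th0 th1] rho01; apply: ge1r_powR => //; rewrite invf_ge1 // ltW.
Qed.

Lemma upper_assouad_spectrumE theta E : 0 < theta < 1 ->
  upper_assouad_spectrum theta E = inf [set alpha | upper_admissible theta E alpha].
Proof.
move=> th01; have /andP[th0 th1] := th01.
rewrite /upper_assouad_spectrum lt_eqF //.
congr inf; apply/seteqP; split=> alpha [C C0 h]; exists C => // x r rho Ex.
  move=> rho01 /andP[r0 rrho]; apply/covering_numberP; apply: h => //.
    exact: powR_theta_le.
  by case/andP: rho01.
move=> r0 rrho rhorho rho1; apply/covering_numberP; apply: h; rewrite ?rho1 ?r0 //.
(* Positivity of [rho] follows from the constraints on the scales: 0 to a non-zero power is 0, and a
   negative base gives 1 by convention, both incompatible with them. *)
rewrite andbT ltNge le_eqVlt; apply/negP => /predU1P[rho0|rho0].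
  by move: rrho; rewrite rho0 powR0 ?leNgt ?r0 // invr_neq0 // gt_eqF.
by move: rhorho; rewrite lt0_powR1 // leNgt (lt_trans rho0).
Qed.

Section Fixed.
Variables (theta : R) (E : set 'rV[R]_d).
Hypotheses (th01 : 0 < theta < 1) (E0 : E !=set0).

Lemma scale_ratio_ge1 r rho : 0 < rho <= 1 -> 0 < r <= rho `^ theta^-1 ->
  1 <= rho / r.
Proof.
move=> rho01 /andP[r0 rrho]; rewrite ler_pdivlMr // mul1r.
by apply: le_trans rrho _; exact: powR_theta_le.
Qed.

Lemma upper_admissible_dim : upper_admissible theta E d%:R.
Proof.
exists ((2 * d + 3)%:R ^+ d); first by rewrite exprn_gt0 // addnS.
move=> x r rho Ex rho01 r01; have rr1 := scale_ratio_ge1 rho01 r01.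
have /andP[r0 _] := r01; rewrite powR_mulrn ?(le_trans ler01) // -exprMn.
apply: (cov_sub _ (lexx _) (lexx _) (cov_ball x r0 _)); first by move=> y [].
by rewrite -[leLHS]mul1r -ler_pdivlMr.
Qed.

Lemma upper_admissible_le alpha beta : alpha <= beta ->
  upper_admissible theta E alpha -> upper_admissible theta E beta.
Proof.
move=> ab [C C0 h]; exists C => // x r rho Ex rho01 r01.
apply: (cov_sub (@subset_refl _ _) (lexx _) _ (h x r rho Ex rho01 r01)).
by rewrite ler_pM2l // ler_powR // scale_ratio_ge1.
Qed.

Lemma upper_admissible_ge0 alpha : upper_admissible theta E alpha -> 0 <= alpha.
Proof.
move=> [C C0 h]; rewrite leNgt; apply/negP => a0; have [x Ex] := E0.
(* With R = 1 and a negative exponent, this [r] makes the bound C / B < 1, so no ball at all would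
   cover a set containing [x]. *)
pose B := 2 * C + 1; have B1 : 1 <= B by rewrite lerDr mulr_ge0 // ltW.
have B0 : 0 < B by exact: lt_le_trans B1.
pose r := B `^ alpha^-1.
have r0 : 0 < r by exact: powR_gt0.
have r1 : r <= 1.
  by rewrite -(powRr0 B); apply: ler_powR => //; rewrite invr_le0 ltW.
have : cov r (C * (1 / r) `^ alpha) (eball x 1 `&` E).
  by apply: h => //; rewrite ?ltr01 ?lexx // powR1 r0 r1.
have -> : (1 / r) `^ alpha = B^-1.
  by rewrite div1r -powR_inv1 ?(ltW r0) // /r -!powRrM mulN1r mulrN mulVf ?lt_eqF // powR_inv1 // ltW.
move=> [[|a c] [szc hc]]; last first.
  have : 1 <= C * B^-1 by apply: le_trans szc; rewrite ler1n.
  by rewrite ler_pdivlMr // /B; lra.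
by have [] := hc x; [split=> //; exact: eball_center|].
Qed.

Let S := [set alpha | upper_admissible theta E alpha].

Lemma has_inf_upper_admissible : has_inf S.
Proof.
split; first by exists d%:R; exact: upper_admissible_dim.
by exists 0 => alpha; exact: upper_admissible_ge0.
Qed.

Lemma upper_spectrum_le alpha : upper_admissible theta E alpha ->
  upper_assouad_spectrum theta E <= alpha.
Proof.
move=> h; rewrite upper_assouad_spectrumE //; apply: ge_inf => //.
by have [] := has_inf_upper_admissible.
Qed.

Lemma upper_spectrum_ge0 : 0 <= upper_assouad_spectrum theta E.
Proof.
rewrite upper_assouad_spectrumE //; apply: lb_le_inf.
  by have [] := has_inf_upper_admissible.
by move=> alpha; exact: upper_admissible_ge0.
Qed.

Lemma upper_spectrum_le_dim : upper_assouad_spectrum theta E <= d%:R.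
Proof. exact/upper_spectrum_le/upper_admissible_dim. Qed.

Lemma upper_spectrum_lt alpha : upper_assouad_spectrum theta E < alpha ->
  upper_admissible theta E alpha.
Proof.
rewrite upper_assouad_spectrumE // -subr_gt0 => h.
have [beta Sb bh] := inf_adherent h has_inf_upper_admissible.
by apply: upper_admissible_le Sb; apply: ltW; move: bh; rewrite addrC subrK.
Qed.

Lemma upper_spectrum_le_eps beta :
  (forall e : R, 0 < e -> upper_admissible theta E (beta + e)) ->
  upper_assouad_spectrum theta E <= beta.
Proof.
by move=> h; apply/ler_addgt0Pr => e e0; exact/upper_spectrum_le/h.
Qed.

Lemma upper_admissible_ball (A : R) alpha : upper_admissible theta E alpha ->
  exists2 C : R, 0 < C & forall x r rho, 0 < rho <= 1 -> 0 < r <= rho `^ theta^-1 ->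
    cov r (C * (rho / r) `^ alpha) (eball x (A * rho) `&` E).
Proof.
move=> [C C0 h]; have [M M1 hM] := @cov_recenter R d A.
exists (M * C); first by rewrite mulr_gt0 // (lt_le_trans ltr01).
move=> x r rho rho01 r01; have /andP[rho0 _] := rho01; rewrite -mulrA.
apply: hM => // [|y Ey]; first by rewrite mulr_ge0 ?powR_ge0 // ltW.
exact: h.
Qed.

End Fixed.

Lemma upper_spectrum_mono theta phi E : E !=set0 -> 0 < theta -> theta <= phi ->
  phi < 1 -> upper_assouad_spectrum theta E <= upper_assouad_spectrum phi E.
Proof.
move=> E0 th0 thphi phi1.
have ph01 : 0 < phi < 1 by rewrite phi1 (lt_le_trans th0).
have th01 : 0 < theta < 1 by rewrite th0 (le_lt_trans thphi).
apply: upper_spectrum_le_eps => // e e0.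
have [|C C0 h] := @upper_spectrum_lt phi E ph01 E0 (upper_assouad_spectrum phi E + e).
  by rewrite ltrDl.
exists C => // x r rho Ex rho01 /andP[r0 rrho]; apply: h => //; rewrite r0.
apply: le_trans rrho _; apply: ger_powR => //.
by rewrite lef_pV2 ?posrE // (lt_le_trans th0).
Qed.

(** A scale r between R^(1/theta) and R^(1/phi) is served by the finer cover at R^(1/theta), where
    ln (R / R^(1/theta)) is at most [k] times ln (R / r). *)
Lemma upper_spectrum_growth theta phi E : E !=set0 -> 0 < theta -> theta <= phi ->
  phi < 1 -> (phi^-1 - 1) * upper_assouad_spectrum phi E <=
             (theta^-1 - 1) * upper_assouad_spectrum theta E.
Proof.
move=> E0 th0 thphi phi1.
have ph0 : 0 < phi by exact: lt_le_trans th0 _.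
have ph01 : 0 < phi < 1 by rewrite phi1 ph0.
have th1 : theta < 1 by exact: le_lt_trans phi1.
have th01 : 0 < theta < 1 by rewrite th0 th1.
have pp : 0 < phi^-1 - 1 by rewrite subr_gt0 invf_gt1.
have pt : 0 < theta^-1 - 1 by rewrite subr_gt0 invf_gt1.
have ptp : phi^-1 <= theta^-1 by rewrite lef_pV2.
rewrite mulrC -ler_pdivlMr //; set k := (theta^-1 - 1) / (phi^-1 - 1).
have k1 : 1 <= k by rewrite ler_pdivlMr // mul1r lerB.
have -> : (theta^-1 - 1) * upper_assouad_spectrum theta E / (phi^-1 - 1) =
  k * upper_assouad_spectrum theta E by rewrite /k mulrAC.
apply: upper_spectrum_le_eps => // e e0.
have k0 : 0 < k by exact: lt_le_trans k1.
pose alpha := upper_assouad_spectrum theta E + e / k.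
have alphak : k * upper_assouad_spectrum theta E + e = k * alpha.
  by rewrite /alpha mulrDr mulrCA divff ?mulr1 // gt_eqF.
have [|C C0 h] := @upper_spectrum_lt theta E th01 E0 alpha.
  by rewrite ltrDl divr_gt0.
have a0 : 0 <= alpha by rewrite addr_ge0 ?upper_spectrum_ge0 // divr_ge0 // ltW.
rewrite alphak; exists C => // x r rho Ex rho01 /andP[r0 rrho].
have /andP[rho0 rho1] := rho01.
have rt0 : 0 < rho `^ theta^-1 by exact: powR_gt0.
have rrho1 : 1 <= rho / r by apply: (scale_ratio_ge1 ph01); rewrite ?r0.
have [rt|tr] := leP r (rho `^ theta^-1).
  apply: (cov_sub (@subset_refl _ _) (lexx _) _ (h x r rho Ex rho01 _)); last by rewrite r0.
  by rewrite ler_pM2l // ler_powR // ler_peMl.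
apply: (cov_sub (@subset_refl _ _) (ltW tr) _ (h x _ rho Ex rho01 _)); last by rewrite rt0 lexx.
rewrite ler_pM2l //.
rewrite (@powR_expR (rho / rho `^ theta^-1)) ?divr_gt0 //.
rewrite (@powR_expR (rho / r)) ?divr_gt0 // ler_expR (mulrC k) -mulrA ler_wpM2l //.
rewrite !ln_div ?posrE // ln_powR.
have lr : ln r <= phi^-1 * ln rho by rewrite -ln_powR ler_ln ?posrE // powR_gt0.
have -> : ln rho - theta^-1 * ln rho = k * (ln rho - phi^-1 * ln rho).
  by rewrite /k; move: (theta^-1) (phi^-1) pp => a b pp; field; rewrite gt_eqF.
by rewrite ler_pM2l // lerD2l lerN2.
Qed.

(* Nonincreasing in phi, whereas the spectrum is nondecreasing: hence its continuity. *)
Definition spectrum_profile E phi := (phi^-1 - 1) * upper_assouad_spectrum phi E.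

(** Monotonicity of the spectrum bounds the drop of the profile by (1/phi - 1/psi) times the
    spectrum at [phi], which is at most d. For psi = 1 the second profile is 0. *)
Lemma spectrum_profile_lipschitz E theta phi psi : E !=set0 -> 0 < theta < 1 ->
  theta <= phi -> phi <= psi -> psi <= 1 ->
  `|spectrum_profile E phi - spectrum_profile E psi| <= d%:R * (phi^-1 - psi^-1).
Proof.
move=> E0 /andP[th0 th1] thphi phipsi psi1; rewrite /spectrum_profile.
have ph0 : 0 < phi by exact: lt_le_trans th0 _.
have ps0 : 0 < psi by exact: lt_le_trans ph0 _.
move: phipsi psi1; rewrite le_eqVlt => /predU1P[->|phipsi]; first by rewrite !subrr normr0 mulr0.
move=> psi1; have ph1 : phi < 1 by exact: lt_le_trans psi1.
have ph01 : 0 < phi < 1 by rewrite ph0.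
have D0 := upper_spectrum_ge0 ph01 E0.
have Dd := upper_spectrum_le_dim ph01 E0.
have pp : psi^-1 < phi^-1 by rewrite ltf_pV2.
have p1 : 1 <= psi^-1 by rewrite invf_ge1.
move: psi1; rewrite le_eqVlt => /predU1P[->|psi1].
  rewrite invr1 subrr mul0r subr0 ger0_norm; last by rewrite mulr_ge0 //; lra.
  by rewrite mulrC ler_wpM2r //; lra.
have ps01 : 0 < psi < 1 by rewrite ps0.
have h1 := upper_spectrum_mono E0 ph0 (ltW phipsi) psi1.
have h2 := upper_spectrum_growth E0 ph0 (ltW phipsi) psi1.
rewrite ger0_norm ?subr_ge0 //.
have : (psi^-1 - 1) * upper_assouad_spectrum phi E <=
  (psi^-1 - 1) * upper_assouad_spectrum psi E by rewrite ler_wpM2l //; lra.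
have : (phi^-1 - psi^-1) * upper_assouad_spectrum phi E <= (phi^-1 - psi^-1) * d%:R.
  by rewrite ler_wpM2l //; lra.
lra.
Qed.

End Spectra.

(** * Hausdorff and box dimensions *)

Section HausdorffAndBox.
Context {R : realType} {d : nat}.
Implicit Types (x : 'rV[R]_d) (E : set 'rV[R]_d) (r : R).

Lemma ediam_eball x r : (ediam (eball x r) <= (2 * r)%:E)%E.
Proof.
apply: ge_ereal_sup => _ [[y z] [/= yx zx] <-]; rewrite lee_fin /=.
rewrite /eball /= in yx zx.
by have := enorm_tri y x z; rewrite (enormB x); lra.
Qed.

Lemma hausdorff_pre_cov r (delta s t : R) E : 0 < s -> 0 < r -> 2 * r <= delta ->
  cov r t E -> (hausdorff_pre s delta E <= (t * (2 * r) `^ s)%:E)%E.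
Proof.
move=> s0 r0 rd [c [ct Ec]]; pose U k := if (k < size c)%N then eball (nth 0 c k) r else set0.
have a0 : 0 <= (2 * r) `^ s by exact: powR_ge0.
apply: le_trans (_ : (\sum_(0 <= k <oo | U k != set0) poweR (ediam (U k)) s <= _)%E).
  apply: ereal_inf_lbound; exists U => //; split.
    move=> k; rewrite /U; case: ifP => _.
      by apply: le_trans (ediam_eball _ _) _; rewrite lee_fin.
    by apply: ge_ereal_sup => _ [[? ?] [/= []]].
  move=> x /Ec [a /(nthP 0)[k kc <-] xa]; exists k => //.
  by rewrite /U kc.
have dU k : (poweR (ediam (U k)) s <= (if (k < size c)%N then (2 * r) `^ s else 0)%:E)%E
    \/ U k = set0.
  rewrite /U; case: ifP => _; [left | by right].
  rewrite -poweR_EFin; apply: gt0_ler_poweR; rewrite ?(ltW s0) //.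
  - rewrite in_itv /= leey andbT; apply: ereal_sup_ubound.
    exists (nth 0 c k, nth 0 c k); last by rewrite /= subrr enorm0.
    by split; exact: eball_center.
  - by rewrite in_itv /= leey andbT lee_fin mulr_ge0 // ltW.
  - exact: ediam_eball.
apply: lime_le; first by apply: is_cvg_nneseries_cond => n _ _; exact: poweR_ge0.
apply: nearW => N; apply: le_trans (_ : ((minn N (size c))%:R * (2 * r) `^ s)%:E <= _)%E.
  rewrite big_mkcond; elim: N => [|N IH]; first by rewrite big_geq // min0n mul0r.
  rewrite big_nat_recr //=.
  apply: le_trans (leeD IH (_ : _ <= (if (N < size c)%N then (2 * r) `^ s else 0)%:E)%E) _.
    have [h|->] := dU N; last by rewrite eqxx lee_fin; case: ifP.
    by case: ifP => // _; rewrite lee_fin; case: ifP.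
  rewrite -EFinD lee_fin; case: ltnP => Nc.
    by rewrite (minn_idPl Nc) -[N.+1%:R]natr1 [leRHS]mulrDl mul1r.
  by rewrite (minn_idPr (leqW Nc)) addr0.
rewrite lee_fin ler_wpM2r //; apply: le_trans ct.
by rewrite ler_nat geq_minr.
Qed.

Lemma upper_admissible_cov theta E alpha : 0 < theta < 1 -> E !=set0 ->
  bounded_set E -> upper_admissible theta E alpha ->
  exists2 C : R, 0 < C & forall r, 0 < r <= 1 -> cov r (C * r `^ (- alpha)) E.
Proof.
move=> th01 [x0 Ex0] bE adm; have [D D0 hD] := bounded_eball bE.
have [C C0 h] := upper_admissible_ball (D + 1) adm.
exists C => // r /andP[r0 r1].
have := h x0 r 1; rewrite ltr01 lexx powR1 r0 r1 => /(_ isT isT).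
have -> : (1 / r) `^ alpha = r `^ (- alpha).
  by rewrite div1r -powR_inv1 ?(ltW r0) // -powRrM mulN1r.
apply: cov_sub => // x Ex; split=> //.
by rewrite /eball /= mulr1 (le_lt_trans (hD _ _ Ex Ex0)) // ltrDl.
Qed.

(** Taking R = 1 gives N_r(E) <= C r^(-alpha), so the covering sums at exponent alpha + e are O(r^e)
    and tend to 0. *)
Lemma hausdorff_dim_le theta E alpha : 0 < theta < 1 -> E !=set0 ->
  bounded_set E -> upper_admissible theta E alpha -> hausdorff_dim E <= alpha.
Proof.
move=> th01 E0 bE adm; have a0 := upper_admissible_ge0 E0 adm.
have [C C0 hC] := upper_admissible_cov th01 E0 bE adm.
apply/ler_addgt0Pr => e e0.
have s0 : 0 < alpha + e by rewrite ltr_wpDl.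
apply: ge_inf; first by exists 0 => s [].
split; first exact: ltW.
have ge0 delta : (0 <= hausdorff_pre (alpha + e) delta E)%E.
  apply: le_ereal_inf_tmp => _ [U _ <-].
  by apply: nneseries_ge0 => n _ _; exact: poweR_ge0.
have pre0 delta : 0 < delta -> hausdorff_pre (alpha + e) delta E = 0%E.
  move=> delta0; apply/le_anti; rewrite ge0 andbT; apply/lee_addgt0Pr => eta eta0.
  rewrite add0e.
  pose k := C * 2 `^ (alpha + e); have k0 : 0 < k by rewrite mulr_gt0 // powR_gt0.
  pose r := Num.min 1 (Num.min (delta / 2) ((eta / k) `^ e^-1)).
  have r0 : 0 < r by rewrite !lt_min ltr01 divr_gt0 //= powR_gt0 // divr_gt0.
  have r1 : r <= 1 by rewrite ge_min lexx.
  have rd : 2 * r <= delta.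
    have : r <= delta / 2 by rewrite !ge_min lexx orbT.
    lra.
  have rk : r `^ e <= eta / k.
    have -> : eta / k = ((eta / k) `^ e^-1) `^ e.
      by rewrite -powRrM mulVf ?gt_eqF // powRr1 // divr_ge0 // ltW.
    apply: ge0_ler_powR; rewrite ?nnegrE ?powR_ge0 ?(ltW e0) ?(ltW r0) //.
    by rewrite !ge_min lexx !orbT.
  have rcov := hC r; rewrite r0 r1 in rcov.
  apply: le_trans (hausdorff_pre_cov s0 r0 rd (rcov isT)) _.
  rewrite lee_fin powRM ?(ltW r0) //.
  have -> : C * r `^ (- alpha) * (2 `^ (alpha + e) * r `^ (alpha + e)) = k * r `^ e.
    have -> : r `^ e = r `^ (- alpha) * r `^ (alpha + e).
      by rewrite -powRD ?addKr // gt_eqF // implybT.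
    by rewrite /k; ring.
  by rewrite mulrC -ler_pdivlMr.
apply/le_anti/andP; split.
  by apply: ge_ereal_sup => _ [delta delta0 <-]; rewrite pre0.
apply: le_trans (ge0 1) _; apply: ereal_sup_ubound.
by exists 1 => //; exact: ltr01.
Qed.

Lemma upper_box_cov E b : E !=set0 -> bounded_set E -> upper_box_dim E < b ->
  exists2 C : R, 0 < C & forall r, 0 < r <= 1 -> cov r (C * r `^ (- b)) E.
Proof.
move=> E0 bE bb.
have th01 : 0 < (2^-1 : R) < 1 by rewrite invr_gt0 ltr0n /= invf_lt1 // ltr1n.
have [C C0 hC] := upper_admissible_cov th01 E0 bE (upper_admissible_dim E th01).
pose f r : \bar R := (lne (covering_number r E) * ((- ln r)^-1)%:E)%E.
have exp1 : 0 < (expR (-1) : R) < 1 by rewrite expR_gt0 expR_lt1 oppr_lt0 ltr01.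
have cN1 r : (1 <= covering_number r E)%E.
  apply: le_ereal_inf_tmp => _ [[|n] [c Ec] <-]; last by rewrite lee_fin ler1n.
  by have [x /Ec [[]]] := E0.
have fle r : 0 < r <= expR (-1) -> (f r <= (`|ln C| + d%:R)%:E)%E.
  move=> /andP[r0 re]; have r1 : r <= 1 by rewrite (le_trans re) // ltW; case/andP: exp1.
  have lr : 1 <= - ln r by rewrite lerNr -(expRK (-1)) ler_ln ?posrE // expR_gt0.
  have lr0 : 0 < - ln r by exact: lt_le_trans lr.
  have Cr0 : 0 < C * r `^ (- d%:R) by rewrite mulr_gt0 // powR_gt0.
  rewrite /f lee_pdivrMr // -EFinM.
  have : (lne (covering_number r E) <= lne (C * r `^ (- d%:R))%:E)%E.
    rewrite lee_lne ?in_itv /= ?leey ?andbT ?lee_fin ?(ltW Cr0) //.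
      by apply/covering_numberP; apply: hC; rewrite r0 r1.
    by rewrite (le_trans _ (cN1 r)).
  rewrite lne_EFin //; move/le_trans; apply; rewrite lee_fin.
  rewrite lnM ?posrE ?powR_gt0 // ln_powR mulrDl mulNr -mulrN lerD2r.
  by rewrite (le_trans (ler_norm _)) // ler_peMr.
have : (limf_esup f 0^'+ < b%:E)%E.
  (* [fine] sends +oo to 0, so the upper limit must first be bounded above; the trivial exponent d
     does it. *)
  have Lfin : (limf_esup f 0^'+ <= (`|ln C| + d%:R)%:E)%E.
    rewrite limf_esupE; apply: le_trans (ereal_inf_lbound _) _.
      exists [set r | 0 < r <= expR (-1)] => //.
      near=> r; apply/andP; split => //.
      by near: r; apply: nbhs_right_le; case/andP: exp1.
    by apply: ge_ereal_sup => _ [r /fle h <-].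
  move: bb Lfin; rewrite /upper_box_dim -/f; case: (limf_esup f 0^'+) => [l| |] //=.
  by move=> _ _; exact: ltNyr.
rewrite limf_esupE => /ereal_inf_lt[_ [A A0 <-] Ab].
have [delta delta0 hd] : exists2 delta : R, 0 < delta <= 1 & forall r, 0 < r < delta ->
    cov r (r `^ (- b)) E.
  move: A0; rewrite /at_right /within /= => /nbhs_ballP[e /= e0 eA].
  exists (Num.min e (expR (-1))).
    by rewrite lt_min e0 ge_min; case/andP: exp1 => -> /ltW ->; rewrite orbT.
  move=> r /andP[r0]; rewrite lt_min => /andP[re rexp].
  have Ar : A r.
    by apply: eA; rewrite // -ball_normE /= sub0r normrN gtr0_norm.
  have r1 : r < 1 by rewrite (lt_trans rexp) //; case/andP: exp1.
  have lr : 0 < - ln r by rewrite oppr_gt0 ln_lt0 // r0.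
  have : (f r <= b%:E)%E.
    by apply: ltW; apply: le_lt_trans Ab; apply: ereal_sup_ubound; exists r.
  rewrite /f lee_pdivrMr // -EFinM => h.
  apply/covering_numberP; rewrite -lee_lne ?in_itv /= ?leey ?andbT ?lee_fin ?powR_ge0 //.
    by rewrite (leNgt (r `^ (- b))) powR_gt0 //= ln_powR mulNr -mulrN.
  by rewrite (le_trans _ (cN1 r)).
case/andP: delta0 => delta0 delta1.
(* For r in [delta, 1] the cover at scale delta / 2 serves; [m] is a lower bound of r^(-b) there
   whatever the sign of [b]. *)
pose N := C * (delta / 2) `^ (- d%:R); pose m := Num.min 1 (delta `^ (- b)).
have dd : 0 < delta / 2 <= 1 by rewrite divr_gt0 //=; lra.
have N0 : 0 <= N by rewrite mulr_ge0 ?powR_ge0 // ltW.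
have m0 : 0 < m by rewrite lt_min ltr01 powR_gt0.
exists (N / m + 1); first by rewrite ltr_wpDl // divr_ge0 // ltW.
move=> r /andP[r0 r1]; have [rd|dr] := ltP r delta.
  apply: (cov_sub (@subset_refl _ _) (lexx _) _ (hd r _)); last by rewrite r0.
  by rewrite ler_peMl ?powR_ge0 // lerDr divr_ge0 // ltW.
apply: (cov_sub (@subset_refl _ _) _ _ (hC _ dd)); first lra.
rewrite -/N; apply: (@le_trans _ _ (N / m * m)); first by rewrite divfK // gt_eqF.
apply: ler_pM; rewrite ?divr_ge0 ?(ltW m0) ?lerDl //.
have [b0|b0] := leP 0 b; last first.
  by rewrite ge_min; apply/orP; right; apply: ge0_ler_powR;
    rewrite ?nnegrE ?oppr_ge0 ?(ltW b0) ?(ltW delta0) ?(ltW r0).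
rewrite ge_min; apply/orP; left.
by rewrite -[leLHS](powRr0 r); apply: ger_powR; rewrite ?r0 ?oppr_le0.
Unshelve. all: by end_near. Qed.

End HausdorffAndBox.

(** The profile is Lipschitz in 1/phi, and 1/phi is Lipschitz in phi on [theta, 1] with constant
    theta^(-2); the extreme value theorem applies. *)
Lemma spectrum_bound_max (R : realType) (d : nat) (P F : set 'rV[R]_d) (theta : R) :
  P !=set0 -> 0 < theta < 1 ->
  exists m, is_maximum [set spectrum_bound P F theta phi
                       | phi in [set phi : R | theta <= phi <= 1]] m.
Proof.
move=> P0 th01; have /andP[th0 th1] := th01.
pose b := upper_box_dim F; pose c := theta^-1 - 1.
have c0 : 0 < c by rewrite subr_gt0 invf_gt1.
pose L := (d%:R + `|b|) * (theta^-1 ^+ 2) / c.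
have lip phi psi : theta <= phi -> phi <= psi -> psi <= 1 ->
    `|spectrum_bound P F theta phi - spectrum_bound P F theta psi| <= L * (psi - phi).
  move=> h1 h2 h3; have ph0 : 0 < phi by exact: lt_le_trans h1.
  have ps0 : 0 < psi by exact: lt_le_trans h2.
  have i1 : 0 <= phi^-1 - psi^-1 by rewrite subr_ge0 lef_pV2.
  have -> : spectrum_bound P F theta phi - spectrum_bound P F theta psi =
      ((spectrum_profile P phi - spectrum_profile P psi) - (phi^-1 - psi^-1) * b) / c.
    by rewrite /spectrum_bound /spectrum_profile -/b -/c; field; rewrite !gt_eqF.
  have ci0 : 0 <= c^-1 by rewrite invr_ge0 ltW.
  rewrite normrM (ger0_norm ci0).
  rewrite /L [leRHS]mulrAC ler_pM2r ?invr_gt0 //.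
  apply: le_trans (ler_normB _ _) _; rewrite normrM (ger0_norm i1).
  have := spectrum_profile_lipschitz P0 th01 h1 h2 h3.
  have i2 : phi^-1 - psi^-1 <= theta^-1 ^+ 2 * (psi - phi).
    have -> : phi^-1 - psi^-1 = phi^-1 * psi^-1 * (psi - phi).
      by field; rewrite !gt_eqF.
    rewrite ler_wpM2r ?subr_ge0 // expr2 ler_pM ?invr_ge0 ?(ltW ph0) ?(ltW ps0) //.
      by rewrite lef_pV2.
    by rewrite lef_pV2 ?posrE // (le_trans h1).
  have := ler_wpM2l (normr_ge0 b) i2; have := ler_wpM2l (ler0n R d) i2.
  rewrite (mulrC _ `|b|); lra.
have L0 : 0 <= L by rewrite !mulr_ge0 ?addr_ge0 ?exprn_ge0 ?invr_ge0 // ltW.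
have cont : {within `[theta, 1], continuous (spectrum_bound P F theta)}.
  apply/subspace_continuousP => phi; rewrite /= in_itv /= => /andP[h1 h2].
  apply/(@cvgrPdist_lt _ _ _ _ (within_filter _ (nbhs_filter phi))) => e e0.
  apply/nbhs_ballP; exists (e / (L + 1)) => /=; first by rewrite divr_gt0 // ltr_wpDl.
  move=> psi; rewrite -ball_normE /= ltr_pdivlMr ?ltr_wpDl // => hd.
  rewrite in_itv /= => /andP[h3 h4].
  have hle : `|spectrum_bound P F theta phi - spectrum_bound P F theta psi| <= L * `|phi - psi|.
    have [hh|/ltW hh] := leP phi psi.
      by rewrite distrC [`|phi - psi|]distrC distrC (ger0_norm (_ : 0 <= psi - phi)) ?subr_ge0 // lip.
    by rewrite distrC (ger0_norm (_ : 0 <= phi - psi)) ?subr_ge0 // lip.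
  apply: le_lt_trans hle _; rewrite mulrC; apply: le_lt_trans hd.
  by rewrite ler_wpM2l // lerDl.
have [phi hphi maxphi] := EVT_max (ltW th1) cont.
exists (spectrum_bound P F theta phi); split.
  by exists phi => //; move: hphi; rewrite in_itv.
by move=> _ [psi hpsi <-]; apply: maxphi; rewrite in_itv.
Qed.

(** * Comparison of spectra *)

Section Comparison.
Context {R : realType} {d : nat} {I : countType}.
Variables (X : set 'rV[R]_d) (S : I -> 'rV[R]_d -> 'rV[R]_d) (rr : seq I -> R).
Variables (Cg xi : R) (M : nat).
Hypotheses (geo : conformal_geometry X S rr Cg xi M).
Hypotheses (SX : forall i, S i @` X `<=` X).
Local Notation F := (limit_set X S).
Hypotheses (F0 : F !=set0).
Implicit Types (x y z : 'rV[R]_d) (r rho s t alpha theta : R).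

Local Notation q i := (rr [:: i]).

Let Cg0 : 0 < Cg. Proof. exact: lt_le_trans (geo_C geo). Qed.
Let FX : F `<=` X. Proof. exact: limit_set_sub SX. Qed.

Lemma size_le_count (J K : eqType) (s : seq J) (c : seq K) (Q : K -> pred J) :
  (forall j, j \in s -> exists2 a, a \in c & Q a j) ->
  (size s <= \sum_(a <- c) count (Q a) s)%N.
Proof.
elim: s => [|j s IH] h; first by [].
have -> : (\sum_(a <- c) count (Q a) (j :: s) =
    \sum_(a <- c) Q a j + \sum_(a <- c) count (Q a) s)%N by rewrite -big_split.
rewrite /= -add1n leq_add //; last by apply: IH => i si; apply: h; rewrite inE si orbT.
have [a ac Qa] := h j (mem_head _ _).
by rewrite (big_rem a ac) /= Qa.
Qed.

Lemma piece_diam i x y : (S i @` X) x -> (S i @` X) y ->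
  enorm (x - y) <= Cg * Cg * q i.
Proof.
move=> [x' Xx' <-] [y' Xy' <-]; apply: le_trans (geo_upper geo [:: i] Xx' Xy') _.
by rewrite [leRHS]mulrAC ler_wpM2l ?(geo_diam geo) // mulr_ge0 ?ltW // (geo_gt0 geo).
Qed.

(** Each ball of the cover meets at most [M] first-level pieces of ratio at least [rho], by
    [geo_overlap] for words of length one. *)
Lemma count_pieces (G : set 'rV[R]_d) rho t (A : set I) : 0 < rho -> cov rho t G ->
  (forall i, A i -> rho <= q i /\ exists2 p, G p & (S i @` X) p) ->
  exists s : seq I, (size s)%:R <= t * M%:R /\ forall i, A i <-> i \in s.
Proof.
move=> rho0 [c [ct Gc]] hA.
pose Q a i := `[< exists2 p, eball a rho p & (S i @` X) p >].
have [s us sA|s [sM sA]] := @finite_enumeration I A (size c * M)%N.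
  apply: leq_trans (_ : \sum_(a <- c) M <= _)%N; last first.
    by rewrite big_const_seq count_predT iter_addn_0 mulnC.
  apply: leq_trans (@size_le_count _ _ s c Q _) _.
    move=> i /sA /hA[_ [p Gp Sp]]; have [a ac pa] := Gc p Gp; exists a => //.
    by apply/asboolP; exists p.
  apply: leq_sum => a _; rewrite -size_filter -(size_map (fun i => [:: i])).
  apply: (geo_overlap geo (n := 1%N) (z := a) rho0).
    by rewrite map_inj_uniq ?filter_uniq // => i j [].
  move=> _ /mapP[i + ->]; rewrite mem_filter => /andP[/asboolP[p pa [z Xz zp]] /sA /hA[qi _]].
  by split=> //; exists z => //; rewrite /= zp.
exists s; split=> //; apply: (@le_trans _ _ (size c * M)%:R); first by rewrite ler_nat.
by rewrite natrM ler_wpM2r.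
Qed.

Lemma dyadic_scale t : 1 <= t -> exists k : nat, 2 ^+ k <= t < 2 ^+ k.+1.
Proof.
move=> t1; have ex : exists k : nat, t < 2 ^+ k.+1.
  exists (Num.truncn t); apply: lt_trans (truncnS_gt t) _.
  by rewrite -natrX ltr_nat ltn_expl.
case: (ex_minnP ex) => [[|k] tk kmin]; first by exists 0%N; rewrite expr0 t1.
by exists k.+1; rewrite tk andbT leNgt; apply/negP => /kmin; rewrite ltnn.
Qed.

(** Along the powers of one letter the ratio tends to 0 but loses at most a factor q i / Cg at each
    step, so it cannot jump over the window. *)
Lemma ratio_select : [set: I] !=set0 -> exists2 kappa : R, 0 < kappa &
  forall delta, 0 < delta <= 1 -> exists v, kappa * delta <= rr v <= delta.
Proof.
move=> [i _]; exists (q i / Cg); first by rewrite divr_gt0 // (geo_gt0 geo).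
move=> delta /andP[d0 d1]; pose u n := iter n (rcons^~ i) [::].
have su n : size (u n) = n by elim: n => //= n IH; rewrite size_rcons IH.
have /andP[xi0 xi1] := geo_xi geo.
have q1 : q i / Cg <= 1.
  rewrite ler_pdivrMr // mul1r; apply: le_trans (geo_le geo _) (le_trans _ (geo_C geo)).
  by rewrite expr1 ltW.
have ex : exists n, rr (u n) <= delta.
  have [||L _ /(_ delta^-1)] := @exponential_count R xi^-1 1.
  - by rewrite invf_gt1.
  - by [].
  rewrite invf_ge1 // => /(_ d1)[n hn _]; exists n.
  apply: le_trans (geo_le geo _) _; rewrite su ltW //.
  by move: hn; rewrite exprVn ltf_pV2 ?posrE // exprn_gt0.
case: (ex_minnP ex) => [[|n] hn nmin]; [exists (u 0%N) | exists (u n.+1)]; last first.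
  rewrite hn andbT; have := geo_rcons geo (u n) i; rewrite -/(u n.+1).
  have : delta < rr (u n) by rewrite ltNge; apply/negP => /nmin; rewrite ltnn.
  move=> h1 h2; rewrite mulrAC ler_pdivrMr // mulrC [leRHS]mulrC.
  by apply: le_trans h2; rewrite ler_wpM2r ?(ltW h1) // ltW // (geo_gt0 geo).
rewrite hn andbT /u /= (geo_nil geo); move: q1 d1 d0.
have : 0 <= q i / Cg by rewrite divr_ge0 ?(ltW Cg0) // ltW // (geo_gt0 geo).
by move=> a b c e; rewrite -[leRHS]mulr1; apply: ler_pM => //; exact: ltW.
Qed.

(* Shrinking by [S_v] with [rr v] comparable to [(r / R^(1/theta))^(theta/(1-theta))]
   turns a pair of scales [r <= R^(1/theta)] into one with equality. *)
Lemma admissible_upper theta alpha : [set: I] !=set0 -> 0 < theta < 1 ->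
  admissible theta F alpha -> upper_admissible theta F alpha.
Proof.
move=> I0 /andP[th0 th1] [C C0 hC].
have [kappa k0 hk] := ratio_select I0.
have [M1 M11 hM1] := @cov_expanding R d (Cg / kappa).
have [M2 M21 hM2] := @cov_recenter R d Cg.
have M10 : 0 < M1 by exact: lt_le_trans M11.
have M20 : 0 < M2 by exact: lt_le_trans M21.
exists (M2 * (C * M1)); first by rewrite !mulr_gt0.
move=> x0 r rho Fx0 /andP[rho0 rho1] /andP[r0 rrho].
have rt0 : 0 < rho `^ theta^-1 by exact: powR_gt0.
pose a := r / rho `^ theta^-1.
have a0 : 0 < a by rewrite divr_gt0.
have a1 : a <= 1 by rewrite ler_pdivrMr // mul1r.
have t1 : 0 < theta^-1 - 1 by rewrite subr_gt0 invf_gt1.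
(* The value is forced by (delta rho)^(1/theta) = delta r, that is delta^(1/theta - 1) = a. *)
pose delta := a `^ (theta^-1 - 1)^-1.
have d0 : 0 < delta by exact: powR_gt0.
have d1 : delta <= 1.
  by rewrite -(powRr0 a); apply: ger_powR; rewrite ?a0 // invr_ge0 ltW.
have dE : delta `^ theta^-1 = delta * a.
  rewrite -[theta^-1](subrK 1) powRD_gt0 //.
  rewrite powRr1 ?(ltW d0) // mulrC; congr (_ * _).
  by rewrite -powRrM mulVf ?gt_eqF // powRr1 // ltW.
have [|v /andP[v1 v2]] := hk delta; first by rewrite d0.
have v0 := geo_gt0 geo v.
have E1 : (delta * rho) `^ theta^-1 = delta * r.
  by rewrite powRM ?ltW // dE /a -mulrA divfK // gt_eqF.
have E2 : (delta * rho) `^ (alpha * (1 - theta^-1)) = (rho / r) `^ alpha.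
  have dr0 : 0 < delta * rho by rewrite mulr_gt0.
  rewrite (mulrC alpha) powRrM; congr (_ `^ _).
  rewrite powRB_gt0 //.
  by rewrite powRr1 ?(ltW dr0) // E1 -mulf_div divff ?mul1r // gt_eqF.
(* S_v stretches by at most Cg delta, so it is balls of radius rho / Cg that are sent into balls of
   radius delta rho; recentring recovers the radius [rho]. *)
have Cr : Cg * (rho / Cg) = rho by rewrite mulrCA divff ?mulr1 // gt_eqF.
have -> : eball x0 rho `&` F = eball x0 (Cg * (rho / Cg)) `&` F by rewrite Cr.
rewrite -mulrA; apply: hM2; first by rewrite divr_gt0.
  by rewrite !mulr_ge0 ?powR_ge0 // ltW.
move=> x Fx; rewrite mulrAC.
have := hC (word_map S v x) (delta * rho) (limit_set_word SX v Fx).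
rewrite mulr_gt0 ?mulr_ile1 ?(ltW d0) ?(ltW rho0) // => /(_ isT); rewrite E1 E2.
apply: (hM1 (fun y z => z = word_map S v y /\ X y) (Cg / rr v)) => //.
- by rewrite divr_ge0 // ltW.
- rewrite [leLHS]mulrA ler_pM2r // mulrAC ler_pdivrMr // -mulrA ler_pM2l //.
  by rewrite ler_pdivlMl.
- move=> y [yx Fy]; exists (word_map S v y); last by split=> //; exact: FX.
  split; last exact: (limit_set_word SX v Fy).
  rewrite /eball /=; apply: le_lt_trans (geo_upper geo v (FX Fy) (FX Fx)) _.
  apply: (@le_lt_trans _ _ (Cg * delta * enorm (y - x))).
    by rewrite ler_wpM2r ?enorm_ge0 // ler_pM2l.
  by rewrite (mulrC Cg) -mulrA ltr_pM2l // mulrC -ltr_pdivlMr.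
- move=> y y' _ _ [-> Xy] [-> Xy']; have := geo_lower geo v Xy Xy'.
  by rewrite mulrAC ler_pdivlMr // mulrC.
Qed.

Lemma upper_admissible_spec theta alpha : 0 < theta < 1 ->
  upper_admissible theta F alpha -> admissible theta F alpha.
Proof.
move=> th01 [C C0 hC]; exists C => // x rho Fx rho01; have /andP[rho0 rho1] := rho01.
have rt0 : 0 < rho `^ theta^-1 by exact: powR_gt0.
have := hC x (rho `^ theta^-1) rho Fx rho01; rewrite rt0 lexx => /(_ isT).
suff -> : (rho / rho `^ theta^-1) `^ alpha = rho `^ (alpha * (1 - theta^-1)) by [].
rewrite (mulrC alpha) powRrM; congr (_ `^ _); rewrite powRB_gt0 //.
by rewrite powRr1 // ltW.
Qed.

Variable (P : set 'rV[R]_d).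
Hypotheses (hP : P `<=` \bigcup_i (S i @` X)).
Hypotheses (hP1 : forall i, exists! p, (P `&` S i @` X) p).

(* The pieces are split by size: tiny ones are close to F, those of size about s are
   no more than the covering number of F at scale s times M, and large ones number at
   most M. The logarithmic number of sizes is absorbed by [e]. *)
Lemma upper_admissible_transversal theta alpha (e : R) : 0 < theta < 1 -> 0 < e ->
  upper_admissible theta F alpha -> upper_admissible theta P (alpha + e).
Proof.
move=> th01 e0 adm; have a0 := upper_admissible_ge0 F0 adm.
have [f0 Ff0] := F0.
have [C C0 hC] := upper_admissible_ball (1 + 2 * (Cg * Cg)) adm.
have [M1 M11 hM1] := @cov_rescale R d (1 + Cg * Cg).
have [L L0 hL] := @exponential_count R 2 e ltac:(by rewrite ltr1n) e0.
have M10 : 0 < M1 by exact: lt_le_trans M11.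
exists (C * M1 + L * (C * M%:R) + M%:R + 1).
  by rewrite ltr_wpDl // !addr_ge0 // ?mulr_ge0 // ltW.
move=> x0 r rho Px0 rho01 r01; have /andP[rho0 rho1] := rho01; have /andP[r0 rrho] := r01.
pose t := rho / r; have t1 : 1 <= t := scale_ratio_ge1 th01 rho01 r01.
have t0 : 0 < t by exact: lt_le_trans t1.
have rr1 : r <= rho by rewrite -[r]mul1r -ler_pdivlMr.
pose N := C * t `^ alpha.
have ta0 : 0 < t `^ alpha by exact: powR_gt0.
have N0 : 0 <= N by rewrite mulr_ge0 ?powR_ge0 // ltW.
have te1 : 1 <= t `^ e by rewrite powR_ge1 // ltW.
have taE : t `^ (alpha + e) = t `^ alpha * t `^ e.
  exact: powRD_gt0.
have CC0 : 0 <= Cg * Cg by rewrite mulr_ge0 // ltW.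
have hF := hC x0 r rho rho01 r01.
(* The point of [P] in a piece is replaced by S_i(f0) in [F], at distance at most Cg^2 q i <= 2 Cg^2
   rho; this explains the enlarged ball. *)
have center i p : (S i @` X) p -> eball x0 rho p -> q i <= 2 * rho ->
    [/\ (S i @` X) (S i f0), F (S i f0), enorm (p - S i f0) <= Cg * Cg * q i &
       enorm (S i f0 - x0) < (1 + 2 * (Cg * Cg)) * rho].
  move=> Sp px qi; have Sf : (S i @` X) (S i f0) by exists f0 => //; exact: FX.
  have h1 := piece_diam Sp Sf; split=> //.
    exact: (limit_set_word SX [:: i] Ff0).
  rewrite /eball /= in px; have := enorm_tri (S i f0) p x0; rewrite (enormB (S i f0) p).
  have := ler_wpM2l CC0 qi; lra.
have [K hK1 hK2] := hL t t1.
pose tiny := [set p | eball x0 rho p /\ exists2 i, (S i @` X) p & q i <= r].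
pose big := [set p | [/\ eball x0 rho p, P p & exists2 i, (S i @` X) p & rho <= q i]].
pose mid k := [set p | [/\ eball x0 rho p, P p & exists2 i, (S i @` X) p &
  [/\ 2 ^+ k * r <= q i & q i <= rho]]].
have pieces (s : seq I) : cov r ((size s)%:R * 1) [set p | P p /\ exists2 i, i \in s & (S i @` X) p].
  apply: (@cov_bigcup _ _ _ _ (fun i => P `&` S i @` X)) => [i _|p [Pp [i si Sp]]].
    have [p [pi puniq]] := hP1 i; apply: cov_sub (cov_point p r0 (lexx 1)) => // p' pi'.
    by rewrite (puniq p').
  by exists i.
have tinyP : cov r (N * M1) tiny.
  apply: (hM1 r ((1 + Cg * Cg) * r)) => //.
  have [c [cN hc]] := hF; exists c; split=> // p [px [i Sp qi]].
  have [|_ Fi pi xi'] := center i p Sp px; first lra.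
  have [a ac ai] := hc (S i f0) (conj xi' Fi); exists a => //.
  rewrite /eball /= in ai *; have := enorm_tri p (S i f0) a.
  have := ler_wpM2l CC0 qi; lra.
have bigP : cov r M%:R big.
  pose A := [set i | exists2 p, eball x0 rho p & (S i @` X) p /\ rho <= q i].
  have c1 : cov rho 1 (eball x0 rho).
    by exists [:: x0]; split=> // p px; exists x0; rewrite // mem_head.
  have [i [p px [Sp qi]]|s [sM sA]] := @count_pieces (eball x0 rho) rho 1 A rho0 c1.
    by split=> //; exists p.
  rewrite mul1r in sM; apply: cov_sub (pieces s) => //; last by rewrite mulr1.
  move=> p [px Pp [i Sp qi]]; split=> //; exists i => //; apply/sA.
  by exists p.
have midP k : cov r (N * M%:R) (mid k).
  pose A := [set i | [/\ 2 ^+ k * r <= q i, q i <= rho &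
    exists2 p, eball x0 rho p & (S i @` X) p]].
  have k1 : 1 <= (2 : R) ^+ k by rewrite exprn_ege1 // ler1n.
  have kr0 : 0 < 2 ^+ k * r by rewrite mulr_gt0 // exprn_gt0.
  have cG : cov (2 ^+ k * r) N (eball x0 ((1 + 2 * (Cg * Cg)) * rho) `&` F).
    by apply: cov_sub hF => //; rewrite ler_peMl // ltW.
  have [i [kq qrho [p px Sp]]|s [sM sA]] := count_pieces kr0 cG (A := A).
    split=> //; have [|Si Fi _ xi'] := center i p Sp px; first lra.
    by exists (S i f0).
  apply: cov_sub (pieces s) => //; last by rewrite mulr1.
  move=> p [px Pp [i Sp [kq qrho]]]; split=> //; exists i => //; apply/sA.
  by split=> //; exists p.
have midsP : cov r (K%:R * (N * M%:R)) (\bigcup_(k in [set k | (k < K)%N]) mid k).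
  by apply: (cov_bigcup_nat (F := mid)) => [k _|p [k kK mk]]; [exact: midP | exists k].
apply: cov_sub (cov_cup (cov_cup tinyP midsP) bigP) => //.
  move=> p [px Pp]; have [i _ Sp] := hP Pp.
  have [qr|rq] := leP (q i) r; first by left; left; split=> //; exists i.
  have [rhoq|qrho] := leP rho (q i); first by right; split=> //; exists i.
  left; right.
  have [|k /andP[k1 k2]] := @dyadic_scale (q i / r); first by rewrite ler_pdivlMr // mul1r ltW.
  have kq : 2 ^+ k * r <= q i by rewrite -ler_pdivlMr.
  exists k; last by split=> //; exists i => //; split=> //; exact: ltW.
  rewrite /= -(@ltr_eXn2l R 2) ?ltr1n //; apply: le_lt_trans k1 (lt_trans _ hK1).
  by rewrite ltr_pM2r // invr_gt0.
rewrite !mulrDl mul1r -/t taE.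
have b1 : N * M1 <= C * M1 * (t `^ alpha * t `^ e).
  rewrite /N mulrAC mulrA ler_peMr // !mulr_ge0 ?(ltW M10) ?(ltW C0) //; exact: ltW.
have b2 : K%:R * (N * M%:R) <= L * (C * M%:R) * (t `^ alpha * t `^ e).
  have -> : L * (C * M%:R) * (t `^ alpha * t `^ e) = L * t `^ e * (N * M%:R).
    by rewrite /N; ring.
  by rewrite ler_wpM2r // mulr_ge0.
have b3 : M%:R <= M%:R * (t `^ alpha * t `^ e).
  by rewrite ler_peMr // mulr_ege1 // powR_ge1.
have b4 : 0 <= t `^ alpha * t `^ e by rewrite mulr_ge0 ?powR_ge0.
lra.
Qed.

End Comparison.

(** * The upper bound *)

Section UpperBound.
Context {R : realType} {d : nat} {I : countType}.
Variables (X : set 'rV[R]_d) (S : I -> 'rV[R]_d -> 'rV[R]_d) (rr : seq I -> R).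
Variables (Cg xi : R) (M : nat).
Hypotheses (geo : conformal_geometry X S rr Cg xi M).
Hypotheses (SX : forall i, S i @` X `<=` X).
Local Notation F := (limit_set X S).
Variables (P : set 'rV[R]_d) (theta b m : R).
Hypotheses (P0 : P !=set0) (hP1 : forall i, exists! p, (P `&` S i @` X) p).
Hypotheses (th01 : 0 < theta < 1) (bm : b <= m).
Hypotheses (boxF : forall e : R, 0 < e -> exists2 C : R, 0 < C &
  forall r, 0 < r <= 1 -> cov r (C * r `^ (- (b + e))) F).
Hypotheses (profile_le : forall phi, theta <= phi -> phi < 1 ->
  spectrum_profile P phi + (theta^-1 - phi^-1) * b <= m * (theta^-1 - 1)).
Implicit Types (x y z : 'rV[R]_d) (r rho s t phi e : R).

Local Notation q i := (rr [:: i]).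

Let Cg0 : 0 < Cg. Proof. exact: lt_le_trans (geo_C geo). Qed.
Let FX : F `<=` X. Proof. exact: limit_set_sub SX. Qed.
Let th0 : 0 < theta. Proof. by case/andP: th01. Qed.
Let th1 : theta < 1. Proof. by case/andP: th01. Qed.
Let tau1 : 0 < theta^-1 - 1. Proof. by rewrite subr_gt0 invf_gt1. Qed.

Lemma upper_spectrum_theta_le : upper_assouad_spectrum theta P <= m.
Proof.
have := profile_le (lexx _) th1; rewrite subrr mul0r addr0 /spectrum_profile.
by rewrite mulrC ler_pM2r.
Qed.

Let m0 : 0 <= m.
Proof. exact: le_trans (upper_spectrum_ge0 th01 P0) upper_spectrum_theta_le. Qed.

(* The pair of scales (rho, s) is written (exp (- l), exp (- u l)), so that
   u = 1 / phi; the constant has to be uniform in u. *)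
Let profile_bound e l u := expR (l * (e + m * (theta^-1 - 1) - b * (theta^-1 - u))).

(** The cover comes from the spectrum of [P] at phi = 1/v and the finer scale exp(-v l), so one
    constant serves all u in [v - eta, v]. Lowering u moves the target exponent by at most eta |b|
    <= e/2, and the slack e' costs (v - 1) e' <= e/2 because v <= 1/theta. *)
Lemma profile_cov_step (A e eta v : R) : 0 < e -> eta * `|b| <= e / 2 ->
  1 < v <= theta^-1 -> exists2 C : R, 0 < C &
  forall x l u, 0 <= l -> v - eta <= u <= v ->
    cov (expR (- (u * l))) (C * profile_bound e l u)
      (eball x (A * expR (- l)) `&` P).
Proof.
move=> e0 etab /andP[v1 vth]; have v0 : 0 < v by exact: lt_trans v1.
have thv : theta <= v^-1 by rewrite -[theta]invrK lef_pV2 ?posrE ?invr_gt0.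
have v11 : v^-1 < 1 by rewrite invf_lt1.
have phi01 : 0 < v^-1 < 1 by rewrite invr_gt0 v0.
pose e' := theta * e / 2; have e'0 : 0 < e' by rewrite !mulr_gt0.
have adm := @upper_spectrum_lt _ _ v^-1 P phi01 P0
  (upper_assouad_spectrum v^-1 P + e') ltac:(by rewrite ltrDl).
have [C C0 hC] := upper_admissible_ball A adm; exists C => // x l u l0 /andP[uv1 uv2].
have rho01 : 0 < expR (- l) <= 1 by rewrite expR_gt0 expR_le1 oppr_le0.
have rE : expR (- l) `^ v = expR (- (v * l)).
  by rewrite powR_expR ?expR_gt0 // expRK mulrN.
have := hC x (expR (- (v * l))) (expR (- l)) rho01.
rewrite invrK rE expR_gt0 lexx => /(_ isT); apply: cov_sub => //.
  by rewrite ler_expR lerN2 ler_wpM2r.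
rewrite ler_pM2l // powR_expR ?divr_gt0 ?expR_gt0 // -expRB expRK ler_expR.
have := profile_le thv v11; rewrite /spectrum_profile invrK => h.
have -> : - l - - (v * l) = l * (v - 1) by ring.
rewrite mulrC -mulrA ler_wpM2l //.
have h1 : (v - 1) * e' <= e / 2.
  rewrite /e' mulrA mulrA ler_pM2r ?invr_gt0 // ler_piMl ?(ltW e0) //.
  apply: (@le_trans _ _ (theta^-1 * theta)); last by rewrite mulVf // gt_eqF.
  by rewrite ler_pM2r //; lra.
have h2 : b * (v - u) <= eta * `|b|.
  apply: le_trans (ler_norm _) _; rewrite normrM mulrC ler_wpM2r //.
  by rewrite ger0_norm; lra.
by rewrite mulrDr; lra.
Qed.

Lemma profile_cov (A e : R) : 0 < e -> exists2 C : R, 0 < C &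
  forall x l u, 0 <= l -> 1 < u <= theta^-1 ->
    cov (expR (- (u * l))) (C * profile_bound e l u)
      (eball x (A * expR (- l)) `&` P).
Proof.
move=> e0; pose eta := e / 2 / (`|b| + 1).
have b1 : 0 < `|b| + 1 by rewrite ltr_wpDl.
have eta0 : 0 < eta by rewrite !divr_gt0.
have etab : eta * `|b| <= e / 2.
  by rewrite /eta mulrAC ler_pdivrMr // ler_pM2l ?divr_gt0 // lerDl.
have grid n : exists2 C : R, 0 < C &
    forall x l u, 0 <= l -> 1 < u <= theta^-1 -> theta^-1 - n%:R * eta <= u ->
    cov (expR (- (u * l))) (C * profile_bound e l u)
      (eball x (A * expR (- l)) `&` P).
  elim: n => [|n [C C0 IH]].
    have [|C C0 hC] := @profile_cov_step A e eta theta^-1 e0 etab.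
      by rewrite lexx invf_gt1 // th1.
    exists C => // x l u l0 /andP[u1 u2]; rewrite mul0r subr0 => u3.
    by apply: hC => //; rewrite u2 andbT; lra.
  pose v := theta^-1 - n%:R * eta.
  have neta : 0 <= n%:R * eta by rewrite mulr_ge0 // ltW.
  have vth : v <= theta^-1 by rewrite /v; lra.
  (* Once the grid has reached 1, all u > 1 are already served; otherwise 1/v is a legitimate phi <
     1. *)
  have [v1|v1] := ltP 1 v; last first.
    exists C => // x l u l0 u12 _; apply: IH => //; case/andP: u12 => u1 _.
    by apply: le_trans v1 _; exact: ltW.
  have [|C' C'0 hC'] := @profile_cov_step A e eta v e0 etab; first by rewrite v1.
  exists (C + C') => [|x l u l0 u12 un]; first by rewrite addr_gt0.
  have pb := expR_ge0 (l * (e + m * (theta^-1 - 1) - b * (theta^-1 - u))).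
  have [vu|uv] := leP v u.
    apply: cov_sub (IH x l u l0 u12 vu) => //.
    by rewrite ler_wpM2r // lerDl ltW.
  apply: cov_sub (hC' x l u l0 _) => //; last first.
    rewrite (ltW uv) andbT; apply: le_trans un; rewrite /v -natr1 mulrDl mul1r; lra.
  by rewrite ler_wpM2r // lerDr ltW.
have [C C0 hC] := grid (Num.truncn (theta^-1 / eta)).+1.
exists C => // x l u l0 u12; apply: hC => //; case/andP: u12 => u1 _.
have : theta^-1 < (Num.truncn (theta^-1 / eta)).+1%:R * eta.
  by rewrite -ltr_pdivrMr // truncnS_gt.
lra.
Qed.

(* [t] bounds the number of pieces of size about [s] near [x], and the power of [s / r]
   is the cost of covering each of them at scale [r]. *)
Lemma scale_cost (A1 A2 e : R) : 0 < e -> 0 <= A1 -> exists2 C : R, 0 < C &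
  forall x rho s r, 0 < rho <= 1 -> 0 < r <= rho `^ theta^-1 -> r <= s -> s <= A1 * rho ->
  exists2 t, cov s t (eball x (A2 * rho) `&` P) &
    t * (s / r) `^ (b + e) <= C * (rho / r) `^ (m + 2 * e).
Proof.
move=> e0 A10.
have [M3 M31 hM3] := @doubling R d A2.
(* With this slack, exp(l e1) = rho^(-e1) is at most (rho / r)^e, since r <= rho^(1/theta). *)
pose e1 := e * (theta^-1 - 1); have e10 : 0 < e1 by rewrite mulr_gt0.
have [C1 C10 hC1] := profile_cov A2 e10.
have adm : upper_admissible theta P (m + e).
  apply: (upper_spectrum_lt th01 P0); apply: le_lt_trans upper_spectrum_theta_le _.
  by rewrite ltrDl.
have [C2 C20 hC2] := upper_admissible_ball A2 adm.
pose K := M3 * (A1 + 1) `^ (m + e).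
have A11 : 0 < A1 + 1 by rewrite ltr_wpDl.
have K0 : 0 < K by rewrite mulr_gt0 ?powR_gt0 // (lt_le_trans ltr01).
exists (C1 + C2 + K); first by rewrite !addr_gt0.
move=> x rho s r rho01 r01 rs sA; have /andP[rho0 rho1] := rho01; have /andP[r0 rrho] := r01.
have T1 := scale_ratio_ge1 th01 rho01 r01; have T0 : 0 < rho / r by rewrite divr_gt0.
have s0 : 0 < s by exact: lt_le_trans rs.
have sr1 : 1 <= s / r by rewrite ler_pdivlMr // mul1r.
have me0 : 0 <= m + e by rewrite addr_ge0 // ltW.
have Tle : (rho / r) `^ (m + e) <= (rho / r) `^ (m + 2 * e) by apply: ler_powR => //; lra.
have srle : (s / r) `^ (b + e) <= (s / r) `^ (m + e) by apply: ler_powR => //; rewrite lerD2r.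
have T20 : 0 <= (rho / r) `^ (m + 2 * e) by exact: powR_ge0.
(* The scale [s] may exceed [rho], though by no more than the factor [A1]; then the bounded number
   [M3] of balls suffices. *)
have [rhos|srho] := leP rho s.
  exists M3.
    exact: (cov_sub (@subIsetl _ _ _) rhos (lexx _) (hM3 x rho rho0)).
  apply: (@le_trans _ _ (K * (rho / r) `^ (m + 2 * e))); last first.
    by rewrite ler_wpM2r // lerDr addr_ge0 // ltW.
  rewrite /K -mulrA ler_wpM2l ?(le_trans ler01) //.
  apply: le_trans srle _; apply: (@le_trans _ _ ((A1 + 1) `^ (m + e) * (rho / r) `^ (m + e))); last first.
    by rewrite ler_wpM2l ?powR_ge0.
  rewrite -powRM ?(ltW A11) ?(ltW T0) //; apply: ge0_ler_powR;
    rewrite ?nnegrE ?mulr_ge0 ?invr_ge0 ?(ltW A11) ?(ltW T0) ?(ltW s0) ?(ltW r0) ?(ltW rho0) //.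
  rewrite mulrA ler_pM2r ?invr_gt0 //; apply: le_trans sA _.
  by rewrite ler_wpM2r ?(ltW rho0) // lerDl.
(* Below rho^(1/theta) the upper spectrum of [P] at theta applies directly, since it is at most
   [m]. *)
have [sth|ths] := leP s (rho `^ theta^-1).
  exists (C2 * (rho / s) `^ (m + e)); first by apply: hC2 => //; rewrite s0.
  apply: (@le_trans _ _ (C2 * (rho / r) `^ (m + 2 * e))); last first.
    by rewrite ler_wpM2r // addrAC lerDr addr_ge0 // ltW.
  rewrite -mulrA ler_pM2l //.
  apply: le_trans (ler_wpM2l (powR_ge0 _ _) srle) _; apply: le_trans Tle.
  rewrite -powRM ?divr_ge0 ?(ltW s0) ?(ltW r0) ?(ltW rho0) //.
  by have -> : rho / s * (s / r) = rho / r by field; rewrite !gt_eqF.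
have l0 : 0 < - ln rho.
  rewrite oppr_gt0 ln_lt0 // rho0 /= lt_neqAle rho1 andbT; apply: contraTN ths => /eqP rhoE.
  by rewrite -leNgt rhoE powR1 -rhoE ltW.
pose l := - ln rho; pose u := ln s / ln rho; pose z := - ln r.
have lE : ln rho = - l by rewrite opprK.
have lnE : ln rho != 0 by rewrite lE oppr_eq0 gt_eqF.
have ulE : u * l = - ln s by rewrite /u /l mulrN divfK.
have u12 : 1 < u <= theta^-1.
  rewrite -(ltr_pM2r l0) -(ler_pM2r l0) -/l ulE mul1r ltrN2 ltr_ln ?posrE // srho /=.
  by rewrite mulrN lerN2 -ln_powR ler_ln ?posrE ?powR_gt0 // ltW.
have rhoE : expR (- l) = rho by rewrite opprK lnK.
have sE : expR (- (u * l)) = s by rewrite ulE opprK lnK.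
have := hC1 x l u (ltW l0) u12; rewrite rhoE sE => cs.
eexists; first exact: cs.
apply: (@le_trans _ _ (C1 * (rho / r) `^ (m + 2 * e))); last first.
  by rewrite ler_wpM2r // -addrA lerDl addr_ge0 // ltW.
rewrite -mulrA ler_pM2l // /profile_bound.
rewrite (@powR_expR _ (s / r)) ?divr_gt0 // (@powR_expR _ (rho / r)) ?divr_gt0 //.
rewrite -expRD ler_expR !ln_div ?posrE //.
have -> : ln s - ln r = z - u * l by rewrite ulE /z; ring.
have -> : ln rho - ln r = z - l by rewrite lE /z; ring.
have zl : l * theta^-1 <= z.
  by rewrite /l /z mulNr lerN2 mulrC -ln_powR ler_ln ?posrE ?powR_gt0.
have ul : l <= u * l by rewrite ler_peMl ?(ltW l0) // ltW; case/andP: u12.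
(* The terms in [b] add up to b (z - l / theta), the price of r being smaller than rho^(1/theta); it
   is absorbed by b <= m. *)
have h1 : b * (z - l * theta^-1) <= m * (z - l * theta^-1) by rewrite ler_wpM2r // subr_ge0.
have h2 : e * (l * theta^-1) <= e * z by rewrite ler_pM2l.
have h3 : e * l <= e * (u * l) by rewrite ler_pM2l.
rewrite /e1; lra.
Qed.

(** This contains what remains of [F] after pulling back: the ratio of the first letter is bounded
    above only. *)
Definition small_pieces A x rho : set 'rV[R]_d :=
  [set y | eball x (A * rho) y /\
     exists2 i, q i <= A * rho & exists2 z, F z & y = S i z].

(** Two of the three [e] come from [scale_cost], the third pays for the number of dyadic sizes
    between r and A rho. *)
Lemma small_pieces_cov (A e : R) : 0 < e -> 1 <= A -> exists2 C : R, 0 < C &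
  forall x r rho, 0 < rho <= 1 -> 0 < r <= rho `^ theta^-1 ->
    cov r (C * (rho / r) `^ (m + 3 * e)) (small_pieces A x rho).
Proof.
move=> e0 A1; have A0 : 0 < A by exact: lt_le_trans A1.
have CC0 : 0 <= Cg * Cg by rewrite mulr_ge0 // ltW.
pose A2 := A * (1 + Cg * Cg).
have [C C0 hC] := @scale_cost A A2 e e0 (ltW A0).
have [B B0 hB] := boxF e0.
have adm : upper_admissible theta P (m + e).
  apply: (upper_spectrum_lt th01 P0); apply: le_lt_trans upper_spectrum_theta_le _.
  by rewrite ltrDl.
have [C2 C20 hC2] := upper_admissible_ball A2 adm.
have [M1 M11 hM1] := @cov_rescale R d (1 + Cg * Cg).
have [M2 M21 hM2] := @cov_expanding R d (2 * Cg).
have [L L0 hL] := @exponential_count R 2 e ltac:(by rewrite ltr1n) e0.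
have M10 : 0 < M1 by exact: lt_le_trans M11.
have M20 : 0 < M2 by exact: lt_le_trans M21.
pose K1 := C2 * M1; pose K2 := L * A `^ e * (M%:R * (B * M2) * C).
have Ae : 0 < A `^ e by exact: powR_gt0.
have K20 : 0 <= K2 by rewrite !mulr_ge0 // ltW.
exists (K1 + K2); first by rewrite ltr_pwDl // mulr_gt0.
move=> x r rho rho01 r01; have /andP[rho0 rho1] := rho01; have /andP[r0 rrho] := r01.
have T1 := scale_ratio_ge1 th01 rho01 r01; have T0 : 0 < rho / r by rewrite divr_gt0.
pose T := rho / r; rewrite -/T.
pose tiny := [set y | small_pieces A x rho y /\
  exists2 i, q i <= r & exists2 z, F z & y = S i z].
pose mid k := [set y | small_pieces A x rho y /\
  exists2 i, [/\ 2 ^+ k * r <= q i, q i <= 2 ^+ k.+1 * r & q i <= A * rho] &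
    exists2 z, F z & y = S i z].
(* Every piece has its point of [P] within Cg^2 q i <= Cg^2 A rho, hence the radius A2 rho. *)
have transversal i z : F z -> eball x (A * rho) (S i z) -> q i <= A * rho ->
    exists2 p, (eball x (A2 * rho) `&` P) p & (S i @` X) p /\ enorm (S i z - p) <= Cg * Cg * q i.
  move=> Fz zx qi; have [p [[Pp Sp] _]] := hP1 i; exists p.
    split=> //; rewrite /eball /= in zx *.
    have Sz : (S i @` X) (S i z) by exists z => //; exact: FX.
    have := piece_diam geo Sp Sz; have := enorm_tri p (S i z) x.
    have := ler_wpM2l CC0 qi; rewrite /A2; lra.
  by split=> //; apply: (piece_diam geo) => //; exists z => //; exact: FX.
have [Kn hK1 hK2] := hL (A * T) ltac:(by rewrite mulr_ege1).
have tinyP : cov r (C2 * T `^ (m + e) * M1) tiny.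
  apply: (hM1 r ((1 + Cg * Cg) * r)) => //.
  have [c [cN hc]] := hC2 x r rho rho01 r01; exists c; split=> // y [[yx _] [i qi [z Fz yE]]].
  have [||p xp [Sp yp]] := transversal i z Fz; first by rewrite -yE.
    apply: le_trans qi _; rewrite -[r]mul1r; apply: ler_pM => //; first exact: ltW.
    by rewrite -[r]mul1r -ler_pdivlMr.
  have [a ac ap] := hc p xp; exists a => //; rewrite /eball /= in ap *.
  rewrite -yE in yp; have := enorm_tri y p a; have := ler_wpM2l CC0 qi; lra.
have midP k : cov r (M%:R * (B * M2) * (C * T `^ (m + 2 * e))) (mid k).
  have k0 : 0 < (2 : R) ^+ k by rewrite exprn_gt0.
  have k1 : 1 <= (2 : R) ^+ k by rewrite exprn_ege1 // ler1n.
  have c0 : 0 <= M%:R * (B * M2) * (C * T `^ (m + 2 * e)).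
    by rewrite !mulr_ge0 ?powR_ge0 // ltW.
  pose s := 2 ^+ k * r; have s0 : 0 < s by rewrite mulr_gt0.
  have rs : r <= s by rewrite ler_peMl // ltW.
  (* For s > A rho no piece of size at least [s] is small, so there is nothing to cover. *)
  have [sA|As] := leP s (A * rho); last first.
    by apply: cov0 => // y [_ [i [h1 _ h2] _]]; move: As; rewrite ltNge (le_trans h1).
  have [t ct tle] := hC x rho s r rho01 r01 rs sA.
  pose E i := [set y | exists2 z, F z & y = S i z].
  pose J := [set i | [/\ s <= q i, q i <= 2 * s &
    exists2 p, (eball x (A2 * rho) `&` P) p & (S i @` X) p]].
  have [i [h1 h2 h3]|js [szj hj]] := count_pieces geo s0 ct (A := J); first by [].
  have t0 := cov_ge0 ct.
  (* S_i has Lipschitz constant at most Cg q i <= 2 Cg s, so it carries a cover of [F] at scale r /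
     s to one at scale 2 Cg r. *)
  have EP i : i \in js -> cov r (B * (s / r) `^ (b + e) * M2) (E i).
    move=> /hj[sq qs _]; have q0 := geo_gt0 geo [:: i].
    have := hB (r / s); rewrite divr_gt0 // ler_pdivrMr // mul1r rs => /(_ isT).
    have -> : (r / s) `^ (- (b + e)) = (s / r) `^ (b + e).
      rewrite !powR_expR ?divr_gt0 //; congr expR.
      by rewrite !ln_div ?posrE //; ring.
    apply: (hM2 (fun y z => y = S i z /\ X z) (Cg * q i)) => //.
    - by rewrite mulr_ge0 // ltW.
    - rewrite mulrA ler_pdivrMr //.
      have := ler_wpM2l (ltW (mulr_gt0 Cg0 r0)) qs; lra.
    - by move=> y [z Fz ->]; exists z => //; split=> //; exact: FX.
    - by move=> y y' z z' [-> Xz] [-> Xz']; exact: (geo_upper geo [:: i] Xz Xz').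
  have := cov_bigcup EP (fun y h => h : (exists2 i, i \in js & E i y)).
  apply: cov_sub => //.
    move=> y [[yx _] [i [h1 h2 h3] [z Fz yE]]]; exists i; last by exists z.
    apply/hj; split=> //; first by rewrite /s mulrA -exprS.
    by have [|p xp [Sp _]] := transversal i z Fz _ h3; [rewrite -yE | exists p].
  apply: (@le_trans _ _ (t * M%:R * (B * (s / r) `^ (b + e) * M2))).
    by rewrite ler_wpM2r // !mulr_ge0 ?powR_ge0 // ltW.
  have -> : t * M%:R * (B * (s / r) `^ (b + e) * M2) =
    M%:R * (B * M2) * (t * (s / r) `^ (b + e)) by ring.
  by rewrite ler_wpM2l // !mulr_ge0 // ltW.
have midsP := @cov_bigcup_nat _ _ Kn mid r _ (\bigcup_(k in [set k | (k < Kn)%N]) mid k)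
  (fun k _ => midP k) (fun y h => let: ex_intro2 k kK yk := h in ex_intro2 _ _ k kK yk).
apply: cov_sub (cov_cup tinyP midsP) => //.
  move=> y sy; have [yx [i qi [z Fz yE]]] := sy.
  have [qr|rq] := leP (q i) r; first by left; split=> //; exists i => //; exists z.
  right; have [|k /andP[k1 k2]] := @dyadic_scale _ (q i / r).
    by rewrite ler_pdivlMr // mul1r ltW.
  exists k.
    rewrite /= -(@ltr_eXn2l R 2) ?ltr1n //; apply: le_lt_trans k1 (le_lt_trans _ hK1).
    by rewrite /T mulrA ler_pM2r // invr_gt0.
  split=> //; exists i; last by exists z.
  split=> //; first by rewrite -ler_pdivlMr.
  by rewrite -ler_pdivrMr // ltW.
have Ta : T `^ (m + 3 * e) = T `^ (m + 2 * e) * T `^ e.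
  by rewrite -powRD_gt0 //; congr (_ `^ _); ring.
rewrite [leRHS]mulrDl; apply: lerD.
  rewrite /K1 mulrAC ler_wpM2l ?mulr_ge0 ?(ltW C20) ?(ltW M10) //.
  by apply: ler_powR => //; lra.
apply: (@le_trans _ _ (L * (A * T) `^ e * (M%:R * (B * M2) * (C * T `^ (m + 2 * e))))).
  by rewrite ler_wpM2r // !mulr_ge0 ?powR_ge0 // ltW.
rewrite powRM ?(ltW A0) ?(ltW T0) // Ta /K2 le_eqVlt; apply/orP; left; apply/eqP.
ring.
Qed.

(* Each point of F near x is coded by a maximal prefix v with [rho <= rr v], followed
   by a letter of small ratio; pulling back by S_v reduces to [small_pieces_cov]. *)
Lemma limit_set_admissible (e : R) : 0 < e -> admissible theta F (m + 4 * e).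
Proof.
move=> e0; have C1 := geo_C geo; have /andP[xi0 xi1] := geo_xi geo.
(* Two points of B(x, rho) are less than 2 rho apart, and pulling back costs [Cg]; the letter after
   the prefix has ratio at most Cg rho / rr v, so 2 Cg serves both purposes. *)
have [C C0 hC] := @small_pieces_cov (2 * Cg) e e0 ltac:(lra).
(* Prefix lengths number about log (1 / rho), and rho^(-e1) is exactly (rho / r)^e when r =
   rho^(1/theta). *)
pose e1 := e * (theta^-1 - 1); have e10 : 0 < e1 by rewrite mulr_gt0.
have [L L0 hL] := @exponential_count R xi^-1 e1 ltac:(by rewrite invf_gt1) e10.
have [M1 M11 hM1] := @cov_expanding R d Cg.
have M10 : 0 < M1 by exact: lt_le_trans M11.
exists (L * (M%:R * (C * M1)) + 1).
  by rewrite ltr_wpDl // !mulr_ge0 // ltW.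
move=> x rho Fx rho01; have /andP[rho0 rho1] := rho01.
pose r := rho `^ theta^-1; have r0 : 0 < r by exact: powR_gt0.
have rrho : r <= rho by exact: powR_theta_le.
pose T := rho / r; have T1 : 1 <= T by rewrite ler_pdivlMr // mul1r.
have T0 : 0 < T by exact: lt_le_trans T1.
have TE (a : R) : rho `^ (a * (1 - theta^-1)) = T `^ a.
  by rewrite (mulrC a) powRrM powRB_gt0 // powRr1 // ltW.
rewrite TE -/r.
have [K hK1 hK2] := hL rho^-1 ltac:(by rewrite invf_ge1).
have Te : rho^-1 `^ e1 = T `^ e.
  rewrite -TE -powR_inv1 ?(ltW rho0) // -powRrM; congr (_ `^ _).
  by rewrite /e1 mulN1r -mulrN opprB.
rewrite Te in hK2.
have c0 : 0 <= C * T `^ (m + 3 * e) * M1 by rewrite !mulr_ge0 ?powR_ge0 // ltW.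
pose E v := [set y | [/\ eball x rho y, F y & exists i z, [/\ F z,
  y = word_map S v (S i z) & q i <= 2 * Cg * (rho / rr v)]]].
have EP v : rho <= rr v -> cov r (C * T `^ (m + 3 * e) * M1) (E v).
  move=> rv; have v0 := geo_gt0 geo v.
  have v1 : rr v <= 1 by apply: le_trans (geo_le geo v) _; rewrite exprn_ile1 // ltW.
  have [[y0 [y0x Fy0 [i0 [z0 [Fz0 y0E q0]]]]]|no] := pselect (exists y, E v y); last first.
    by apply: cov0 => // y yE; apply: no; exists y.
  have rho'01 : 0 < rho / rr v <= 1 by rewrite divr_gt0 // ler_pdivrMr // mul1r.
  (* The pulled-back pair satisfies only an inequality, because rr v <= 1 and 1/theta > 1. *)
  have r'01 : 0 < r / rr v <= (rho / rr v) `^ theta^-1.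
    rewrite divr_gt0 //= powRM ?invr_ge0 ?(ltW rho0) ?(ltW v0) // ler_pM2l //.
    by apply: le1r_powR; rewrite invf_ge1 // ltW.
  have := hC (S i0 z0) (r / rr v) (rho / rr v) rho'01 r'01.
  have -> : rho / rr v / (r / rr v) = T by rewrite /T; field; rewrite !gt_eqF.
  apply: (hM1 (fun y z => y = word_map S v z /\ X z) (Cg * rr v)) => //.
  - by rewrite mulr_ge0 // ltW.
  - by rewrite -mulrA ler_pM2l // mulrCA divff ?mulr1 // gt_eqF.
  - move=> y [yx Fy [i [z [Fz yE qi]]]]; exists (S i z); last first.
      by split=> //; exact: (word_map_stable SX [:: i] (FX Fz)).
    have XS := word_map_stable SX [:: i] (FX Fz).
    have XS0 := word_map_stable SX [:: i0] (FX Fz0).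
    split; last by exists i => //; exists z.
    rewrite /eball /= in yx y0x *.
    have := geo_lower geo v XS XS0; rewrite /= -yE -y0E => h.
    have h2 : enorm (y - y0) < 2 * rho.
      by have := enorm_tri y x y0; rewrite (enormB x); lra.
    have h3 : Cg * enorm (y - y0) < Cg * (2 * rho) by rewrite ltr_pM2l.
    rewrite mulrA ltr_pdivlMr //; lra.
  - by move=> y y' z z' [-> Xz] [-> Xz']; exact: (geo_upper geo).
(* For one word length, at most [M] prefixes of ratio at least [rho] reach the ball. *)
have lev n : cov r (M%:R * (C * T `^ (m + 3 * e) * M1))
    [set y | exists2 v, size v = n /\ rho <= rr v & E v y].
  pose J := [set v : seq I | [/\ size v = n, rho <= rr v & exists y, E v y]].
  have [s us sJ|s [sM sJ]] := @finite_enumeration _ J M.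
    apply: (geo_overlap geo (n := n) (z := x) rho0 us) => v /sJ[-> rv [y [yx Fy [i [z [Fz yE _]]]]]].
    by split=> //; exists (S i z); [exact: (word_map_stable SX [:: i] (FX Fz)) | rewrite -yE].
  have := @cov_bigcup _ _ _ s E r _ [set y | exists2 v, size v = n /\ rho <= rr v & E v y]
    (fun v vs => EP v (let: And3 _ h _ := (sJ v).2 vs in h)).
  move=> h; apply: (@cov_sub _ _ r r _ _ _ [set y | exists2 v, size v = n /\ rho <= rr v & E v y]) (h _) => //.
    by rewrite ler_wpM2r // ler_nat.
  by move=> y [v [sv rv] yE]; exists v => //; apply/sJ; split=> //; exists y.
apply: (@cov_sub _ _ r r (K%:R * (M%:R * (C * T `^ (m + 3 * e) * M1))) _ _ (eball x rho `&` F)) => //.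
  have -> : T `^ (m + 4 * e) = T `^ e * T `^ (m + 3 * e).
    by rewrite -powRD_gt0 //; congr (_ `^ _); ring.
  apply: (@le_trans _ _ (L * T `^ e * (M%:R * (C * T `^ (m + 3 * e) * M1)))).
    by rewrite ler_wpM2r // mulr_ge0.
  have : 0 <= T `^ e * T `^ (m + 3 * e) by rewrite mulr_ge0 ?powR_ge0.
  lra.
apply: (cov_bigcup_nat (F := fun n => [set y | exists2 v, size v = n /\ rho <= rr v & E v y])) => //.
move=> y [yx Fy]; have [w hw] := limit_set_prefix geo SX Fy.
have K0 : (0 < K)%N.
  case: (K) hK1 => //; rewrite expr0 => h.
  by have := le_lt_trans (_ : 1 <= rho^-1) h; rewrite invf_ge1 // ltxx => /(_ rho1).
have xiK : xi ^+ K < rho.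
  by move: hK1; rewrite exprVn ltf_pV2 ?posrE ?exprn_gt0.
(* The search runs over [n.+1], so that the prefix of length [n] still has ratio at least [rho]; for
   n = 0 this is the empty word, of ratio 1. *)
have ex : exists n, rr (mkseq w n.+1) < rho.
  exists K.-1; rewrite prednK //; apply: le_lt_trans xiK.
  by apply: le_trans (geo_le geo _) _; rewrite size_mkseq.
case: (ex_minnP ex) => n hn nmin.
have nK : (n < K)%N.
  rewrite -(prednK K0) ltnS; apply: nmin; rewrite prednK //; apply: le_lt_trans xiK.
  by apply: le_trans (geo_le geo _) _; rewrite size_mkseq.
have rn : rho <= rr (mkseq w n).
  case: n hn nmin {nK} => [|n] hn nmin; first by rewrite (geo_nil geo).
  by rewrite leNgt; apply/negP => /nmin; rewrite ltnn.
exists n => //; exists (mkseq w n); first by rewrite size_mkseq.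
have [z Fz yE] := hw n; split=> //; exists (w n), z; split=> //.
have v0 := geo_gt0 geo (mkseq w n).
have := geo_rcons geo (mkseq w n) (w n); rewrite -mkseqS => h.
rewrite mulrA ler_pdivlMr // mulrC; apply: le_trans h _.
have : Cg * rr (mkseq w n.+1) <= Cg * rho by rewrite ler_pM2l // ltW.
have : 0 <= Cg * rho by rewrite mulr_ge0 // ltW.
lra.
Qed.

End UpperBound.

Theorem theorem4p4 (R : realType) (d : nat) (hd : (0 < d)%N) (I : countType)
    (X : set 'rV[R]_d) (S : I -> 'rV[R]_d -> 'rV[R]_d) (hS : is_CIFS X S)
    (P : set 'rV[R]_d) (hP : P `<=` \bigcup_i (S i @` X))
    (hP1 : forall i, exists! p, (P `&` S i @` X) p)
    (theta : R) (htheta : 0 < theta < 1) :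
  [/\ Num.max (hausdorff_dim (limit_set X S)) (upper_assouad_spectrum theta P)
        <= upper_assouad_spectrum theta (limit_set X S),
      upper_assouad_spectrum theta (limit_set X S)
        = assouad_spectrum theta (limit_set X S) &
      exists2 m : R,
        is_maximum [set spectrum_bound P (limit_set X S) theta phi
                   | phi in [set phi : R | theta <= phi <= 1]] m &
        assouad_spectrum theta (limit_set X S) <= m].
Proof.
have [rr [Cg [xi [M geo]]]] := cifs_geometry hd hS.
have [I0 cX _ SX [Xo _ _] _ _] := hS; have [i0 _] := I0.
have X0 : X !=set0 by have [x xX] := Xo; exists x; exact: interior_subset.
set F := limit_set X S.
have FX : F `<=` X := limit_set_sub SX.
have F0 : F !=set0 := limit_set_nonempty geo SX I0 cX X0.
have bF : bounded_set F.
  have [B [Br hB]] := compact_bounded cX; exists B; split=> // y By x Fx.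
  exact: (hB y By x (FX x Fx)).
have P0 : P !=set0 by have [p [[Pp _] _]] := hP1 i0; exists p.
have specE : upper_assouad_spectrum theta F = assouad_spectrum theta F.
  rewrite upper_assouad_spectrumE // assouad_spectrumE; congr inf.
  apply/seteqP; split=> alpha /=; first exact: upper_admissible_spec.
  exact: (admissible_upper geo SX I0 htheta).
have [m mmax] := spectrum_bound_max F P0 htheta.
have /andP[th0 th1] := htheta.
have tau : 0 < theta^-1 - 1 by rewrite subr_gt0 invf_gt1.
have boundm phi : theta <= phi <= 1 -> spectrum_bound P F theta phi <= m.
  by move=> h; apply: mmax.2; exists phi.
split=> //; last first.
  exists m => //; rewrite -specE; apply: upper_spectrum_le_eps => // e e0.
  apply: (admissible_upper geo SX I0 htheta).
  have -> : m + e = m + 4 * (e / 4) by field.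
  apply: (limit_set_admissible geo SX P0 hP1 htheta (b := upper_box_dim F)).
  (* At phi = 1 the bound f equals the upper box dimension of F, hence b <= m. *)
  - have := boundm 1; rewrite lexx ltW // => /(_ isT).
    rewrite /spectrum_bound invr1 subrr mul0r add0r.
    by rewrite mulrAC divff ?mul1r // gt_eqF.
  - by move=> e' e'0; apply: upper_box_cov => //; rewrite ltrDl.
  - move=> phi h1 h2; have := boundm phi; rewrite h1 ltW // => /(_ isT).
    by rewrite /spectrum_bound ler_pdivrMr.
  - by rewrite divr_gt0.
rewrite ge_max; apply/andP; split; apply/ler_addgt0Pr => e e0.
  apply: (hausdorff_dim_le htheta F0 bF); apply: upper_spectrum_lt => //.
  by rewrite ltrDl.
apply: upper_spectrum_le => //.
have -> : upper_assouad_spectrum theta F + e =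
  upper_assouad_spectrum theta F + e / 2 + e / 2 by field.
apply: (upper_admissible_transversal geo SX F0 hP hP1) => //.
  by rewrite divr_gt0.
by apply: upper_spectrum_lt => //; rewrite ltrDl divr_gt0.
Qed.
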